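(* Let $s\in(0,1)$, let $u_0\in L^\infty(\mathbb{R}^d)$, and let $\Phi:\mathbb{R}\to\mathbb{R}$ be nondecreasing and locally Lipschitz. Then the very weak solution of the problem $$u_t=-(-\Delta)^s\,\Phi(u)\ \text{ in }\mathbb{R}^d\times\mathbb{R}^+,\qquad u=u_0\ \text{ on }\mathbb{R}^d\times\{0\},$$ is unique (as an element of $L^\infty(\mathbb{R}^d\times\mathbb{R}^+)$): any two very weak solutions with the same initial datum $u_0$ coincide a.e. in $\mathbb{R}^d\times\mathbb{R}^+$.
   Context: $\mathbb{R}^+=(0,\infty)$. The $s$-fractional Laplacian of a test function $\varphi\in C_c^\infty(\mathbb{R}^d)$ is $$(-\Delta)^s\varphi(x)=c_{d,s}\ \mathrm{p.v.}\int_{\mathbb{R}^d}\frac{\varphi(x)-\varphi(x')}{|x-x'|^{d+2s}}\,dx',\qquad c_{d,s}=\frac{2^{2s}s\,\Gamma(\frac d2+s)}{\pi^{d/2}\Gamma(1-s)};$$ for functions depending also on $t$ it acts in the variable $x$ only. Very weak solution: a measurable function $u$ is a very weak solution of the problem with datum $u_0$ if $u\in L^\infty(\mathbb{R}^d\times\mathbb{R}^+)$ and for a.e. $T>0$ $$\int_0^T\!\!\int_{\mathbb{R}^d}u\,\varphi_t\,dx\,dt=\int_0^T\!\!\int_{\mathbb{R}^d}\Phi(u)\,(-\Delta)^s\varphi\,dx\,dt+\int_{\mathbb{R}^d}u(x,T)\varphi(x,T)\,dx-\int_{\mathbb{R}^d}u_0(x)\varphi(x,0)\,dx$$ for every $\varphi\in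 C_c^\infty(\mathbb{R}^d\times[0,T])$. *)

(* Defs.v *)
From HB Require Import structures.
From mathcomp Require Import all_boot all_order all_algebra.
From mathcomp Require Import all_classical all_reals all_analysis.

Set Implicit Arguments.
Unset Strict Implicit.
Unset Printing Implicit Defensive.
Import Order.TTheory GRing.Theory Num.Theory.
Import numFieldNormedType.Exports.

Local Open Scope classical_set_scope.
Local Open Scope ring_scope.

(* Borel sigma-algebra of R^n = 'rV[R]_n, presented as the sigma-algebra
   generated by the coordinate maps (as the library does for n.-tuple). *)
Definition rV_display : measure_display. Proof. exact. Qed.

Section measurable_rV.
Variables (R : realType) (n : nat).

Let coords : 'I_n -> 'rV[R]_n -> R := fun i x => x ord0 i.

Let rV_set0 : g_sigma_preimage coords set0.
Proof. exact: sigma_algebra0. Qed.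

Let rV_setC A : g_sigma_preimage coords A -> g_sigma_preimage coords (~` A).
Proof. exact: sigma_algebraC. Qed.

Let rV_bigcup (F : (set 'rV[R]_n)^nat) :
  (forall i, g_sigma_preimage coords (F i)) ->
  g_sigma_preimage coords (\bigcup_i (F i)).
Proof. exact: sigma_algebra_bigcup. Qed.

HB.instance Definition _ := @isMeasurable.Build rV_display
  'rV[R]_n (g_sigma_preimage coords) rV_set0 rV_setC rV_bigcup.

End measurable_rV.

Lemma measurable_coord (R : realType) n (i : 'I_n) :
  measurable_fun [set: 'rV[R]_n] (fun x : 'rV[R]_n => x ord0 i).
Proof.
move=> _ Y mY; rewrite setTI; apply: sub_sigma_algebra => /=.
rewrite -bigcup_seq/=; exists i => /=; first by rewrite mem_index_enum.
by exists Y => //; rewrite setTI.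
Qed.

Lemma measurable_fun_rVP (R : realType) d (T : measurableType d) n
    (f : T -> 'rV[R]_n) :
  measurable_fun [set: T] f <->
  forall i, measurable_fun [set: T] (fun t => f t ord0 i).
Proof.
split=> [mf i|mf]; first exact: (measurableT_comp (measurable_coord i) mf).
move=> _ Y mY; rewrite setTI.
have : image_set_system [set: T] f measurable Y; last first.
  by rewrite /image_set_system/= setTI.
move: Y mY; apply: smallest_sub.
  by apply: sigma_algebra_image; exact: sigma_algebra_measurable.
move=> A; rewrite -bigcup_seq/= => -[i _ [B mB <-]].
rewrite /image_set_system/= !setTI -[X in measurable X]setTI; exact: mf.
Qed.

Section lebesgue_rV.
Variable R : realType.

Let cons_rV (n : nat) (p : R * 'rV[R]_n) : 'rV[R]_n.+1 := row_mx p.1%:M p.2.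

Let cons_rV0 n p : cons_rV (n := n) p ord0 ord0 = p.1.
Proof.
have -> : @ord0 n = lshift n (@ord0 0) by exact/val_inj.
by rewrite /cons_rV (row_mxEl p.1%:M p.2) mxE eqxx.
Qed.

Let cons_rVS n p (j : 'I_n) : cons_rV p ord0 (lift ord0 j) = p.2 ord0 j.
Proof.
have -> : lift ord0 j = rshift 1 j by exact/val_inj.
by rewrite /cons_rV (row_mxEr p.1%:M p.2).
Qed.

Let uncons_rV (n : nat) (x : 'rV[R]_n.+1) : R * 'rV[R]_n :=
  (x ord0 ord0, \row_j x ord0 (lift ord0 j)).

Let cons_rVK n : cancel (@cons_rV n) (@uncons_rV n).
Proof.
move=> [a v]; rewrite /uncons_rV cons_rV0; congr pair.
by apply/rowP => j; rewrite mxE cons_rVS.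
Qed.

Let measurable_cons_rV n : measurable_fun setT (@cons_rV n).
Proof.
apply/measurable_fun_rVP => i.
case: (unliftP ord0 i) => [j ->|->].
  under eq_fun do rewrite cons_rVS.
  exact: (measurableT_comp (measurable_coord j)).
under eq_fun do rewrite cons_rV0.
exact: measurable_fst.
Qed.

Let measurable_uncons_rV n : measurable_fun setT (@uncons_rV n).
Proof.
apply/measurable_fun_pair; first exact: measurable_coord.
apply/measurable_fun_rVP => j.
under eq_fun do rewrite mxE.
exact: measurable_coord.
Qed.

Section step.
Variables (n : nat) (m : {sigma_finite_measure set 'rV[R]_n -> \bar R}).

Definition rV_prod_measure : set 'rV[R]_n.+1 -> \bar R :=
  pushforward (lebesgue_measure \x m)%E
    (fun p : R * 'rV[R]_n => row_mx p.1%:M p.2 : 'rV[R]_n.+1).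

Let rV_prod_measure0 : rV_prod_measure set0 = 0%E.
Proof. by rewrite /rV_prod_measure /pushforward preimage_set0 measure0. Qed.

Let rV_prod_measure_ge0 A : (0 <= rV_prod_measure A)%E.
Proof. by rewrite /rV_prod_measure /pushforward; exact: measure_ge0. Qed.

Let rV_prod_measure_sigma_additive : semi_sigma_additive rV_prod_measure.
Proof.
apply: (@measure_semi_sigma_additive _ _ _
  (measure_function_pushforward__canonical__measure_function_Measure
    (lebesgue_measure \x m)%E (@measurable_cons_rV n))).
Qed.

HB.instance Definition _ := isMeasure.Build _ _ _ rV_prod_measure
  rV_prod_measure0 rV_prod_measure_ge0 rV_prod_measure_sigma_additive.

Let rV_prod_measure_sigma_finite : sigma_finite setT rV_prod_measure.
Proof.
have /sigma_finiteP[F [FT ndF Foo]] := sigma_finiteT (@lebesgue_measure R).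
have /sigma_finiteP[G [GT ndG Goo]] := sigma_finiteT m.
exists (fun k => @uncons_rV n @^-1` (F k `*` G k)).
  rewrite -preimage_bigcup -[LHS](preimage_setT (@uncons_rV n)).
  congr (_ @^-1` _); rewrite -setXTT FT GT predeqE => -[x y]; split.
    move=> [/= [i _ Fx] [j _ Gy]]; exists (maxn i j) => //; split.
      by move: x Fx; exact/subsetPset/ndF/leq_maxl.
    by move: y Gy; exact/subsetPset/ndG/leq_maxr.
  by move=> [k _ []/= ? ?]; split; exists k.
move=> k; have [mF Fk] := Foo k; have [mG Gk] := Goo k.
have mFG : measurable (F k `*` G k) by exact: measurableX.
split; first by rewrite -[X in measurable X]setTI; exact: measurable_uncons_rV.
rewrite /rV_prod_measure /pushforward -comp_preimage.
rewrite (_ : _ \o _ = id); last by apply/funext => p; exact: cons_rVK.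
by rewrite preimage_id product_measure1E// lte_mul_pinfty// ge0_fin_numE.
Qed.

HB.instance Definition _ := Measure_isSigmaFinite.Build _ _ _ rV_prod_measure
  rV_prod_measure_sigma_finite.

End step.

(* n-dimensional Lebesgue measure: R^0 carries the unit point mass and
   R^n.+1 = R * R^n the product measure. *)
Fixpoint lebesgue_rV n : {sigma_finite_measure set 'rV[R]_n -> \bar R} :=
  match n with
  | 0 => dirac (0 : 'rV[R]_0)
  | n'.+1 => rV_prod_measure (lebesgue_rV n')
  end.

End lebesgue_rV.
Arguments lebesgue_rV {R} n.

Section Gamma.
Variable R : realType.

(* Euler's Gamma function; the integral converges for 0 < x, the only range
   in which it is used below. *)
Definition Gamma (x : R) : R :=
  \int[lebesgue_measure]_(t in `]0, +oo[) (t `^ (x - 1) * expR (- t)).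

End Gamma.

Section test_functions.
Context {R : realType}.

Definition iter_derive (V : normedModType R) (vs : seq V) (f : V -> R) : V -> R :=
  foldr (fun v g => 'D_v g) f vs.

(* For finite-dimensional V (the only use below) this is C^oo: each iterated
   directional derivative, being differentiable, is continuous. *)
Definition smooth (V : normedModType R) (f : V -> R) : Prop :=
  forall (vs : seq V) (x : V), differentiable (iter_derive vs f) x.

Definition compactly_supported (V : normedModType R) (f : V -> R) : Prop :=
  compact (closure [set x | f x != 0]).

(* C_c^oo(R^d x [0,T]): restrictions to the closed slab of C_c^oo functions on
   R^d x R; no vanishing is imposed at t = 0 or t = T.  Such a function is
   represented by a total one whose values off the slab are irrelevant. *)
Definition Cc_infty_slab (d : nat) (T : R) (phi : 'rV[R]_d * R -> R) : Prop :=
  exists psi : 'rV[R]_d * R -> R,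
    [/\ smooth psi, compactly_supported psi &
        forall x t, 0 <= t <= T -> phi (x, t) = psi (x, t)].

End test_functions.

Section fractional_laplacian.
Context {R : realType} (d : nat).
Implicit Types (s : R) (x y : 'rV[R]_d).

(* The norm `|x| of the library on 'rV is the sup norm. *)
Definition enorm x : R := Num.sqrt (\sum_i x ord0 i ^+ 2).

Definition frac_lap_const s : R :=
  2 `^ (2 * s) * s * Gamma (d%:R / 2 + s) / (pi `^ (d%:R / 2) * Gamma (1 - s)).

Definition frac_lap s (f : 'rV[R]_d -> R) x : R :=
  frac_lap_const s *
  lim ((fun e : R => \int[lebesgue_rV d]_(y in [set y | e < enorm (x - y)])
          ((f x - f y) / enorm (x - y) `^ (d%:R + 2 * s))) @ 0^'+).

End fractional_laplacian.

Section very_weak_solution.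
Context {R : realType} (d : nat).

Definition lebesgue_st : {measure set ('rV[R]_d * measurableTypeR R)%type -> \bar R} :=
  (lebesgue_rV d \x lebesgue_measure)%E.

Definition upper_half : set ('rV[R]_d * R)%type := [set z | 0 < z.2].

Definition locally_lipschitz (Phi : R -> R) : Prop :=
  forall x : R, exists2 A : set R, nbhs x A & [lipschitz Phi y | y in A].

(* Solutions live on R^d x (0,oo) but are represented by total functions: their
   values at times t <= 0 are irrelevant (t = 0 is a null set of times). *)
Definition very_weak_solution (s : R) (Phi : R -> R) (u0 : 'rV[R]_d -> R)
    (u : 'rV[R]_d * R -> R) : Prop :=
  (u \_ upper_half) \in Lfun lebesgue_st +oo%E /\
  {ae lebesgue_measure, forall T : R, 0 < T ->
    forall phi : 'rV[R]_d * R -> R, Cc_infty_slab T phi ->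
    \int[lebesgue_measure]_(t in `[0, T]) \int[lebesgue_rV d]_x
      (u (x, t) * derive1 (fun t' => phi (x, t')) t) =
    \int[lebesgue_measure]_(t in `[0, T]) \int[lebesgue_rV d]_x
      (Phi (u (x, t)) * frac_lap s (fun x' => phi (x', t)) x)
    + \int[lebesgue_rV d]_x (u (x, T) * phi (x, T))
    - \int[lebesgue_rV d]_x (u0 x * phi (x, 0))}.

End very_weak_solution.
Arguments lebesgue_st {R} d.
Arguments upper_half {R} d.
Arguments very_weak_solution {R d} s Phi u0 u.

(* Main.v *)
Require Import Defs.
From HB Require Import structures.
From mathcomp Require Import all_boot all_order all_algebra.
From mathcomp Require Import all_classical all_reals all_analysis.
From mathcomp Require Import measurable_realfun ess_sup_inf.
From mathcomp Require Import ring lra.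

(** Uniqueness follows from a weighted energy estimate. Replace two solutions u
    and v by bounded representatives and put w = u - v, g = Phi(u) - Phi(v).
    Since Phi is nondecreasing and Lipschitz on bounded sets
    (locally_lipschitz_bounded), g^2 <= K g w pointwise.

    Test functions that do not depend on time are enough. With the mollifier
    J of radius r reflected at x, the two equations give (tested_equation), for
    almost every t and for every x,
      [J * w](x, t) = - c \int_0^t [Lap (J * g)](x, q) dq,
    where Lap is the fractional Laplacian without its constant c. Put
    f = J * g and F(x, t) = \int_0^t f(x, q) dq, multiply by f and integrate
    against a weight wt(x) in space and a weight th(t) in time. Without the
    weights the right-hand side would be a negative multiple of the time
    derivative of a squared seminorm of F. The weight in space, which is needed
    because the solutions are merely bounded, breaks this symmetry: grouping the
    points in pairs (symmetrized_lower_bound) one meets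
      (wt(x) f(x, t) - wt(y) f(y, t)) (F(x, t) - F(y, t)),
    whose integral against th is bounded from below, for each eta > 0, by that of
      - eta (wt(x) - wt(y))^2 / (wt(x) + wt(y)) (f(x, t)^2 + f(y, t)^2),
    provided that th decays at an exponential rate at least 1 / (2 eta)
    (pair_energy). The weight wt(x) = (1 + |x|)^-(d + 2s) decays like the kernel
    of Lap, and the integral of this factor against the kernel is therefore at
    most C0 wt (wtQ_int). This yields (energy_inequality, regularized_energy)
      \iint th wt f (J * w) <= c eta C0 \iint th wt f^2.
    Mollifications converge in the weighted L1 norm, since translations are
    continuous in it (bmeas_tcont). When r tends to 0 the integral of th wt g w
    is thus at most c eta C0 K times itself; a small eta forces g = 0, and then
    the equation forces w = 0 (uniqueness_core).

    The operator only ever acts on mollifiers, which have bounded second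
    differences; there the principal value is an absolutely convergent integral
    (frac_lap_reflect). Fubini is applied to the kernel truncated near the
    origin, which is integrable; the truncation error is uniformly small and
    compactly supported (Lap_Lape_ball). *)

Set Implicit Arguments.
Unset Strict Implicit.
Unset Printing Implicit Defensive.
Import Order.TTheory GRing.Theory Num.Theory.
Import numFieldNormedType.Exports.

Local Open Scope classical_set_scope.
Local Open Scope ring_scope.

(** * Integration of real-valued functions *)

Notation "m .-itg f" :=
  (integrable m [set: _] (EFin \o (f : _ -> _))) (at level 2, f at level 9).

Lemma measurable_comp_pair dT dX dY dZ (T : measurableType dT)
    (X : measurableType dX) (Y : measurableType dY) (Z : measurableType dZ)
    (F : X * Y -> Z) (f : T -> X) (g : T -> Y) :
  measurable_fun setT F -> measurable_fun setT f -> measurable_fun setT g ->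
  measurable_fun setT (fun t => F (f t, g t)).
Proof.
move=> mF mf mg.
exact: (measurableT_comp mF (measurable_fun_pair mf mg)).
Qed.

Section real_integrals.
Context dd (T : measurableType dd) (R : realType).
Variable m : {measure set T -> \bar R}.
Implicit Types f g h : T -> R.

Lemma itg_measurable f : m.-itg f -> measurable_fun setT f.
Proof. by move=> /measurable_int /measurable_EFinP. Qed.

Lemma itg_dom f g : measurable_fun setT f -> m.-itg g ->
  (forall x, `|f x| <= g x) -> m.-itg f.
Proof.
move=> mf ig fg; apply: le_integrable ig => //; first exact/measurable_EFinP.
by move=> x _ /=; rewrite lee_fin (le_trans (fg x))// ler_norm.
Qed.

Lemma itgD f g : m.-itg f -> m.-itg g -> m.-itg (fun x => f x + g x).
Proof. by move=> fi gi; exact: (integrableD measurableT fi gi). Qed.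

Lemma itgB f g : m.-itg f -> m.-itg g -> m.-itg (fun x => f x - g x).
Proof. by move=> fi gi; exact: (integrableB measurableT fi gi). Qed.

Lemma itgZ k f : m.-itg f -> m.-itg (fun x => k * f x).
Proof. by move=> fi; exact: (integrableZl measurableT k fi). Qed.

Lemma itg_norm f : m.-itg f -> m.-itg (fun x => `|f x|).
Proof. exact: integrable_norm. Qed.

Lemma itg_bddM M h f : measurable_fun setT h -> (forall x, `|h x| <= M) ->
  m.-itg f -> m.-itg (fun x => h x * f x).
Proof.
move=> mh hM fi; apply: (itg_dom (g := fun x => M * `|f x|)).
- by apply: measurable_funM => //; exact: itg_measurable.
- by apply: itgZ; exact: itg_norm.
- by move=> x; rewrite normrM ler_wpM2r.
Qed.

Lemma itgE f : measurable_fun setT f ->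
  (\int[m]_x `|f x|%:E < +oo)%E -> m.-itg f.
Proof. by move=> mf fi; apply/integrableP; split => //; exact/measurable_EFinP. Qed.

Lemma intD f g : m.-itg f -> m.-itg g ->
  \int[m]_x (f x + g x) = \int[m]_x f x + \int[m]_x g x.
Proof. by move=> fi gi; rewrite RintegralD. Qed.

Lemma intB f g : m.-itg f -> m.-itg g ->
  \int[m]_x (f x - g x) = \int[m]_x f x - \int[m]_x g x.
Proof. by move=> fi gi; rewrite RintegralB. Qed.

Lemma intZ k f : m.-itg f -> \int[m]_x (k * f x) = k * \int[m]_x f x.
Proof. by move=> fi; rewrite RintegralZl. Qed.

Lemma le_int f g : m.-itg f -> m.-itg g -> (forall x, f x <= g x) ->
  \int[m]_x f x <= \int[m]_x g x.
Proof. by move=> fi gi fg; apply: le_Rintegral. Qed.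

Lemma int_ge0 f : (forall x, 0 <= f x) -> 0 <= \int[m]_x f x.
Proof. by move=> f0; apply: Rintegral_ge0. Qed.

Lemma norm_int_le f g : measurable_fun setT f -> m.-itg g ->
  (forall x, `|f x| <= g x) -> `|\int[m]_x f x| <= \int[m]_x g x.
Proof.
move=> mf gi fg; have fi := itg_dom mf gi fg.
apply: (le_trans (le_normr_Rintegral _ fi)) => //.
by apply: le_int => //; exact: itg_norm.
Qed.

Lemma EFin_int f : m.-itg f -> (\int[m]_x f x)%:E = (\int[m]_x (f x)%:E)%E.
Proof. by move=> fi; rewrite fineK//; exact: integrable_fin_num. Qed.

Lemma int_ae_eq f g : measurable_fun setT f -> measurable_fun setT g ->
  {ae m, forall x, f x = g x} -> \int[m]_x f x = \int[m]_x g x.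
Proof.
move=> mf mg fg; congr fine; apply: ae_eq_integral => //;
  [exact/measurable_EFinP|exact/measurable_EFinP|].
by apply: filterS fg => x -> _.
Qed.

Lemma ae_mp2 (P Q W : T -> Prop) : {ae m, forall x, P x} ->
  {ae m, forall x, Q x} -> (forall x, P x -> Q x -> W x) -> {ae m, forall x, W x}.
Proof. by move=> aP aQ PQW; apply: filterS2 aP aQ. Qed.

Lemma int_ge0_eq0 f : m.-itg f -> (forall x, 0 <= f x) ->
  \int[m]_x f x = 0 -> {ae m, forall x, f x = 0}.
Proof.
move=> fi f0 If0; have := EFin_int fi; rewrite If0 => /esym I0.
have mf := itg_measurable fi.
have /(ae_eq_integral_abs m measurableT) : measurable_fun setT (EFin \o f).
  exact/measurable_EFinP.
case=> + _; rewrite /ae_eq/=.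
under eq_integral do rewrite ger0_norm//.
by move=> /(_ I0); apply: filterS => x /(_ Logic.I) [].
Qed.

Lemma itg_indic (A : set T) : measurable A -> (m A < +oo)%E -> m.-itg (\1_A : T -> R).
Proof.
move=> mA fA; apply: itgE; first exact: measurable_indic.
under eq_integral do rewrite ger0_norm//.
by rewrite integral_indic// setIT.
Qed.

Lemma int_indic (A : set T) : measurable A -> \int[m]_x (\1_A x : R) = fine (m A).
Proof. by move=> mA; congr fine; rewrite integral_indic// setIT. Qed.

Lemma dominated_int_cvg (F : (T -> R)^nat) f g :
  (forall n, measurable_fun setT (F n)) ->
  (forall x, F n x @[n --> \oo] --> f x) -> m.-itg g ->
  (forall n x, `|F n x| <= g x) ->
  \int[m]_x F n x @[n --> \oo] --> \int[m]_x f x.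
Proof.
move=> mF Ff gi Fg.
have mf : measurable_fun setT f.
  by apply: (measurable_fun_cvg mF) => x _; exact: Ff.
have [//|||||fi _] := @dominated_convergence _ _ _ m setT measurableT
  (fun n x => (F n x)%:E) (EFin \o f) (EFin \o g).
- by move=> n; exact/measurable_EFinP.
- exact/measurable_EFinP.
- by apply: aeW => x _; apply: cvg_EFin; [exact: nearW|exact: Ff].
- exact: gi.
- by apply: aeW => x n _ /=; rewrite lee_fin.
move=> /= h; apply: fine_cvg; rewrite fineK//.
exact: integrable_fin_num.
Qed.

End real_integrals.

Section real_fubini.
Context d1 d2 (X : measurableType d1) (Y : measurableType d2) (R : realType).
Variable m1 : {sigma_finite_measure set X -> \bar R}.
Variable m2 : {sigma_finite_measure set Y -> \bar R}.
Implicit Type F : X * Y -> R.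

Lemma measurable_int2 F : measurable_fun setT F ->
  measurable_fun setT (fun x => \int[m2]_y F (x, y)).
Proof.
move=> mF; rewrite /Rintegral.
apply: (measurableT_comp (fine_measurable measurableT)).
under eq_fun do rewrite integralE.
have mEF : measurable_fun setT (EFin \o F) by exact/measurable_EFinP.
apply: emeasurable_funB.
- under eq_fun do rewrite (funepos_comp (EFin \o F)).
  apply: (measurable_fun_fubini_tonelli_F ((EFin \o F)^\+)%E) => //.
  exact: measurable_funepos.
- under eq_fun do rewrite (funeneg_comp (EFin \o F)).
  apply: (measurable_fun_fubini_tonelli_F ((EFin \o F)^\-)%E) => //.
  exact: measurable_funeneg.
Qed.

Lemma measurable_int1 F : measurable_fun setT F ->
  measurable_fun setT (fun y => \int[m1]_x F (x, y)).
Proof.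
move=> mF; rewrite /Rintegral.
apply: (measurableT_comp (fine_measurable measurableT)).
under eq_fun do rewrite integralE.
have mEF : measurable_fun setT (EFin \o F) by exact/measurable_EFinP.
apply: emeasurable_funB.
- under eq_fun do rewrite (funepos_comp (EFin \o F)).
  apply: (measurable_fun_fubini_tonelli_G ((EFin \o F)^\+)%E) => //.
  exact: measurable_funepos.
- under eq_fun do rewrite (funeneg_comp (EFin \o F)).
  apply: (measurable_fun_fubini_tonelli_G ((EFin \o F)^\-)%E) => //.
  exact: measurable_funeneg.
Qed.

Lemma itg_prod F (b : Y -> R) : measurable_fun setT F -> m2.-itg b ->
  (forall y, (\int[m1]_x `|F (x, y)|%:E <= (b y)%:E)%E) ->
  (m1 \x m2)%E.-itg F.
Proof.
move=> mF bi Fb; apply/integrable21ltyP; first exact/measurable_EFinP.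
have b0 y : 0 <= b y.
  by rewrite -lee_fin (le_trans _ (Fb y))//; apply: integral_ge0.
apply: le_lt_trans (integrable_lty measurableT bi) => //=.
apply: ge0_le_integral => //.
- by move=> y _; exact: integral_ge0.
- apply: (measurable_fun_fubini_tonelli_G (fun z => `|F z|%:E)) => //.
  by apply/measurable_EFinP; exact: measurableT_comp.
- exact: measurable_int bi.
Qed.

Lemma itg_prodM F (a : X -> R) (b : Y -> R) : measurable_fun setT F ->
  m1.-itg a -> m2.-itg b -> (forall x y, `|F (x, y)| <= a x * b y) ->
  (m1 \x m2)%E.-itg F.
Proof.
move=> mF ai bi Fab.
apply: (itg_prod (b := fun y => (\int[m1]_x `|a x|) * `|b y|)) => //.
  by apply: itgZ; exact: itg_norm.
move=> y; rewrite mulrC EFinM EFin_int; last exact: itg_norm.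
rewrite -ge0_integralZl_EFin//.
- apply: ge0_le_integral => //.
  + by apply/measurable_EFinP; apply: measurableT_comp => //; exact: measurableT_comp.
  + apply: measurable_funeM.
    by apply/measurable_EFinP; apply: measurableT_comp => //; exact: itg_measurable ai.
  + move=> x _; rewrite -EFinM lee_fin mulrC -normrM.
    exact: le_trans (Fab _ _) (ler_norm _).
- by apply/measurable_EFinP; apply: measurableT_comp => //; exact: itg_measurable ai.
Qed.

Variables (F : X * Y -> R) (iF : (m1 \x m2)%E.-itg F).

Let aeF : {ae m1, forall x,
  (\int[m2]_y F (x, y))%:E = (\int[m2]_y (F (x, y))%:E)%E}.
Proof. by apply: filterS (ae_integrable1 iF) => x ix; rewrite EFin_int. Qed.

Let aeG : {ae m2, forall y,
  (\int[m1]_x F (x, y))%:E = (\int[m1]_x (F (x, y))%:E)%E}.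
Proof. by apply: filterS (ae_integrable2 iF) => x ix; rewrite EFin_int. Qed.

Let eF : (\int[m1]_x (\int[m2]_y F (x, y))%:E =
  \int[m1]_x \int[m2]_y (F (x, y))%:E)%E.
Proof.
apply: ae_eq_integral => //.
- by apply/measurable_EFinP/measurable_int2; exact: itg_measurable iF.
- exact: measurable_fubini_F iF.
- by apply: filterS aeF => x h _.
Qed.

Let eG : (\int[m2]_y (\int[m1]_x F (x, y))%:E =
  \int[m2]_y \int[m1]_x (F (x, y))%:E)%E.
Proof.
apply: ae_eq_integral => //.
- by apply/measurable_EFinP/measurable_int1; exact: itg_measurable iF.
- exact: measurable_fubini_G iF.
- by apply: filterS aeG => x h _.
Qed.

Lemma int_prod1 :
  \int[(m1 \x m2)%E]_z F z = \int[m1]_x \int[m2]_y F (x, y).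
Proof. by rewrite [LHS]/Rintegral [RHS]/Rintegral eF -(integral12_prod_meas1 iF). Qed.

Lemma int_prod2 :
  \int[(m1 \x m2)%E]_z F z = \int[m2]_y \int[m1]_x F (x, y).
Proof. by rewrite [LHS]/Rintegral [RHS]/Rintegral eG -(integral21_prod_meas1 iF). Qed.

Lemma int_swap :
  \int[m1]_x \int[m2]_y F (x, y) = \int[m2]_y \int[m1]_x F (x, y).
Proof. by rewrite -int_prod1 int_prod2. Qed.

Lemma itg_int2 : m1.-itg (fun x => \int[m2]_y F (x, y)).
Proof.
apply/integrableP; split.
  by apply/measurable_EFinP/measurable_int2; exact: itg_measurable iF.
have /integrableP[_] := integrable_fubini_F iF.
apply: le_lt_trans; rewrite le_eqVlt; apply/orP; left; apply/eqP.
apply: ae_eq_integral => //.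
- apply: measurableT_comp => //.
  by apply/measurable_EFinP/measurable_int2; exact: itg_measurable iF.
- by apply: measurableT_comp => //; exact: measurable_fubini_F iF.
- by apply: filterS aeF => x h _; congr abse; exact: h.
Qed.

End real_fubini.

Lemma itg_int1 d1 d2 (X : measurableType d1) (Y : measurableType d2)
    (R : realType) (m1 : {sigma_finite_measure set X -> \bar R})
    (m2 : {sigma_finite_measure set Y -> \bar R}) (F : X * Y -> R) :
  (m1 \x m2)%E.-itg F -> m2.-itg (fun y => \int[m1]_x F (x, y)).
Proof.
move=> iF; apply: (@itg_int2 _ _ _ _ _ m2 m1 (fun z => F (z.2, z.1))).
have mF := itg_measurable iF.
apply/integrable12ltyP.
  apply/measurable_EFinP/(measurableT_comp mF).
  by apply/measurable_fun_pair; [exact: measurable_snd|exact: measurable_fst].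
have mEF : measurable_fun setT (EFin \o F) by exact/measurable_EFinP.
exact: (proj1 (integrable21ltyP m1 m2 mEF) iF).
Qed.

(** * Lebesgue measure on row vectors *)

Section lebesgue_rV_theory.
Variable R : realType.
Local Notation mu := (@lebesgue_rV R).
Local Notation lam := (@lebesgue_measure R).

Definition cons_rV n (p : R * 'rV[R]_n) : 'rV[R]_n.+1 := row_mx p.1%:M p.2.

Lemma cons_rV0 n (p : R * 'rV[R]_n) : cons_rV p ord0 ord0 = p.1.
Proof.
have -> : @ord0 n = lshift n (@ord0 0) by exact/val_inj.
by rewrite /cons_rV (row_mxEl p.1%:M p.2) mxE eqxx.
Qed.

Lemma cons_rVS n (p : R * 'rV[R]_n) (j : 'I_n) :
  cons_rV p ord0 (lift ord0 j) = p.2 ord0 j.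
Proof.
have -> : lift ord0 j = rshift 1 j by exact/val_inj.
by rewrite /cons_rV (row_mxEr p.1%:M p.2).
Qed.

Lemma measurable_cons_rV n : measurable_fun setT (@cons_rV n).
Proof.
apply/measurable_fun_rVP => i.
case: (unliftP ord0 i) => [j ->|->].
  under eq_fun do rewrite cons_rVS.
  exact: (measurableT_comp (measurable_coord j)).
under eq_fun do rewrite cons_rV0.
exact: measurable_fst.
Qed.

Lemma measurable_rV_add n : measurable_fun setT
  (fun p : 'rV[R]_n * 'rV[R]_n => p.1 + p.2).
Proof.
apply/measurable_fun_rVP => i; under eq_fun do rewrite mxE.
by apply: measurable_funD; apply: (measurableT_comp (measurable_coord i));
  [exact: measurable_fst|exact: measurable_snd].
Qed.

Lemma measurable_rV_sub n : measurable_fun setT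
  (fun p : 'rV[R]_n * 'rV[R]_n => p.1 - p.2).
Proof.
apply/measurable_fun_rVP => i; under eq_fun do rewrite !mxE.
by apply: measurable_funB; apply: (measurableT_comp (measurable_coord i));
  [exact: measurable_fst|exact: measurable_snd].
Qed.

Lemma measurable_rV_subr n (c : 'rV[R]_n) : measurable_fun setT (fun x : 'rV[R]_n => c - x).
Proof.
apply/measurable_fun_rVP => i; under eq_fun do rewrite !mxE.
by apply: measurable_funB => //; exact: measurable_coord.
Qed.

Lemma measurable_rV_addr n (c : 'rV[R]_n) :
  measurable_fun setT (fun x : 'rV[R]_n => x + c).
Proof.
apply/measurable_fun_rVP => i; under eq_fun do rewrite !mxE.
by apply: measurable_funD => //; exact: measurable_coord.
Qed.

(** The measure on R^(n+1) is the image under cons_rV of a product measure: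
    this is the inductive step for the facts that follow. *)
Lemma ge0_integral_rVS n (f : 'rV[R]_n.+1 -> \bar R) :
  measurable_fun setT f -> (forall x, 0 <= f x)%E ->
  (\int[mu n.+1]_x f x = \int[lam]_a \int[mu n]_v f (cons_rV (a, v)))%E.
Proof.
move=> mf f0.
have mc : measurable_fun setT
    (@cons_rV n : (measurableTypeR R * 'rV[R]_n)%type -> 'rV[R]_n.+1).
  exact: measurable_cons_rV.
have := @ge0_integral_pushforward _ _ _ _ R _ mc (lam \x mu n)%E
  setT f measurableT mf (fun y _ => f0 y).
rewrite preimage_setT => h.
transitivity (\int[(lam \x mu n)%E]_x (f \o @cons_rV n) x)%E.
  by rewrite -h; apply: eq_measure_integral.
rewrite (@fubini_tonelli1 _ _ _ _ _ lam (mu n) (f \o @cons_rV n)) //.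
  exact: (measurableT_comp mf mc).
by move=> x; exact: f0.
Qed.

Lemma ge0_integral_reflect1 (f : R -> \bar R) (c : R) :
  measurable_fun setT f -> (forall x, 0 <= f x)%E ->
  (\int[lam]_x f (c - x)%R = \int[lam]_x f x)%E.
Proof.
move=> mf f0.
pose r := (fun x : R => c - x) : measurableTypeR R -> measurableTypeR R.
have mr : measurable_fun setT r by exact: measurable_funB.
have := @ge0_integral_pushforward _ _ _ _ R r mr lam
  setT f measurableT mf (fun y _ => f0 y).
rewrite preimage_setT => <-.
apply: eq_measure_integral => A mA _; apply/esym.
transitivity (pushforward lam r A) => //.
apply: lebesgue_measure_unique => //= _ [[a b]] _ <-.
rewrite /pushforward.
have -> : r @^-1` `]a, b] = `[c - b, c - a[%classic.
  apply/seteqP; split => x /=; rewrite /r !in_itv/=; lra.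
rewrite !lebesgue_measure_itv/= !lte_fin.
have -> : (c - b < c - a) = (a < b) by rewrite ltrD2l ltrN2.
by case: ifPn => // _; rewrite -!EFinD; congr EFin; ring.
Qed.

(** Reflections generate the translations, and c - x is the form in which
    convolutions meet the measure. *)
Lemma ge0_integral_reflect n (f : 'rV[R]_n -> \bar R) (c : 'rV[R]_n) :
  measurable_fun setT f -> (forall x, 0 <= f x)%E ->
  (\int[mu n]_x f (c - x)%R = \int[mu n]_x f x)%E.
Proof.
elim: n f c => [|n IHn] f c mf f0.
  by apply: eq_integral => x _; rewrite [x]thinmx0 [c]thinmx0 subr0.
rewrite ge0_integral_rVS //; last first.
  exact: (measurableT_comp mf (measurable_rV_subr c)).
rewrite [RHS]ge0_integral_rVS//.
have mfc : measurable_fun setT (f \o @cons_rV n).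
  exact: (measurableT_comp mf (@measurable_cons_rV n)).
pose c' : 'rV[R]_n := \row_j c ord0 (lift ord0 j).
have cE a v : c - cons_rV (a, v) = cons_rV (c ord0 ord0 - a, c' - v).
  apply/rowP => i; rewrite mxE [X in _ + X]mxE.
  case: (unliftP ord0 i) => [j ->|->].
    by rewrite !cons_rVS [RHS]mxE [X in _ = _ + X]mxE [X in _ = X + _]mxE.
  by rewrite !cons_rV0.
under eq_integral => a _.
  under eq_integral => v _ do rewrite cE.
  rewrite (IHn (fun v => f (cons_rV (c ord0 ord0 - a, v))) c').
  - over.
  - by apply: (measurableT_comp mfc); exact/measurable_fun_pair.
  - by move=> x; exact: f0.
pose g a := (\int[mu n]_v f (cons_rV (a, v)))%E.
apply: (ge0_integral_reflect1 (f := g)).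
  by apply: (measurable_fun_fubini_tonelli_F (f \o @cons_rV n)) => // x; exact: f0.
by move=> a; exact: integral_ge0.
Qed.

Lemma int_reflect n (f : 'rV[R]_n -> R) (c : 'rV[R]_n) :
  measurable_fun setT f ->
  \int[mu n]_x f (c - x) = \int[mu n]_x f x.
Proof.
move=> mf; have mEf : measurable_fun setT (EFin \o f) by exact/measurable_EFinP.
congr fine; rewrite integralE [RHS]integralE; congr (_ - _)%E.
- under eq_integral do rewrite (funepos_comp (EFin \o f)).
  by apply: ge0_integral_reflect => //; exact: measurable_funepos.
- under eq_integral do rewrite (funeneg_comp (EFin \o f)).
  by apply: ge0_integral_reflect => //; exact: measurable_funeneg.
Qed.

Lemma itg_reflect n (f : 'rV[R]_n -> R) (c : 'rV[R]_n) :
  (mu n).-itg f -> (mu n).-itg (fun x => f (c - x)).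
Proof.
move=> fi; have mf := itg_measurable fi; apply: itgE.
  exact: (measurableT_comp mf (measurable_rV_subr c)).
rewrite (ge0_integral_reflect (f := fun x => `|f x|%:E)).
- by have /integrableP[] := fi.
- by apply/measurable_EFinP; exact: measurableT_comp.
- by [].
Qed.

Lemma int_opp n (f : 'rV[R]_n -> R) : measurable_fun setT f ->
  \int[mu n]_x f (- x) = \int[mu n]_x f x.
Proof.
by move=> mf; rewrite -(int_reflect 0 mf); under [RHS]eq_Rintegral do rewrite sub0r.
Qed.

Lemma itg_opp n (f : 'rV[R]_n -> R) :
  (mu n).-itg f -> (mu n).-itg (fun x => f (- x)).
Proof.
move=> /(itg_reflect 0); rewrite (_ : (fun x => f (0 - x)) = fun x => f (- x))//.
by apply/funext => x; rewrite sub0r.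
Qed.

Lemma int_shift n (f : 'rV[R]_n -> R) (c : 'rV[R]_n) : measurable_fun setT f ->
  \int[mu n]_x f (x + c) = \int[mu n]_x f x.
Proof.
move=> mf; rewrite -(int_reflect c mf).
have mg : measurable_fun setT (fun x : 'rV[R]_n => f (c - x)).
  exact: (measurableT_comp mf (measurable_rV_subr c)).
by rewrite -(int_opp mg); under [RHS]eq_Rintegral do rewrite opprK addrC.
Qed.

Lemma itg_shift n (f : 'rV[R]_n -> R) (c : 'rV[R]_n) :
  (mu n).-itg f -> (mu n).-itg (fun x => f (x + c)).
Proof.
move=> /(itg_reflect c)/itg_opp.
rewrite (_ : (fun x => f (c - - x)) = fun x => f (x + c))//.
by apply/funext => x; rewrite opprK addrC.
Qed.

Lemma rV_normE n (x : 'rV[R]_n) : `|x| = \big[Num.max/0]_(i < n) `|x ord0 i|.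
Proof.
rewrite [LHS]/Num.norm/= mx_normrE; apply/le_anti/andP; split.
  apply/bigmax_leP; split => [|[i j] _ /=]; first exact: bigmax_ge_id.
  by rewrite (ord1 i); exact: (le_bigmax _ (fun i => `|x ord0 i|)).
apply/bigmax_leP; split => [|j _]; first exact: bigmax_ge_id.
exact: (le_bigmax _ (fun ij => `|x ij.1 ij.2|) (ord0, j)).
Qed.

Lemma measurable_rV_norm n : measurable_fun setT (fun x : 'rV[R]_n => `|x|).
Proof.
under eq_fun do rewrite rV_normE.
elim: (index_enum _) => [|i s IHs].
  by under eq_fun do rewrite big_nil; exact: measurable_cst.
under eq_fun do rewrite big_cons.
apply: measurable_maxr => //.
by apply: measurableT_comp => //; exact: measurable_coord.
Qed.

Lemma measurable_rV_ball n (r : R) : measurable [set x : 'rV[R]_n | `|x| < r].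
Proof.
rewrite -[X in measurable X]setTI.
exact: (measurable_fun_ltr (@measurable_rV_norm n) (measurable_cst r)).
Qed.

(** The balls of the supremum norm are cubes. *)
Lemma measure_rV_ball n (r : R) : 0 < r -> mu n [set x | `|x| < r] = ((2 * r) ^+ n)%:E.
Proof.
move=> r0; elim: n => [|n IHn].
  rewrite expr0 [LHS]diracE mem_set//= normr0 //.
have mB k : measurable [set x : 'rV[R]_k | `|x| < r] by exact: measurable_rV_ball.
transitivity (\int[mu n.+1]_x
    (\1_[set x : 'rV[R]_n.+1 | `|x| < r] x)%:E)%E.
  by rewrite integral_indic//; [rewrite setIT|exact: (mB n.+1)].
rewrite ge0_integral_rVS//; last first.
  by apply/measurable_EFinP/measurable_indic; exact: mB.
have E a v : (\1_[set x : 'rV[R]_n.+1 | `|x| < r] (cons_rV (a, v)) : R)%:E =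
    ((\1_(`]- r, r[%classic) a)%:E * (\1_[set x : 'rV[R]_n | `|x| < r] v)%:E)%E.
  have K : (`|cons_rV (a, v)| < r) = (`|a| < r) && (`|v| < r).
    rewrite !rV_normE big_ord_recl cons_rV0/= gt_max; congr andb.
    by under eq_bigr do rewrite cons_rVS.
  rewrite -EFinM !indicE -natrM mulnb; congr (nat_of_bool _)%:R%:E.
  apply/idP/andP => [|[]]; rewrite !inE/= in_itv/= -ltr_norml K.
    by move=> /andP[].
  by move=> -> ->.
transitivity (\int[lam]_a
    ((\1_(`]- r, r[%classic) a)%:E * ((2 * r) ^+ n)%:E))%E.
  apply: eq_integral => a _; under eq_integral => v _ do rewrite E.
  rewrite integralZl//; last first.
    by apply: itg_indic; [exact: mB|rewrite [X in (X < _)%E]IHn ltry].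
  by rewrite integral_indic//; [rewrite setIT; congr (_ * _)%E; exact: IHn|exact: mB].
rewrite integralZr//; last exact: integrable_indic_itv.
rewrite integral_indic// setIT [X in (X * _)%E]lebesgue_measure_itv/= lte_fin.
rewrite ifT; last by lra.
by rewrite -EFinB -EFinM exprS; congr (_%:E); ring.
Qed.

Lemma int_indic_ball n (r : R) : 0 < r ->
  \int[mu n]_x \1_[set x : 'rV[R]_n | `|x| < r] x = (2 * r) ^+ n.
Proof.
move=> r0; rewrite int_indic; last exact: measurable_rV_ball.
by rewrite -[RHS]/(fine _%:E) -measure_rV_ball.
Qed.

Lemma itg_indic_ball n (r : R) : 0 < r ->
  (mu n).-itg (\1_[set x : 'rV[R]_n | `|x| < r] : _ -> R).
Proof.
move=> r0; apply: itg_indic; first exact: measurable_rV_ball.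
by rewrite [X in (X < _)%E]measure_rV_ball// ltry.
Qed.

Lemma measurable_enorm n : measurable_fun setT (@enorm R n).
Proof.
apply: (measurableT_comp (continuous_measurable_fun (@sqrt_continuous R))).
apply: measurable_sum => i; apply: measurable_funX; exact: measurable_coord.
Qed.

Lemma norm_le_enorm n (x : 'rV[R]_n) : `|x| <= enorm x.
Proof.
rewrite rV_normE; apply/bigmax_leP; split => [|i _]; first exact: sqrtr_ge0.
rewrite -sqrtr_sqr ler_wsqrtr// (bigD1 i)//= lerDl.
by apply: sumr_ge0 => j _; exact: sqr_ge0.
Qed.

Lemma enormN n (x : 'rV[R]_n) : enorm (- x) = enorm x.
Proof.
by rewrite /enorm; congr Num.sqrt; apply: eq_bigr => i _; rewrite mxE sqrrN.
Qed.

End lebesgue_rV_theory.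

(** * The singular kernel and the weight *)

Lemma dyadic_bracket (R : realType) (r : R) : 1 <= r ->
  exists k : nat, 2 ^+ k <= r < 2 ^+ k.+1.
Proof.
move=> r1.
have ex : exists k : nat, r < 2 ^+ k.+1.
  exists (Num.truncn r); apply: (lt_le_trans (truncnS_gt r)).
  by rewrite -natrX ler_nat ltnW// ltn_expl.
case: (ex_minnP ex) => -[|k] rk kmin.
  by exists 0%N; rewrite expr0 r1.
exists k.+1; rewrite rk andbT leNgt; apply/negP => /kmin.
by rewrite ltnn.
Qed.

Lemma nneseries_bounded (R : realType) (a : R^nat) (B : R) :
  (forall n, 0 <= a n) -> (forall n, \sum_(0 <= k < n) a k <= B) ->
  (\sum_(0 <= k <oo) (a k)%:E < +oo)%E.
Proof.
move=> a0 aB; apply: (@le_lt_trans _ _ B%:E); last exact: ltry.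
apply: lime_le; first by apply: is_cvg_nneseries => n _ _; rewrite lee_fin.
by apply: nearW => n; rewrite sumEFin lee_fin.
Qed.

Lemma sum_geometric_le (R : realType) (r : R) n : 0 <= r < 1 ->
  \sum_(0 <= k < n) r ^+ k <= (1 - r)^-1.
Proof.
move=> /andP[r0 r1].
have -> : \sum_(0 <= k < n) r ^+ k = (1 - r ^+ n) / (1 - r).
  apply: (canRL (mulfK _)); first by rewrite subr_eq0 gt_eqF.
  elim: n => [|n IHn]; first by rewrite big_geq// mul0r expr0 subrr.
  by rewrite big_nat_recr//= mulrDl IHn exprS; ring.
rewrite ler_pdivrMr ?subr_gt0// mulVf ?subr_eq0 ?gt_eqF//.
by rewrite gerBl exprn_ge0.
Qed.

Lemma powR_exprn (R : realType) (a r : R) k : 0 <= a ->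
  (a ^+ k) `^ r = (a `^ r) ^+ k.
Proof.
by move=> a0; rewrite -powR_mulrn// -powRrM mulrC powRrM powR_mulrn ?powR_ge0.
Qed.

Lemma powRN_le (R : realType) (p a b : R) : 0 <= p -> 0 < a -> a <= b ->
  b `^ (- p) <= a `^ (- p).
Proof.
move=> p0 a0 ab; rewrite !powRN lef_pV2 ?posrE ?powR_gt0//; last exact: lt_le_trans ab.
by rewrite ge0_ler_powR ?nnegrE ?(ltW a0)// (le_trans (ltW a0)).
Qed.

Section kernel_and_weight.
Variables (R : realType) (d : nat) (s : R).
Hypothesis d0 : (0 < d)%N.
Hypothesis s01 : 0 < s < 1.
Local Notation mu := (@lebesgue_rV R d).
Local Notation p := (d%:R + 2 * s).
Implicit Types x y z : 'rV[R]_d.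

Let p0 : 0 < p.
Proof. have := ler0n R d; move: s01 => /andP[]; lra. Qed.

(** The kernel of the fractional Laplacian times the size of the second
    difference of a regular bounded function. *)
Definition kap z : R := Num.min 1 (`|z| ^+ 2) * `|z| `^ (- p).

Lemma kap_ge0 z : 0 <= kap z.
Proof. by rewrite mulr_ge0 ?powR_ge0// le_min ler01 sqr_ge0. Qed.

Lemma measurable_kap : measurable_fun setT kap.
Proof.
apply: measurable_funM.
  apply: measurable_minr => //.
  by apply: measurable_funX; exact: measurable_rV_norm.
exact: (measurableT_comp (measurable_powR (- p)) (@measurable_rV_norm R d)).
Qed.

Let r1 : R := 2 `^ (- (2 * s)).
Let r2 : R := 2 `^ (2 * s - 2).

Let r1_lt1 : 0 <= r1 < 1.
Proof.
rewrite powR_ge0/= -(powRr0 2) /r1 /powR ifF ?ifF ?pnatr_eq0//.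
rewrite ltr_expR mul0r; have := @ln_gt0 R 2 ltac:(lra).
move: s01 => /andP[]; nra.
Qed.

Let r2_lt1 : 0 <= r2 < 1.
Proof.
rewrite powR_ge0/= -(powRr0 2) /r2 /powR ifF ?ifF ?pnatr_eq0//.
rewrite ltr_expR mul0r; have := @ln_gt0 R 2 ltac:(lra).
move: s01 => /andP[]; nra.
Qed.

Let q : R := 2 `^ (- p).
Let q0 : 0 < q. Proof. by rewrite powR_gt0. Qed.

Let pow_dyadic (k : nat) : (2 ^+ k : R) `^ (- p) = q ^+ k.
Proof. exact: powR_exprn. Qed.

Let pow_dyadicV (k : nat) : (2^-1 ^+ k : R) `^ (- p) = q^-1 ^+ k.
Proof.
rewrite powR_exprn ?invr_ge0//; congr (_ ^+ k).
have -> : (2^-1 : R) = 2 `^ (- 1) by rewrite powR_inv1.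
by rewrite /q -[in LHS]powRrM mulN1r opprK -[in RHS]powRN opprK.
Qed.

(* the k-th term bounds kap on the two annuli where the norm is in
   [2^k, 2^(k+1)[ and in ]2^-(k+1), 2^-k] *)
Let t (k : nat) z : R :=
  q ^+ k * \1_[set z : 'rV[R]_d | `|z| < 2 ^+ k.+1] z +
  q^-1 * (4^-1 * q^-1) ^+ k *
    \1_[set z : 'rV[R]_d | `|z| < 2 * 2^-1 ^+ k] z.

Let t_ge0 k z : 0 <= t k z.
Proof.
rewrite /t addr_ge0// mulr_ge0 ?exprn_ge0// ?(ltW q0)// ?mulr_ge0 ?exprn_ge0//.
all: by rewrite ?mulr_ge0 ?invr_ge0 ?(ltW q0).
Qed.

Let powRNmono (a b : R) : 0 < a -> a <= b -> b `^ (- p) <= a `^ (- p).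
Proof. exact: powRN_le (ltW p0). Qed.

Let kap_le_t z : exists k, kap z <= t k z.
Proof.
have [->|z0] := eqVneq z 0.
  exists 0%N; rewrite /kap normr0 expr0n/= powR0 ?oppr_eq0 ?gt_eqF// mulr0.
  exact: t_ge0.
have nz : 0 < `|z| by rewrite normr_gt0.
have [z1|z1] := leP 1 `|z|.
  have [k /andP[kz zk]] := dyadic_bracket z1; exists k.
  apply: (@le_trans _ _ (q ^+ k)).
    rewrite /kap min_l; last by rewrite -(expr1n _ 2) lerXn2r ?nnegrE.
    by rewrite mul1r -pow_dyadic powRNmono// exprn_gt0.
  rewrite /t indicE mem_set//= mulr1 lerDl mulr_ge0// mulr_ge0//.
    by rewrite invr_ge0 ltW.
  by rewrite exprn_ge0// mulr_ge0// invr_ge0 ltW.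
have z1' : 1 <= `|z|^-1 by rewrite -invr1 lef_pV2 ?posrE// ltW.
have [k /andP[kz zk]] := dyadic_bracket z1'; exists k.
have zle : `|z| <= 2^-1 ^+ k.
  by rewrite exprVn -[leLHS]invrK lef_pV2 ?posrE ?exprn_gt0// invr_gt0.
have zge : 2^-1 ^+ k.+1 <= `|z|.
  by rewrite exprVn -[leRHS]invrK lef_pV2 ?posrE ?exprn_gt0// ?invr_gt0// ltW.
apply: (@le_trans _ _ (q^-1 * (4^-1 * q^-1) ^+ k)); last first.
  rewrite /t [in X in _ + X]indicE mem_set/=; last first.
    apply: (le_lt_trans zle); rewrite ltr_pMl ?exprn_gt0//; lra.
  by rewrite mulr1 lerDr mulr_ge0// exprn_ge0// ltW.
rewrite /kap min_r; last by rewrite expr_le1// ltW.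
rewrite exprMn mulrCA; apply: ler_pM; rewrite ?powR_ge0 ?sqr_ge0//.
  apply: (@le_trans _ _ ((2^-1 ^+ k) ^+ 2)).
    by rewrite lerXn2r ?nnegrE ?exprn_ge0.
  by rewrite -exprM mulnC exprM expr2 -invfM -natrM.
apply: (le_trans (powRNmono _ zge)); first by rewrite exprn_gt0.
by rewrite pow_dyadicV exprS.
Qed.

Let int_t k : (\int[mu]_z (t k z)%:E = (4 ^+ d * r1 ^+ k + q^-1 * 4 ^+ d * r2 ^+ k)%:E)%E.
Proof.
have q1 : q * 2 ^+ d = r1.
  rewrite /q /r1 -powR_mulrn// -powRD ?pnatr_eq0 ?implybT//.
  by congr (_ `^ _); ring.
have q2 : 4^-1 * q^-1 * 2^-1 ^+ d = r2.
  rewrite /q /r2 -powRN opprK exprVn -powR_invn// mulrAC.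
  have -> : (4^-1 : R) = 2 `^ (- 2%:R) by rewrite powR_invn// -natrX.
  by rewrite -!powRD ?pnatr_eq0 ?implybT//; congr (_ `^ _); ring.
have f0 k1 : (mu [set z | (`|z| < 2 ^+ k1)%R] < +oo)%E.
  by rewrite [X in (X < _)%E]measure_rV_ball ?exprn_gt0// ltry.
have g0 k1 : (mu [set z | (`|z| < 2 * 2^-1 ^+ k1)%R] < +oo)%E.
  by rewrite [X in (X < _)%E]measure_rV_ball ?mulr_gt0 ?exprn_gt0// ltry.
have i1 := itg_indic (measurable_rV_ball (2 ^+ k.+1)) (f0 _).
have i2 := itg_indic (measurable_rV_ball (2 * 2^-1 ^+ k)) (g0 _).
rewrite -[LHS]EFin_int; last by apply: itgD; apply: itgZ.
rewrite intD ?intZ//; [|exact: itgZ..].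
rewrite !int_indic_ball ?mulr_gt0 ?exprn_gt0//.
have two (a : R) : 2 * (2 * a) = 4 * a by ring.
congr EFin; rewrite -q1 -q2 exprS !two ![in RHS]exprMn -![in RHS]exprM.
rewrite ![(d * k)%N]mulnC ![(_ * _) ^+ d]exprMn -!exprM [in LHS]exprMn.
by ring.
Qed.

(** Sum over dyadic annuli. Those at distance 2^k contribute 2^(-2sk), those at
    distance 2^-k contribute 2^((2s-2)k); both geometric series converge
    because 0 < s < 1. *)
Lemma itg_kap : mu.-itg kap.
Proof.
apply: itgE; first exact: measurable_kap.
apply: (@le_lt_trans _ _ (\int[mu]_z \sum_(0 <= k <oo) (t k z)%:E)%E).
  have mt k : measurable_fun setT (t k).
    by apply: measurable_funD; apply: measurable_funM => //;
      apply: measurable_indic; exact: measurable_rV_ball.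
  apply: ge0_le_integral => //.
  - apply/measurable_EFinP; apply: measurableT_comp => //; exact: measurable_kap.
  - apply: ge0_emeasurable_sum; first by move=> k z *; rewrite lee_fin.
    by move=> k _; apply/measurable_EFinP; exact: mt.
  - move=> z _; rewrite ger0_norm ?kap_ge0//; have [k ktz] := kap_le_t z.
    apply: (@le_trans _ _ (t k z)%:E); first by rewrite lee_fin.
    apply: (@le_trans _ _ (\sum_(0 <= i < k.+1) (t i z)%:E)%E).
      rewrite big_nat_recr//= leeDr// sume_ge0// => i _; rewrite lee_fin//.
    by apply: nneseries_lim_ge => n _ _; rewrite lee_fin.
rewrite integral_nneseries//; last 2 first.
- move=> k; apply/measurable_EFinP.
  by apply: measurable_funD; apply: measurable_funM => //;
    apply: measurable_indic; exact: measurable_rV_ball.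
- by move=> k z _; rewrite lee_fin.
under eq_eseriesr do rewrite int_t.
apply: (nneseries_bounded (B := 4 ^+ d * (1 - r1)^-1 + q^-1 * 4 ^+ d * (1 - r2)^-1)).
  move=> k; rewrite addr_ge0// !mulr_ge0 ?exprn_ge0 ?invr_ge0//.
  - by case/andP: r1_lt1.
  - exact: ltW.
  - by case/andP: r2_lt1.
move=> k; rewrite big_split/= -!mulr_sumr lerD// ler_wpM2l ?sum_geometric_le//.
by rewrite mulr_ge0 ?exprn_ge0 ?invr_ge0// ltW.
Qed.

End kernel_and_weight.

Section weight.
Variables (R : realType) (d : nat) (s : R).
Hypothesis d0 : (0 < d)%N.
Hypothesis s01 : 0 < s < 1.
Local Notation mu := (@lebesgue_rV R d).
Local Notation p := (d%:R + 2 * s).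
Implicit Types x y z : 'rV[R]_d.

Let p0 : 0 < p.
Proof. have := ler0n R d; move: s01 => /andP[]; lra. Qed.

Definition ker z : R := (enorm z `^ p)^-1.

Lemma ker_ge0 z : 0 <= ker z. Proof. by rewrite invr_ge0 powR_ge0. Qed.

Lemma kerN z : ker (- z) = ker z. Proof. by rewrite /ker enormN. Qed.

Lemma measurable_ker : measurable_fun setT ker.
Proof.
rewrite /ker; under eq_fun do rewrite -powRN.
exact: (measurableT_comp (measurable_powR (- p)) (@measurable_enorm R d)).
Qed.

Lemma ker_le_norm z : ker z <= `|z| `^ (- p).
Proof.
have [->|z0] := eqVneq z 0.
  rewrite /ker normr0 powR0 ?oppr_eq0 ?gt_eqF//.
  suff -> : enorm (0 : 'rV[R]_d) = 0 by rewrite powR0 ?gt_eqF// invr0.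
  by rewrite /enorm big1 ?sqrtr0// => i _; rewrite mxE expr0n.
have nz : 0 < `|z| by rewrite normr_gt0.
have ez := lt_le_trans nz (norm_le_enorm z).
rewrite powRN lef_pV2 ?posrE ?powR_gt0//.
by rewrite ge0_ler_powR ?nnegrE ?(ltW p0) ?(ltW nz) ?(ltW ez)// norm_le_enorm.
Qed.

Lemma sqr_ker_le_kap z : `|z| <= 1 -> `|z| ^+ 2 * ker z <= kap s z.
Proof.
move=> z1; rewrite /kap min_r ?expr_le1//.
by rewrite ler_wpM2l ?sqr_ge0// ker_le_norm.
Qed.

Lemma ker_le_kap z : 1 <= `|z| -> ker z <= kap s z.
Proof.
move=> z1; rewrite /kap min_l ?mul1r ?ker_le_norm//.
by rewrite -(expr1n _ 2) lerXn2r ?nnegrE.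
Qed.

Lemma ker_min_le_kap z : Num.min 1 (`|z| ^+ 2) * ker z <= kap s z.
Proof. by rewrite ler_wpM2l ?ker_le_norm// le_min ler01 sqr_ge0. Qed.

(** Cutting off a neighbourhood of the origin makes the kernel integrable;
    the principal value is the limit as the radius tends to zero. *)
Definition kere (e : R) z : R := if e < enorm z then ker z else 0.

Lemma kere_ge0 e z : 0 <= kere e z.
Proof. by rewrite /kere; case: ifP => // _; exact: ker_ge0. Qed.

Lemma kere_le_ker e z : kere e z <= ker z.
Proof. by rewrite /kere; case: ifP => // _; exact: ker_ge0. Qed.

Lemma kereN e z : kere e (- z) = kere e z.
Proof. by rewrite /kere kerN enormN. Qed.

Lemma measurable_kere e : measurable_fun setT (kere e).
Proof.
apply: measurable_fun_ifT => //; last exact: measurable_ker.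
exact: (measurable_fun_ltr (measurable_cst e) (@measurable_enorm R d)).
Qed.

Lemma enorm_le_norm x : enorm x ^+ 2 <= d%:R * `|x| ^+ 2.
Proof.
rewrite /enorm sqr_sqrtr; last by apply: sumr_ge0 => i _; exact: sqr_ge0.
apply: (@le_trans _ _ (\sum_(i < d) `|x| ^+ 2)); last first.
  by rewrite sumr_const card_ord mulr_natl.
apply: ler_sum => i _; rewrite -real_normK ?num_real// lerXn2r ?nnegrE//.
by rewrite [leRHS]rV_normE; exact: (le_bigmax _ (fun i => `|x ord0 i|)).
Qed.

Lemma itg_kere (e : R) : 0 < e -> mu.-itg (kere e).
Proof.
move=> e0; have dR0 : 0 < d%:R :> R by rewrite ltr0n.
pose m := Num.min 1 (e ^+ 2 / d%:R).
have m0 : 0 < m by rewrite lt_min ltr01 divr_gt0 ?exprn_gt0.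
have ig : mu.-itg (fun z => m^-1 * kap s z) by apply: itgZ; exact: itg_kap.
have mk := measurable_kere e.
apply: (itg_dom mk ig) => z.
rewrite ger0_norm ?kere_ge0// ler_pdivlMl//.
rewrite /kere; case: ifPn => ez; last by rewrite mulr0 kap_ge0.
apply: le_trans (ker_min_le_kap z); rewrite ler_wpM2r ?ker_ge0//.
rewrite /m le_min !ge_min lexx/=; apply/orP; right.
rewrite ler_pdivrMr// mulrC; apply: le_trans (enorm_le_norm z).
by rewrite lerXn2r ?nnegrE ?(ltW e0)// ?sqrtr_ge0// ltW.
Qed.

(** The weight decays exactly like the kernel: fast enough to be integrable,
    slowly enough for its increments, integrated against the kernel, to be
    controlled by its own value (wtQ_int below). *)
Definition wt x : R := (1 + `|x|) `^ (- p).

Let n1 x : 1 <= 1 + `|x|. Proof. by rewrite lerDl. Qed.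
Let n1_gt0 x : 0 < 1 + `|x|. Proof. exact: lt_le_trans (n1 x). Qed.
Hint Resolve n1_gt0 : core.

Lemma wt_gt0 x : 0 < wt x. Proof. exact: powR_gt0. Qed.
Lemma wt_ge0 x : 0 <= wt x. Proof. exact: powR_ge0. Qed.
Hint Resolve wt_gt0 wt_ge0 : core.

Let powRNmono (a b : R) : 0 < a -> a <= b -> b `^ (- p) <= a `^ (- p).
Proof. exact: powRN_le (ltW p0). Qed.

Lemma wt_le1 x : wt x <= 1.
Proof. by apply: (le_trans (powRNmono _ (n1 x))); rewrite ?ltr01// powR1. Qed.

Lemma measurable_wt : measurable_fun setT wt.
Proof.
apply: (measurableT_comp (measurable_powR (- p))).
by apply: measurable_funD => //; exact: measurable_rV_norm.
Qed.

Lemma itg_wt : mu.-itg wt.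
Proof.
apply: (itg_dom measurable_wt (g := fun z => \1_[set z : 'rV[R]_d | `|z| < 1] z + kap s z)).
  by apply: itgD; [exact: itg_indic_ball|exact: itg_kap].
move=> z; rewrite ger0_norm//; have [z1|z1] := ltP `|z| 1.
  by rewrite indicE mem_set//= (le_trans (wt_le1 z))// lerDl kap_ge0.
apply: (@le_trans _ _ (kap s z)); last by rewrite lerDr.
rewrite /kap min_l ?mul1r.
  by apply: powRNmono; [exact: lt_le_trans z1|rewrite lerDr].
by rewrite -(expr1n _ 2) lerXn2r ?nnegrE.
Qed.

Let pow2_ge1 : 1 <= 2 `^ p :> R.
Proof.
by have := @ler_powR R 2 (ltW (ltr1n R 2)) 0 p (ltW p0); rewrite powRr0.
Qed.

Let pow2 (a b : R) : 0 < a -> 0 < b -> b <= 2 * a -> a `^ (- p) <= 2 `^ p * b `^ (- p).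
Proof.
move=> a0 b0 ba; have -> : a `^ (- p) = 2 `^ p * (2 * a) `^ (- p).
  by rewrite powRM ?(ltW a0)// mulrA [2 `^ (- p)]powRN mulfV ?mul1r// gt_eqF// powR_gt0.
by rewrite ler_wpM2l ?powR_ge0//; exact: powRNmono.
Qed.

Lemma wt_near x y : `|x - y| <= 1 -> wt x <= 2 `^ p * wt y.
Proof.
move=> xy; apply: pow2 => //; have := ler_normD x (y - x).
rewrite (_ : x + (y - x) = y); last by rewrite addrC subrK.
by rewrite [X in _ + X]distrC; have := normr_ge0 x; lra.
Qed.

(** Of two vectors x and z whose norms add up to at least that of y, the longer
    one has at least half the norm of y; its weight is at most 2^p times that
    of y. *)
Lemma wt_conv x y z : `|y| <= `|x| + `|z| -> wt x * wt z <= 2 `^ p * wt y * (wt x + wt z).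
Proof.
move=> yxz; have [xz|xz] := leP `|x| `|z|.
  have h : wt z <= 2 `^ p * wt y by apply: pow2 => //; lra.
  rewrite mulrC; apply: ler_pM => //; by rewrite lerDl.
have h : wt x <= 2 `^ p * wt y by apply: pow2 => //; lra.
by apply: ler_pM => //; rewrite lerDr.
Qed.

Let pow_diff (a b : R) : 1 <= b -> b <= a -> b `^ (- p) - a `^ (- p) <= p * (a - b) * b `^ (- p).
Proof.
move=> b1 ba; have b0 : 0 < b by exact: lt_le_trans b1.
have a0 : 0 < a by exact: lt_le_trans ba.
have -> : a `^ (- p) = b `^ (- p) * expR (- p * ln (a / b)).
  rewrite /powR !gt_eqF// -expRD ln_div ?posrE//; congr expR; ring.
rewrite -[X in X - _]mulr1 -mulrBr mulrC ler_wpM2r ?powR_ge0//.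
have h1 := expR_ge1Dx (- p * ln (a / b)).
have h2 : ln (a / b) <= a - b.
  have -> : a / b = 1 + (a - b) / b by rewrite mulrBl mulfV ?gt_eqF// addrC subrK.
  have ab0 : 0 <= (a - b) / b by rewrite divr_ge0 ?subr_ge0// ltW.
  apply: (@le_trans _ _ ((a - b) / b)); first by apply: le_ln1Dx; lra.
  by rewrite ler_piMr ?subr_ge0// invf_le1.
have := ler_wpM2l (ltW p0) h2; lra.
Qed.

(** The logarithmic derivative of the weight is bounded. *)
Lemma wt_lip x y : `|x - y| <= 1 -> `|wt x - wt y| <= p * 2 `^ p * `|x - y| * wt y.
Proof.
move=> xy1.
have xy := ler_dist_dist x y.
have q1 := pow2_ge1.
have [h|h] := leP `|x| `|y|.
- have := pow_diff (n1 x) (b := 1 + `|x|) (a := 1 + `|y|) ltac:(lra).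
  rewrite -/(wt x) -/(wt y) => h1.
  rewrite ger0_norm ?subr_ge0; last by apply: powRNmono => //; lra.
  apply: (le_trans h1).
  have -> : p * 2 `^ p * `|x - y| * wt y = p * (`|x - y| * (2 `^ p * wt y)) by ring.
  rewrite -mulrA ler_wpM2l ?(ltW p0)//.
  apply: ler_pM => //; last exact: wt_near.
    by rewrite subr_ge0; lra.
  by move: xy; rewrite ler_norml => /andP[]; lra.
- have := pow_diff (n1 y) (b := 1 + `|y|) (a := 1 + `|x|) ltac:(lra).
  rewrite -/(wt x) -/(wt y) => h1.
  rewrite distrC ger0_norm ?subr_ge0; last by apply: powRNmono => //; lra.
  apply: (le_trans h1); rewrite ler_wpM2r// -[leRHS]mulrA ler_wpM2l ?(ltW p0)//.
  rewrite -[leLHS]mul1r; apply: ler_pM => //; first by lra.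
  by move: xy; rewrite ler_norml => /andP[]; lra.
Qed.

(** The price, relative to the mean weight, of moving the weight from one
    point to another. *)
Definition wtQ x y : R := (wt x - wt y) ^+ 2 / (wt x + wt y).

Lemma wtQ_ge0 x y : 0 <= wtQ x y.
Proof. by rewrite divr_ge0 ?sqr_ge0// addr_ge0. Qed.

Lemma wtQC x y : wtQ x y = wtQ y x.
Proof. by rewrite /wtQ -sqrrN opprB [wt x + _]addrC. Qed.

Lemma wtQ_le x y : wtQ x y <= wt x + wt y.
Proof.
rewrite ler_pdivrMr ?addr_gt0// expr2.
by have := wt_ge0 x; have := wt_ge0 y; nra.
Qed.

Let C1 : R := (p * 2 `^ p) ^+ 2.
Let C2 : R := 2 `^ p * 2 `^ p.

(* At distance at most 1 the numerator of wtQ is quadratic by wt_lip and tames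
   the singularity of the kernel; at larger distances the kernel is at most a
   multiple of the weight of the difference, and wt_conv applies. *)
Let wtQ_ker x y : wtQ x y * ker (x - y) <=
  wt y * ((C1 + 1 + C2) * kap s (x - y) + C2 * (2 `^ p) * wt (x - y) + C2 * (2 `^ p) * wt x).
Proof.
have C10 : 0 <= C1 by exact: sqr_ge0.
have P0 : 0 < 2 `^ p :> R by rewrite powR_gt0.
have C20 : 0 <= C2 by rewrite mulr_ge0 ?ltW.
have k0 := kap_ge0 s (x - y).
set z := x - y in k0 *.
have wx := wt_ge0 x; have wy := wt_gt0 y; have wz := wt_ge0 z.
have CP : 0 <= C2 * 2 `^ p by rewrite mulr_ge0 ?(ltW P0).
have [z1|/ltW z1] := leP `|z| 1.
  apply: (@le_trans _ _ (wt y * (C1 * kap s z))).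
    apply: (@le_trans _ _ (C1 * `|z| ^+ 2 * wt y * ker z)).
      rewrite ler_wpM2r ?ker_ge0// ler_pdivrMr ?addr_gt0//.
      have := wt_lip z1; rewrite -/z => h.
      rewrite -[leLHS]ger0_norm ?sqr_ge0// normrX.
      apply: (@le_trans _ _ ((p * 2 `^ p * `|z| * wt y) ^+ 2)).
        by rewrite lerXn2r ?nnegrE// ?mulr_ge0 ?(ltW p0) ?(ltW P0) ?(ltW wy).
      have -> : (p * 2 `^ p * `|z| * wt y) ^+ 2 = C1 * `|z| ^+ 2 * wt y * wt y.
        by rewrite /C1; ring.
      rewrite ler_wpM2l ?lerDr// mulr_ge0 ?(ltW wy)// mulr_ge0// ?sqr_ge0.
    have -> : C1 * `|z| ^+ 2 * wt y * ker z = wt y * (C1 * (`|z| ^+ 2 * ker z)) by ring.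
    by rewrite ler_wpM2l ?(ltW wy)// ler_wpM2l// sqr_ker_le_kap.
  rewrite ler_wpM2l ?(ltW wy)//.
  have := mulr_ge0 C20 k0; have := mulr_ge0 CP wz; have := mulr_ge0 CP wx; lra.
apply: (@le_trans _ _ ((wt x + wt y) * ker z)).
  by rewrite ler_wpM2r ?ker_ge0// wtQ_le.
have kz := ker_le_kap z1.
have kw : ker z <= 2 `^ p * wt z.
  apply: (le_trans (ker_le_norm z)); apply: pow2 => //; [exact: lt_le_trans z1|lra].
have yxz : `|y| <= `|x| + `|z|.
  by have := ler_normB x z; rewrite (_ : x - z = y)// /z opprB addrC subrK.
have cv := wt_conv yxz.
have e1 : wt x * ker z <= wt y * (C2 * (wt x + wt z)).
  apply: (@le_trans _ _ (2 `^ p * (wt x * wt z))).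
    by rewrite mulrCA ler_wpM2l.
  apply: (@le_trans _ _ (2 `^ p * (2 `^ p * wt y * (wt x + wt z)))).
    by rewrite ler_wpM2l ?(ltW P0).
  by rewrite /C2 le_eqVlt; apply/orP; left; apply/eqP; ring.
have e2 : wt y * ker z <= wt y * kap s z by rewrite ler_wpM2l ?(ltW wy).
rewrite mulrDl; apply: (le_trans (lerD e1 e2)); rewrite -mulrDr ler_wpM2l ?(ltW wy)//.
have q1 := pow2_ge1.
have := mulr_ge0 C10 k0; have := mulr_ge0 C20 k0.
have : C2 * (wt x + wt z) <= C2 * 2 `^ p * (wt x + wt z).
  by rewrite ler_wpM2r ?addr_ge0// ler_peMr.
lra.
Qed.

Definition wtC0 : R :=
  (C1 + 1 + C2) * \int[mu]_z kap s z + 2 * (C2 * (2 `^ p) * \int[mu]_z wt z).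

Lemma wtC0_ge0 : 0 <= wtC0.
Proof.
have P0 : 0 <= 2 `^ p :> R by rewrite powR_ge0.
have I1 : 0 <= \int[mu]_z kap s z by apply: int_ge0 => z; exact: kap_ge0.
have I2 : 0 <= \int[mu]_z wt z by exact: int_ge0.
have C10 : 0 <= C1 by exact: sqr_ge0.
have C20 : 0 <= C2 by rewrite mulr_ge0.
by rewrite addr_ge0 ?mulr_ge0// addr_ge0 ?addr_ge0.
Qed.

Lemma measurable_wtQ : measurable_fun setT (fun w : 'rV[R]_d * 'rV[R]_d => wtQ w.1 w.2).
Proof.
have m1 : measurable_fun setT (fun w : 'rV[R]_d * 'rV[R]_d => wt w.1).
  by apply: (measurableT_comp measurable_wt); exact: measurable_fst.
have m2 : measurable_fun setT (fun w : 'rV[R]_d * 'rV[R]_d => wt w.2).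
  by apply: (measurableT_comp measurable_wt); exact: measurable_snd.
have mD := measurable_funD m1 m2.
apply: measurable_funM.
  exact: (measurable_funX 2 (measurable_funB m1 m2)).
rewrite (_ : (fun _ => _) = (fun w => (wt w.1 + wt w.2) `^ (- 1))).
  exact: (measurableT_comp (measurable_powR (- 1)) mD).
by apply/funext => w; rewrite powR_inv1 ?addr_ge0.
Qed.

(** The bound does not depend on the truncation radius e. *)
Lemma wtQ_int (e : R) y : 0 < e ->
  \int[mu]_z (kere e z * wtQ y (y - z)) <= wtC0 * wt y.
Proof.
move=> e0.
have mB : measurable_fun setT (fun z : 'rV[R]_d => y - z) by exact: measurable_rV_subr.
have mQ : measurable_fun setT (fun z => wtQ y (y - z)).
  exact: (measurable_comp_pair measurable_wtQ (measurable_cst y) mB).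
have ik : mu.-itg (kap s) by exact: itg_kap.
have iw := itg_wt.
have iwy := itg_reflect y iw.
pose g z := wt y * ((C1 + 1 + C2) * kap s z + C2 * 2 `^ p * wt z + C2 * 2 `^ p * wt (y - z)).
have ig : mu.-itg g by apply: itgZ; apply: itgD; [apply: itgD|]; exact: itgZ.
have h z : kere e z * wtQ y (y - z) <= g z.
  have := wtQ_ker (y - z) y; rewrite addrAC subrr add0r kerN.
  have -> : kap s (- z) = kap s z by rewrite /kap normrN.
  have -> : wt (- z) = wt z by rewrite /wt normrN.
  rewrite -/(g z); apply: le_trans; rewrite mulrC wtQC ler_wpM2l ?wtQ_ge0//.
  exact: kere_le_ker.
have mf : measurable_fun setT (fun z => kere e z * wtQ y (y - z)).
  by apply: measurable_funM => //; exact: measurable_kere.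
have f0 z : 0 <= kere e z * wtQ y (y - z) by rewrite mulr_ge0 ?kere_ge0 ?wtQ_ge0.
have jf : mu.-itg (fun z => kere e z * wtQ y (y - z)).
  by apply: (itg_dom mf ig) => z; rewrite ger0_norm.
apply: (le_trans (le_int jf ig h)); rewrite /g intZ; last first.
  by apply: itgD; [apply: itgD|]; exact: itgZ.
rewrite !intD ?intZ; try by [exact: itgZ|apply: itgD; exact: itgZ|].
rewrite (int_reflect y measurable_wt) mulrC ler_wpM2r//.
rewrite le_eqVlt; apply/orP; left; apply/eqP; rewrite /wtC0; ring.
Qed.

End weight.
#[global] Hint Extern 0 (is_true (_ <= wt _ _)) => exact: wt_ge0 : core.
#[global] Hint Extern 0 (is_true (_ < wt _ _)) => exact: wt_gt0 : core.

(** * Continuity of translations in the weighted L1 norm *)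

Definition bmeas dT (T : measurableType dT) (R : realType) (f : T -> R) :=
  measurable_fun setT f /\ exists M : R, forall x, `|f x| <= M.

Section bounded_measurable.
Context dT (T : measurableType dT) (R : realType).
Implicit Types f g : T -> R.

Lemma bmeasB f g : bmeas f -> bmeas g -> bmeas (fun x => f x - g x).
Proof.
move=> [mf [M Mf]] [mg [N Ng]]; split; first exact: measurable_funB.
by exists (M + N) => x; rewrite (le_trans (ler_normB _ _))// lerD.
Qed.

Lemma bmeasD f g : bmeas f -> bmeas g -> bmeas (fun x => f x + g x).
Proof.
move=> [mf [M Mf]] [mg [N Ng]]; split; first exact: measurable_funD.
by exists (M + N) => x; rewrite (le_trans (ler_normD _ _))// lerD.
Qed.

Lemma bmeasM f g : bmeas f -> bmeas g -> bmeas (fun x => f x * g x).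
Proof.
move=> [mf [M Mf]] [mg [N Ng]]; split; first exact: measurable_funM.
by exists (M * N) => x; rewrite normrM ler_pM.
Qed.

Lemma bmeas_cst (k : R) : bmeas (fun _ : T => k).
Proof. by split => //; exists `|k|. Qed.

Lemma bmeas_norm f : bmeas f -> bmeas (fun x => `|f x|).
Proof.
move=> [mf [M Mf]]; split; first exact: measurableT_comp.
by exists M => x; rewrite normr_id.
Qed.

Lemma bmeas_indic (A : set T) : measurable A -> bmeas (\1_A : T -> R).
Proof.
move=> mA; split; first exact: measurable_indic.
by exists 1 => x; rewrite indicE; case: (_ \in _); rewrite ?normr1 ?normr0.
Qed.

Lemma bmeas_sum (I : Type) (r : seq I) (F : I -> T -> R) :
  (forall i, bmeas (F i)) -> bmeas (fun x => \sum_(i <- r) F i x).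
Proof.
move=> bF; elim: r => [|i r IHr].
  by under eq_fun do rewrite big_nil; exact: bmeas_cst.
by under eq_fun do rewrite big_cons; exact: bmeasD.
Qed.

Lemma bmeas_comp dX (X : measurableType dX) (f : T -> R) (h : X -> T) :
  bmeas f -> measurable_fun setT h -> bmeas (fun x => f (h x)).
Proof.
move=> [mf [M Mf]] mh; split; first exact: measurableT_comp.
by exists M => x; exact: Mf.
Qed.

Lemma itg_bmeasM (m : {measure set T -> \bar R}) f g :
  bmeas f -> m.-itg g -> m.-itg (fun x => g x * f x).
Proof.
move=> [mf [M Mf]] ig; under eq_fun do rewrite mulrC.
exact: itg_bddM Mf ig.
Qed.

End bounded_measurable.

Lemma clamp_lipschitz (R : realDomainType) (u v : R) :
  `|Num.min 1 (Num.max 0 u) - Num.min 1 (Num.max 0 v)| <= `|u - v|.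
Proof.
have cl (a : R) : [\/ a <= 0 /\ Num.min 1 (Num.max 0 a) = 0,
    0 <= a <= 1 /\ Num.min 1 (Num.max 0 a) = a |
    1 <= a /\ Num.min 1 (Num.max 0 a) = 1].
  have [a0|/ltW a0] := leP a 0.
    by constructor 1; split => //; rewrite min_r.
  have [a1|/ltW a1] := leP a 1; last by constructor 3.
  by constructor 2; split => //; rewrite a0.
have := ler_norm (u - v); have := ler_norm (- (u - v)); rewrite normrN.
by case: (cl u) => -[? ->]; case: (cl v) => -[? ->]; rewrite ler_norml; lra.
Qed.

Section approximate_identity.
Variables (R : realType) (d : nat) (s : R).
Hypothesis s01 : 0 < s < 1.
Local Notation mu := (@lebesgue_rV R d).
Local Notation p := (d%:R + 2 * s).
Local Notation wt := (@wt R d s).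
Implicit Types (f g h : 'rV[R]_d -> R) (x z : 'rV[R]_d).

Definition wnorm f : R := \int[mu]_x (wt x * `|f x|).

(** The modulus of continuity of translations in the weighted L1 norm. *)
Definition wmod f z : R := wnorm (fun x => f (x - z) - f x).

Let iw : mu.-itg wt. Proof. exact: itg_wt. Qed.

Lemma bmeas_shift f z : bmeas f -> bmeas (fun x => f (x - z)).
Proof. by move=> bf; apply: (bmeas_comp bf); exact: measurable_rV_addr. Qed.

Lemma itg_wnorm f : bmeas f -> mu.-itg (fun x => wt x * `|f x|).
Proof. by move=> bf; apply: itg_bmeasM => //; exact: bmeas_norm. Qed.

Lemma wnorm_ge0 f : 0 <= wnorm f.
Proof. by apply: int_ge0 => x; rewrite mulr_ge0. Qed.

Lemma wnorm_le f g h : bmeas f -> bmeas g -> bmeas h ->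
  (forall x, `|f x| <= `|g x| + `|h x|) -> wnorm f <= wnorm g + wnorm h.
Proof.
move=> bf bg bh fgh; rewrite /wnorm -intD; [|exact: itg_wnorm..].
apply: le_int => [||x]; first exact: itg_wnorm.
  by apply: itgD; exact: itg_wnorm.
by rewrite -mulrDr ler_wpM2l.
Qed.

Lemma wnorm_shift f z : bmeas f -> `|z| <= 1 ->
  wnorm (fun x => f (x - z)) <= 2 `^ p * wnorm f.
Proof.
move=> bf z1; rewrite /wnorm.
have ms := measurable_rV_addr (- z).
have mg : measurable_fun setT (fun x => wt x * `|f (x - z)|).
  by apply: itg_measurable (itg_wnorm _); exact: bmeas_shift.
rewrite -(int_shift z mg) -intZ; last exact: itg_wnorm.
have mf := bf.1; have mn : measurable_fun setT (fun x => `|f x|) by exact: measurableT_comp.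
have sub x : `|x + z - x| <= 1 by rewrite addrC addKr.
have mw : measurable_fun setT (fun x => wt (x + z)).
  by apply: measurableT_comp; [exact: measurable_wt|exact: measurable_rV_addr].
apply: le_int => [||x].
- apply: (itg_dom (g := fun x => 2 `^ p * (wt x * `|f x|))).
  + by under eq_fun do rewrite addrK; exact: measurable_funM.
  + by apply: itgZ; exact: itg_wnorm.
  + move=> x; rewrite addrK normrM normr_id ger0_norm// mulrA ler_wpM2r//.
    exact: wt_near.
- by apply: itgZ; exact: itg_wnorm.
- by rewrite addrK mulrA ler_wpM2r// wt_near.
Qed.

Definition translation_continuous f :=
  forall e : R, 0 < e -> exists2 r : R, 0 < r <= 1 &
    forall z, `|z| <= r -> wmod f z <= e.

Local Notation tcont := translation_continuous.

Let bmod f z : bmeas f -> bmeas (fun x => f (x - z) - f x).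
Proof. by move=> bf; apply: bmeasB => //; exact: bmeas_shift. Qed.

(** Translations by at most 1 are uniformly bounded for the weighted norm, so
    that an approximation can be exchanged with a small translation. *)
Lemma tcont_approx f : bmeas f ->
  (forall e, 0 < e -> exists g, [/\ bmeas g, tcont g &
     wnorm (fun x => f x - g x) <= e]) -> tcont f.
Proof.
move=> bf cf e e0.
have P0 : 0 < 2 `^ p :> R by rewrite powR_gt0.
have e1 : 0 < e / 2 / (2 `^ p + 1) by rewrite !divr_gt0// addr_gt0.
have [g [bg gg fg]] := cf _ e1.
have [r r0 rg] := gg (e / 2) ltac:(lra).
exists r => // z zr; have z1 : `|z| <= 1 by move: r0 => /andP[_]; exact: le_trans.
pose h x := f x - g x; have bh : bmeas h by exact: bmeasB.
have bhs := bmeas_shift z bh.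
apply: (@le_trans _ _ (wnorm (fun x => h (x - z) - h x) + wmod g z)).
  apply: wnorm_le; [exact: bmod..|] => x.
  rewrite (_ : f (x - z) - f x = (h (x - z) - h x) + (g (x - z) - g x)).
    exact: ler_normD.
  by rewrite /h; ring.
have h1 : wnorm (fun x => h (x - z) - h x) <= wnorm (fun x => h (x - z)) + wnorm h.
  by apply: wnorm_le => //; [exact: bmod|move=> x; exact: ler_normB].
have h2 := wnorm_shift bh z1; have h3 := rg z zr.
have h4 : (2 `^ p + 1) * wnorm h <= e / 2.
  by rewrite mulrC -ler_pdivlMr// addr_gt0.
lra.
Qed.

Lemma tcontD f g : bmeas f -> bmeas g -> tcont f -> tcont g ->
  tcont (fun x => f x + g x).
Proof.
move=> bf bg gf gg e e0.
have [r /andP[r0 r1] rf] := gf (e / 2) ltac:(lra).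
have [t /andP[t0 t1] tg] := gg (e / 2) ltac:(lra).
exists (Num.min r t); first by rewrite lt_min r0 t0 ge_min r1.
move=> z; rewrite le_min => /andP[zr zt].
apply: (@le_trans _ _ (wmod f z + wmod g z)).
  apply: wnorm_le; [by apply: bmod; exact: bmeasD|exact: bmod..|] => x.
  by rewrite opprD addrACA ler_normD.
by have := rf z zr; have := tg z zt; lra.
Qed.

Lemma tcontZ k f : bmeas f -> tcont f -> tcont (fun x => k * f x).
Proof.
move=> bf gf e e0; have k0 : 0 < `|k| + 1 by rewrite ltr_wpDl.
have [r r0 rf] := gf (e / (`|k| + 1)) ltac:(exact: divr_gt0).
exists r => // z /rf; rewrite ler_pdivlMr// => h.
apply: le_trans h; rewrite /wmod /wnorm mulrC -intZ; last first.
  by apply: itg_wnorm; exact: bmod.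
have ib : mu.-itg (fun x => wt x * `|k * f (x - z) - k * f x|).
  apply: itg_wnorm; apply: (bmod z (f := fun x => k * f x)).
  by apply: bmeasM => //; exact: bmeas_cst.
apply: le_int => // [|x]; first by apply: itgZ; apply: itg_wnorm; exact: bmod.
rewrite -mulrBr normrM [leRHS]mulrCA ler_wpM2l// ler_wpM2r// lerDl//.
Qed.

Lemma lipschitz_tcont f (L : R) : bmeas f ->
  (forall x z, `|f (x - z) - f x| <= L * `|z|) -> tcont f.
Proof.
move=> bf Lf e e0; have I0 : 0 <= \int[mu]_x wt x by exact: int_ge0.
have k0 : 0 < `|L| * \int[mu]_x wt x + 1 by rewrite ltr_wpDl// mulr_ge0.
exists (Num.min 1 (e / (`|L| * \int[mu]_x wt x + 1))).
  by rewrite lt_min ltr01 divr_gt0//= ge_min lexx.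
move=> z; rewrite le_min => /andP[z1]; rewrite ler_pdivlMr// => h.
apply: le_trans h; rewrite /wmod /wnorm.
apply: (@le_trans _ _ (\int[mu]_x (`|L| * `|z| * wt x))).
  apply: le_int; [by apply: itg_wnorm; exact: bmod|exact: itgZ|] => x.
  rewrite mulrC ler_wpM2r// (le_trans (Lf _ _))//.
  by rewrite ler_wpM2r// ler_norm.
rewrite intZ// mulrDr mulr1 mulrA [`|L| * _]mulrC lerDl//.
Qed.

(** Dominated convergence: weighted L1 limits of bounded sequences. *)
Lemma tcont_lim (F : nat -> 'rV[R]_d -> R) f (M : R) :
  (forall n, bmeas (F n)) -> (forall n, tcont (F n)) -> bmeas f ->
  (forall n x, `|f x - F n x| <= M) ->
  (forall x, F n x @[n --> \oo] --> f x) -> tcont f.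
Proof.
move=> bF gF bf FM Ff; apply: tcont_approx => // e e0.
have : (\int[mu]_x (wt x * `|f x - F n x|)) @[n --> \oo] --> \int[mu]_x (cst 0 x : R).
  apply: (dominated_int_cvg (g := fun x => M * wt x)).
  - by move=> n; apply: itg_measurable (itg_wnorm _); exact: bmeasB.
  - move=> x; rewrite -[cst 0 x]/(0 : R) -(mulr0 (wt x)); apply: cvgMr.
    apply/norm_cvg0P; rewrite -(subrr (f x)); apply: cvgB => //; exact: cvg_cst.
  - exact: itgZ.
  - by move=> n x; rewrite ger0_norm ?mulr_ge0// mulrC ler_wpM2r.
rewrite Rintegral_cst// mul0r => /cvgrPdist_le/(_ e e0)[N _ /(_ N (leqnn _))] /=.
rewrite sub0r normrN => h; exists (F N); split => //.
by apply: le_trans h; rewrite ler_norm.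
Qed.

Local Notation ind A := (\1_(A : set 'rV[R]_d) : 'rV[R]_d -> R).

(** The sets whose indicator is continuous under translations form a
    sigma-algebra that contains the half spaces, hence all measurable sets;
    simple functions and monotone limits then reach every bounded measurable
    function. *)
Definition tcont_set : set_system 'rV[R]_d :=
  [set A | measurable A /\ tcont (ind A)].

Lemma tcont_setT : tcont_set setT.
Proof.
split => //; apply: (lipschitz_tcont (L := 0)); first exact: bmeas_indic.
by move=> x z; rewrite !indicT subrr normr0 mul0r.
Qed.

Lemma tcont_setC A : tcont_set A -> tcont_set (~` A).
Proof.
move=> [mA gA]; split; first exact: measurableC.
move=> e e0; have [r r0 rA] := gA _ e0; exists r => // z zr.
apply: le_trans (rA z zr); rewrite /wmod le_eqVlt; apply/orP; left; apply/eqP.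
apply: eq_Rintegral => x _; congr (_ * _).
rewrite !indicE !in_setC; case: (_ \in A); case: (_ \in A) => /=;
  by rewrite ?subrr ?normr0// ?subr0 ?sub0r ?normrN.
Qed.

Lemma tcont_setU A B : tcont_set A -> tcont_set B -> tcont_set (A `|` B).
Proof.
move=> [mA gA] [mB gB]; split; first exact: measurableU.
have bA := bmeas_indic R mA; have bB := bmeas_indic R mB.
have bAB := bmeas_indic R (measurableU _ _ mA mB).
move=> e e0.
have [r /andP[r0 r1] rf] := gA (e / 2) ltac:(lra).
have [t /andP[t0 t1] tg] := gB (e / 2) ltac:(lra).
exists (Num.min r t); first by rewrite lt_min r0 t0 ge_min r1.
move=> z; rewrite le_min => /andP[zr zt].
apply: (@le_trans _ _ (wmod (ind A) z + wmod (ind B) z)).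
  apply: wnorm_le; [exact: bmod..|] => x.
  rewrite !indicE !in_setU.
  case: (_ \in A); case: (_ \in A); case: (_ \in B); case: (_ \in B) => /=;
  by rewrite ?subrr ?normr0 ?addr0 ?subr0 ?sub0r ?normrN ?normr1 ?add0r// ?lerDl.
by have := rf z zr; have := tg z zt; lra.
Qed.

Lemma tcont_bigcup (F : (set 'rV[R]_d)^nat) :
  (forall n, tcont_set (F n)) -> tcont_set (\bigcup_n F n).
Proof.
move=> gF; have mU : measurable (\bigcup_n F n).
  by apply: bigcup_measurable => n _; exact: (gF n).1.
have gS n : tcont_set (\big[setU/set0]_(i < n) F i).
  elim: n => [|n IHn]; last by rewrite big_ord_recr; exact: tcont_setU.
  by rewrite big_ord0 -setCT; apply: tcont_setC; exact: tcont_setT.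
split => //.
apply: (tcont_lim (F := fun n => ind (\big[setU/set0]_(i < n) F i)) (M := 1)).
- by move=> n; apply: bmeas_indic; exact: (gS n).1.
- by move=> n; exact: (gS n).2.
- exact: bmeas_indic.
- move=> n x; rewrite !indicE; case: (_ \in _); case: (_ \in _) => /=;
  by rewrite ?subrr ?normr0 ?subr0 ?sub0r ?normrN ?normr1.
move=> x; apply: cvg_near_cst.
have [Ux|nUx] := pselect ((\bigcup_n F n) x); last first.
  apply: nearW => n; rewrite !indicE !memNset//.
  by rewrite -bigcup_mkord => -[i _ Fi]; apply: nUx; exists i.
have [i _ Fix] := Ux; exists i.+1 => // n /= ni.
by rewrite !indicE !mem_set// -bigcup_mkord; exists i.
Qed.

(** Clamped affine functions are Lipschitz and converge to the indicator of a
    half space. *)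
Lemma tcont_ray (i : 'I_d) (a : R) : tcont_set [set x | a < x ord0 i].
Proof.
have mc := @measurable_coord R d i.
have mA : measurable [set x : 'rV[R]_d | a < x ord0 i].
  rewrite -[X in measurable X]setTI.
  exact: (measurable_fun_ltr (measurable_cst a) mc).
split => //.
pose h (n : nat) (x : 'rV[R]_d) : R := Num.min 1 (Num.max 0 (n%:R * (x ord0 i - a))).
have h01 n x : 0 <= h n x <= 1.
  by rewrite /h le_min ler01/= ge_min le_max !lexx.
have bh n : bmeas (h n).
  split; last by exists 1 => x; have /andP[? ?] := h01 n x; rewrite ger0_norm.
  apply: measurable_minr => //; apply: measurable_maxr => //.
  by apply: measurable_funM => //; exact: measurable_funB.
apply: (tcont_lim (F := h) (M := 1)) => //.
- move=> n; apply: (lipschitz_tcont (L := n%:R)) => // x z.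
  have n0 : 0 <= n%:R :> R by [].
  have xz : `|(x - z) ord0 i - x ord0 i| <= `|z|.
    rewrite !mxE addrC addKr normrN [leRHS]rV_normE.
    exact: (le_bigmax _ (fun i => `|z ord0 i|)).
  apply: (@le_trans _ _ `|n%:R * ((x - z) ord0 i - a) - n%:R * (x ord0 i - a)|).
    exact: clamp_lipschitz.
  rewrite -mulrBr (_ : (x - z) ord0 i - a - _ = (x - z) ord0 i - x ord0 i); last ring.
  by rewrite normrM ger0_norm// ler_wpM2l.
- exact: bmeas_indic.
- move=> n x; have /andP[? ?] := h01 n x; rewrite indicE.
  by case: (_ \in _) => /=; rewrite ler_norml; lra.
- move=> x; have [ax|xa] := ltP a (x ord0 i); last first.
    apply: cvg_near_cst; apply: nearW => n; rewrite indicE memNset/=; last first.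
      by apply/negP; rewrite -leNgt.
    rewrite /h max_l ?min_r// mulr_ge0_le0// subr_le0//.
  apply: cvg_near_cst; exists (Num.truncn (x ord0 i - a)^-1).+1 => // n /= nn.
  rewrite indicE mem_set//= /h min_l// le_max; apply/orP; right.
  rewrite -ler_pdivrMr ?subr_gt0// mul1r ltW//.
  by apply: (lt_le_trans (truncnS_gt _)); rewrite ler_nat.
Qed.

Lemma measurable_tcont_set A : measurable A -> tcont_set A.
Proof.
move: A; apply: smallest_sub.
  split.
  - by rewrite -setCT; apply: tcont_setC; exact: tcont_setT.
  - by move=> B /tcont_setC; rewrite setTD.
  - exact: tcont_bigcup.
move=> A; rewrite -bigcup_seq/= => -[i _ [B mB <-]]; rewrite setTI.
have : <<s @ocitv R >> `<=`
    [set B | tcont_set ((fun x : 'rV[R]_d => x ord0 i) @^-1` B)]; last exact.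
apply: smallest_sub.
  split.
  - by rewrite /= preimage_set0 -setCT; apply: tcont_setC; exact: tcont_setT.
  - by move=> C gC; rewrite /= setTD preimage_setC; exact: tcont_setC.
  - by move=> F gF; rewrite /= preimage_bigcup; exact: tcont_bigcup.
move=> _ [[a b] _ <-] /=.
have g : tcont_set (~` (~` [set x | a < x ord0 i] `|` [set x | b < x ord0 i])).
  by apply: tcont_setC; apply: tcont_setU; [apply: tcont_setC|]; exact: tcont_ray.
apply: (eq_ind _ tcont_set g).
apply/seteqP; split => x /=; rewrite in_itv/=.
  by move=> /not_orP[/contrapT -> /negP]; rewrite -leNgt.
move=> /andP[ax xb]; apply/not_orP; split; first exact.
by apply/negP; rewrite -leNgt.
Qed.

Lemma tcont_sum (I : Type) (r : seq I) (c : I -> R) (A : I -> set 'rV[R]_d) :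
  (forall i, measurable (A i)) ->
  tcont (fun x => \sum_(i <- r) c i * \1_(A i) x).
Proof.
move=> mA; have bA i := bmeas_indic R (mA i).
have bcA i : bmeas (fun x => c i * ind (A i) x).
  by apply: bmeasM => //; exact: bmeas_cst.
elim: r => [|i r IHr].
  under eq_fun do rewrite big_nil.
  apply: (lipschitz_tcont (L := 0)); first exact: bmeas_cst.
  by move=> x z; rewrite subrr normr0 mul0r.
under eq_fun do rewrite big_cons.
apply: tcontD => //; first exact: bmeas_sum.
by apply: tcontZ => //; exact: (measurable_tcont_set (mA i)).2.
Qed.

Import HBNNSimple.

Lemma bmeas_tcont f : bmeas f -> tcont f.
Proof.
have pos g : bmeas g -> (forall x, 0 <= g x) -> tcont g.
  move=> bg g0; have [mg [M Mg]] := bg.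
  have mEg : measurable_fun setT (EFin \o g) by exact/measurable_EFinP.
  pose G := nnsfun_approx measurableT mEg.
  have Gg x : G n x @[n --> \oo] --> g x.
    have := cvg_nnsfun_approx measurableT mEg (fun x _ => g0 x) (x := x) Logic.I.
    by move/fine_cvg.
  have Gle n x : G n x <= g x.
    have ndG : nondecreasing_seq (G ^~ x).
      by move=> k m km; exact/lefP/nd_nnsfun_approx.
    by have := nondecreasing_cvgn_le ndG (cvgP _ (Gg x)) n; rewrite (cvg_lim _ (Gg x)).
  have bG n : bmeas (G n).
    split => //; exists M => x; rewrite ger0_norm//.
    by rewrite (le_trans (Gle n x))// (le_trans (ler_norm _)).
  apply: (tcont_lim (F := fun n => G n) (M := M)) => //.
    move=> n; have E := funext (fimfunEord (G n)).
    rewrite /= in E; rewrite E; apply: tcont_sum => i.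
    exact: measurable_sfunP.
  move=> n x; rewrite ger0_norm ?subr_ge0//.
  by rewrite lerBlDr (le_trans (ler_norm _))// (le_trans (Mg x))// lerDl.
move=> bf; have [mf [M Mf]] := bf.
have M0 : 0 <= M by exact: le_trans (Mf 0).
have bfM : bmeas (fun x => f x + M) by apply: bmeasD => //; exact: bmeas_cst.
have gfM : tcont (fun x => f x + M).
  by apply: pos => // x; have := Mf x; rewrite ler_norml; lra.
move=> e /gfM[r r0 rf]; exists r => // z /rf.
rewrite /wmod (_ : (fun x => _) = (fun x => f (x - z) - f x))//.
by apply/funext => x; ring.
Qed.

End approximate_identity.

(** * Quadratic forms of primitives *)

Section time_forms.
Variable R : realType.
Local Notation lam := (@lebesgue_measure R).
Implicit Types (k h : R -> R) (t r : R).

Definition btw t r : R := if 0 <= r <= t then 1 else 0.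

(** The primitive vanishing at 0, for nonnegative times. *)
Definition prim k t : R := \int[lam]_r (btw t r * k r).

Lemma btw_ge0 t r : 0 <= btw t r. Proof. by rewrite /btw; case: ifP. Qed.

Lemma btw_le1 t r : btw t r <= 1. Proof. by rewrite /btw; case: ifP. Qed.

Lemma btw_indic t : btw t = \1_(`[0, t]%classic) :> (R -> R).
Proof.
apply/funext => r; rewrite /btw indicE.
case: ifPn => h; [rewrite mem_set|rewrite memNset] => //=; rewrite in_itv//=.
exact/negP.
Qed.

Lemma measurable_btw : measurable_fun setT (fun z : R * R => btw z.1 z.2).
Proof.
have m1 : measurable_fun setT (fun z : R * R => z.1) by exact: measurable_fst.
have m2 : measurable_fun setT (fun z : R * R => z.2) by exact: measurable_snd.
rewrite /btw; apply: measurable_fun_ifT => //.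
by apply: measurable_and; apply: measurable_fun_ler.
Qed.

Lemma measurable_btw_comp dT (T : measurableType dT) (f g : T -> R) :
  measurable_fun setT f -> measurable_fun setT g ->
  measurable_fun setT (fun w => btw (f w) (g w)).
Proof. by move=> mf mg; exact: (measurable_comp_pair measurable_btw mf mg). Qed.

Lemma measurable_btw1 t : measurable_fun setT (btw t).
Proof. by rewrite btw_indic; exact: measurable_indic. Qed.

Lemma itg_btw t : lam.-itg (btw t).
Proof. by rewrite btw_indic; exact: integrable_indic_itv. Qed.

Lemma itg_btwM t k : bmeas k -> lam.-itg (fun r => btw t r * k r).
Proof. by move=> bk; apply: itg_bmeasM => //; exact: itg_btw. Qed.

Lemma btwSS S t r : t <= S -> btw S r * btw t r = btw t r.
Proof.
move=> tS; rewrite /btw; case: (boolP (0 <= r <= t)) => [/andP[r0 rt]|_].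
  by rewrite r0 (le_trans rt tS) mulr1.
by rewrite mulr0.
Qed.

Lemma int_diag h t : \int[lam]_r (if r == t then h r else 0) = 0.
Proof.
rewrite -[RHS](Rintegral_set1 h t) [RHS]Rintegral_mkcond.
apply: eq_Rintegral => r _; rewrite patchE; case: eqVneq => [->|rt].
  by rewrite mem_set.
by rewrite memNset//=; exact/eqP.
Qed.

(** Integrate over the square and split it along the diagonal. *)
Lemma int_primitive_sqr K : lam.-itg K ->
  2 * \int[lam]_r (K r * \int[lam]_q (if (q : R) <= (r : R) then K q else 0)) =
  (\int[lam]_r K r) ^+ 2.
Proof.
move=> iK; have mK := itg_measurable iK.
have mK1 : measurable_fun setT (fun z : R * R => K z.1) by exact: measurableT_comp.
have mK2 : measurable_fun setT (fun z : R * R => K z.2) by exact: measurableT_comp.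
have m1 : measurable_fun setT (fun z : R * R => z.1) by exact: measurable_fst.
have m2 : measurable_fun setT (fun z : R * R => z.2) by exact: measurable_snd.
have iA (b : R * R -> bool) : measurable_fun setT b ->
    (lam \x lam)%E.-itg (fun z => if b z then K z.1 * K z.2 else 0).
  move=> mb; refine (@itg_prodM _ _ _ _ _ lam lam
    (fun z : R * R => if b z then K z.1 * K z.2 else 0)
    (fun r => `|K r|) (fun r => `|K r|) _ _ _ _).
  - by apply: measurable_fun_ifT => //; exact: measurable_funM.
  - exact: itg_norm.
  - exact: itg_norm.
  - move=> x y /=; case: ifP => _; first by rewrite normrM.
    by rewrite normr0 mulr_ge0.
have iif (b : R -> bool) : measurable_fun setT b ->
    lam.-itg (fun q => if b q then K q else 0).
  move=> mb; apply: (itg_dom (g := fun q => `|K q|)).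
  - exact: measurable_fun_ifT.
  - exact: itg_norm.
  - by move=> x; case: ifP; rewrite ?normr0.
pose A := fun z : R * R => if z.2 <= z.1 then K z.1 * K z.2 else 0.
pose B := fun z : R * R => if z.1 <= z.2 then K z.1 * K z.2 else 0.
have jA : (lam \x lam)%E.-itg A.
  by apply: (iA (fun z => z.2 <= z.1)); exact: measurable_fun_ler.
have jB : (lam \x lam)%E.-itg B.
  by apply: (iA (fun z => z.1 <= z.2)); exact: measurable_fun_ler.
have mle r : measurable_fun setT (fun q : R => q <= r) by exact: measurable_fun_ler.
have mge r : measurable_fun setT (fun q : R => r <= q) by exact: measurable_fun_ler.
have meq r : measurable_fun setT (fun q : R => q == r) by exact: measurable_fun_eqr.
have EA (r : R) : K r * \int[lam]_q (if (q : R) <= r then K q else 0) = \int[lam]_q A (r, q).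
  rewrite -intZ; last exact: iif.
  by apply: eq_Rintegral => q _; rewrite /A/=; case: ifP => _; rewrite ?mulr0.
have EB (r : R) : \int[lam]_q B (r, q) = K r * \int[lam]_q (if r <= (q : R) then K q else 0).
  rewrite -intZ; last exact: iif.
  by apply: eq_Rintegral => q _; rewrite /B/=; case: ifP => _; rewrite ?mulr0.
under eq_Rintegral do rewrite EA.
have AB : \int[lam]_r \int[lam]_q A (r, q) = \int[lam]_r \int[lam]_q B (r, q).
  rewrite (int_swap jA); apply: eq_Rintegral => q _; apply: eq_Rintegral => r _.
  by rewrite /A /B/= mulrC.
rewrite mulr_natl mulr2n {2}AB -intD; [|exact: (itg_int2 jA)|exact: (itg_int2 jB)].
rewrite expr2 -intZ//; apply: eq_Rintegral => r _.
rewrite -EA EB -mulrDr [RHS]mulrC; congr (_ * _).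
rewrite -intD; [|exact: iif..].
rewrite -[RHS]addr0 -[X in _ = _ + X](int_diag K r) -intD//; last exact: (iif (fun q => q == r)).
by apply: eq_Rintegral => q _; case: ltgtP => _; rewrite ?addr0 ?add0r.
Qed.

Lemma prim_sqr k t : bmeas k -> prim k t ^+ 2 = 2 * prim (fun r => k r * prim k r) t.
Proof.
move=> bk; rewrite -(int_primitive_sqr (itg_btwM t bk)); congr (2 * _).
apply: eq_Rintegral => r _; rewrite -mulrA /btw.
case: ifP => [/andP[r0 rt]|]; last by rewrite !mul0r.
rewrite !mul1r; congr (_ * _); apply: eq_Rintegral => q _.
rewrite /btw; case: (boolP (@Order.le _ R q r)) => qr.
  by rewrite (le_trans qr rt).
by rewrite andbF mul0r.
Qed.

Lemma measurable_prim k : measurable_fun setT k -> measurable_fun setT (prim k).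
Proof.
move=> mk.
refine (@measurable_int2 _ _ _ _ _ lam (fun z : R * R => btw z.1 z.2 * k z.2) _).
by apply: measurable_funM; [exact: measurable_btw|exact: measurableT_comp].
Qed.

Lemma ae_neq0 : {ae lam, forall t, t != 0}.
Proof.
exists [set 0]; split; [exact: measurable_set1|exact: lebesgue_measure_set1|].
by move=> t /= /negP; rewrite negbK => /eqP.
Qed.

Lemma int_btw t : 0 <= t -> \int[lam]_r btw t r = t.
Proof.
move=> t0; rewrite btw_indic int_indic//=.
rewrite lebesgue_measure_itv/= lte_fin; case: ifPn => [_|]; first by rewrite /= subr0.
by rewrite -leNgt => t0'; apply/le_anti; rewrite t0.
Qed.

Lemma norm_prim_le k t (M : R) : bmeas k -> 0 <= t -> (forall r, `|k r| <= M) ->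
  `|prim k t| <= M * t.
Proof.
move=> bk t0 kM; apply: (@le_trans _ _ (\int[lam]_r (M * btw t r))).
  apply: norm_int_le => [||r].
  - by apply: measurable_funM; [exact: measurable_btw1|exact: bk.1].
  - exact: itgZ (itg_btw t).
  - by rewrite normrM ger0_norm ?btw_ge0// mulrC ler_wpM2r// btw_ge0.
by rewrite intZ ?int_btw//; exact: itg_btw.
Qed.

Lemma bmeas_btw_prim S k : bmeas k -> bmeas (fun t => btw S t * prim k t).
Proof.
move=> bk; split.
  apply: measurable_funM; first exact: measurable_btw1.
  exact: measurable_prim bk.1.
have [_ [M Mk]] := bk; have M0 : 0 <= M by exact: le_trans (Mk 0).
exists (M * `|S|) => t; rewrite /btw; case: ifP => [/andP[t0 tS]|_].
  rewrite mul1r (le_trans (norm_prim_le _ _ Mk))// ler_wpM2l//.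
  by rewrite (le_trans tS)// ler_norm.
by rewrite mul0r normr0 mulr_ge0.
Qed.

Section exponential_weight.
Variables (S L : R).
Hypotheses (S0 : 0 < S) (L0 : 0 < L).

(** An exponential weight on [0, S], and minus its primitive there that vanishes
    at S. By int_th_prim, pairing a density with its own primitive against th
    yields the square of the primitive against tm; by th_le, tm is at least L
    times th. Taking L large makes this square dominate other quadratic terms. *)
Definition tm t : R := btw S t * expR (- (L * t)).

Definition th r : R := \int[lam]_t (btw t r * tm t).

Lemma measurable_tm : measurable_fun setT tm.
Proof.
apply: measurable_funM; first exact: measurable_btw1.
by apply: measurableT_comp => //; apply: measurableT_comp.
Qed.

Lemma tm_ge0 t : 0 <= tm t. Proof. by rewrite mulr_ge0 ?btw_ge0 ?expR_ge0. Qed.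

Lemma tm_le_btw t : tm t <= btw S t.
Proof.
rewrite /tm /btw; case: ifP => [/andP[t0 _]|_]; last by rewrite mul0r.
by rewrite mul1r -expR0 ler_expR oppr_le0 mulr_ge0// ltW.
Qed.

Lemma itg_tm : lam.-itg tm.
Proof.
refine (@itg_dom _ _ _ lam tm (btw S) measurable_tm (itg_btw S) _) => t.
by rewrite ger0_norm ?tm_ge0 ?tm_le_btw.
Qed.

Lemma measurable_th : measurable_fun setT th.
Proof.
refine (@measurable_int2 _ _ _ _ _ lam (fun z : R * R => btw z.2 z.1 * tm z.2) _).
apply: measurable_funM; last by apply: measurableT_comp => //; exact: measurable_tm.
exact: (measurable_comp_pair measurable_btw measurable_snd measurable_fst).
Qed.

Lemma th_ge0 r : 0 <= th r.
Proof. by apply: int_ge0 => t; rewrite mulr_ge0 ?btw_ge0 ?tm_ge0. Qed.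

Lemma int_expN a b : a < b ->
  \int[lam]_(t in `[a, b]) expR (- (L * t)) = (expR (- (L * a)) - expR (- (L * b))) / L.
Proof.
move=> ab; pose F t := - (L^-1 * expR (- (L * t))).
have dF t : is_derive t 1 F (expR (- (L * t))).
  rewrite /F; apply: is_derive_eq.
  by rewrite /GRing.scale/=; field; rewrite gt_eqF.
have cexp : continuous (fun t => expR (- (L * t))).
  move=> t; apply: (@continuous_comp _ _ _ (fun t => - (L * t)) expR).
    by apply: continuousN; apply: continuousM => //; exact: cst_continuous.
  exact: continuous_expR.
have cF : continuous F.
  by move=> t; apply/differentiable_continuous/derivable1_diffP; case: (dF t).
rewrite /Rintegral (@continuous_FTC2 _ _ F)//.
- by rewrite -EFinB /F/=; field; rewrite gt_eqF.
- exact: continuous_subspaceT.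
- split.
  + by move=> t _; case: (dF t).
  + by apply: cvg_at_right_filter; exact: cF.
  + by apply: cvg_at_left_filter; exact: cF.
- by move=> t _; rewrite derive1E; case: (dF t) => _ ->.
Qed.

Lemma th_out r : ~~ (0 <= r <= S) -> th r = 0.
Proof.
move=> h; rewrite /th; under eq_Rintegral => t _.
  have -> : btw t r * tm t = 0.
    rewrite /tm mulrA /btw; case: ifP; case: ifP; rewrite ?mul0r ?mulr0 ?mul0r//.
    move=> /andP[t0 tS] /andP[r0 rt]; case/negP: h.
    by rewrite r0 (le_trans rt tS).
  over.
by rewrite Rintegral_cst// mul0r.
Qed.

Lemma thE r : 0 <= r <= S -> th r = (expR (- (L * r)) - expR (- (L * S))) / L.
Proof.
move=> /andP[r0 rS].
have -> : th r = \int[lam]_(t in `[r, S]) expR (- (L * t)).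
  rewrite Rintegral_mkcond; apply: eq_Rintegral => t _.
  rewrite patchE /tm mulrA /btw r0 /=; case: ifPn => rt; last first.
    rewrite mul0r mul0r memNset//= in_itv/= (negbTE rt)//.
  rewrite (le_trans r0 rt)/=; case: ifPn => tS.
    by rewrite mem_set/= ?in_itv/= ?rt ?tS// !mul1r.
  by rewrite mulr0 mul0r memNset//= in_itv/= (negbTE tS) andbF.
move: rS; rewrite le_eqVlt => /predU1P[->|rS]; last exact: int_expN.
by rewrite set_itv1 Rintegral_set1 subrr mul0r.
Qed.

Lemma th_gt0 r : 0 <= r < S -> 0 < th r.
Proof.
move=> /andP[r0 rS]; rewrite thE ?r0 ?ltW// divr_gt0// subr_gt0 ltr_expR ltrN2.
by rewrite ltr_pM2l.
Qed.

Lemma th_le r : th r <= L^-1 * tm r.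
Proof.
have [h|h] := boolP (0 <= r <= S); last first.
  by rewrite th_out// mulr_ge0 ?tm_ge0// invr_ge0 ltW.
rewrite thE// /tm /btw h mul1r mulrC ler_wpM2l ?invr_ge0 ?(ltW L0)//.
by rewrite gerBl expR_ge0.
Qed.

Lemma itg_th : lam.-itg th.
Proof.
refine (@itg_dom _ _ _ lam th _ measurable_th (itgZ L^-1 itg_tm) _) => r.
by rewrite ger0_norm ?th_ge0 ?th_le.
Qed.

Lemma th_btw r : btw S r * th r = th r.
Proof.
by rewrite {1}/btw; case: ifPn => h; rewrite ?mul1r// mul0r th_out.
Qed.

Lemma itg_th_prim k h : bmeas k -> bmeas h ->
  lam.-itg (fun t => th t * (h t * prim k t)).
Proof.
move=> bk bh.
rewrite (_ : (fun t => _) = fun t => th t * (h t * (btw S t * prim k t))).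
  by apply: itg_bmeasM; [apply: bmeasM => //; exact: bmeas_btw_prim|exact: itg_th].
by apply/funext => t; rewrite -[in LHS]th_btw; ring.
Qed.

Lemma itg_tm_prim_sqr k : bmeas k -> lam.-itg (fun t => tm t * prim k t ^+ 2).
Proof.
move=> bk.
rewrite (_ : (fun t => _) = fun t => tm t * ((btw S t * prim k t) * (btw S t * prim k t))).
  apply: itg_bmeasM itg_tm; apply: bmeasM; exact: bmeas_btw_prim.
apply/funext => t; rewrite /tm /btw; case: ifP => _; rewrite ?mul0r// !mul1r; ring.
Qed.

(** Integration by parts, in the form of Fubini for the integral that defines
    th; prim_sqr identifies the inner integral. *)
Lemma int_th_prim k : bmeas k ->
  \int[lam]_r (th r * (k r * prim k r)) =
  2^-1 * \int[lam]_t (tm t * prim k t ^+ 2).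
Proof.
move=> bk; have mk := bk.1; have mp := measurable_prim mk.
have mkp : measurable_fun setT (fun r => k r * prim k r) by exact: measurable_funM.
pose F := fun z : R * R => btw z.2 z.1 * tm z.2 * (k z.1 * prim k z.1).
have [_ [N Nk]] := bmeasM bk (bmeas_btw_prim S bk).
have iF : (lam \x lam)%E.-itg F.
  refine (@itg_prodM _ _ _ _ _ lam lam F (fun r => N * btw S r) tm _ _ _ _).
  - have m3 : measurable_fun setT (fun z : R * R => btw z.2 z.1).
      exact: (measurable_comp_pair measurable_btw measurable_snd measurable_fst).
    have m4 : measurable_fun setT (fun z : R * R => tm z.2).
      exact: (measurableT_comp measurable_tm measurable_snd).
    have m5 : measurable_fun setT (fun z : R * R => k z.1 * prim k z.1).
      exact: (measurableT_comp mkp measurable_fst).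
    exact: (measurable_funM (measurable_funM m3 m4) m5).
  - exact: itgZ (itg_btw S).
  - exact: itg_tm.
  - move=> r' t'; move: (r' : R) (t' : R) => {r' t'} r t.
    have N0 : 0 <= N := le_trans (normr_ge0 _) (Nk 0).
    have rhs0 : 0 <= N * btw S r * tm t by rewrite !mulr_ge0 ?btw_ge0 ?tm_ge0.
    have bt0 : 0 <= btw t r * tm t by rewrite mulr_ge0 ?btw_ge0 ?tm_ge0.
    have bt1 : btw t r * tm t <= tm t by rewrite ler_piMl ?tm_ge0 ?btw_le1.
    have [/andP[r0 rt]|h] := boolP (0 <= r <= t); last first.
      by rewrite /F/= {1}/btw (negbTE h) !mul0r normr0.
    have [/andP[t0 tS]|h] := boolP (0 <= t <= S); last first.
      suff tm0 : tm t = 0 by rewrite /F/= tm0 mulr0 mul0r normr0 mulr0.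
      by rewrite /tm /btw (negbTE h) mul0r.
    have br : btw S r = 1 by rewrite /btw r0 (le_trans rt tS).
    have := Nk r; rewrite br mul1r mulr1 => kN.
    have -> : F (r, t) = k r * prim k r * (btw t r * tm t) by rewrite /F/= mulrC.
    by rewrite normrM (ger0_norm bt0) ler_pM.
transitivity (\int[lam]_r \int[lam]_t F (r, t)).
  apply: eq_Rintegral => r _; rewrite mulrC -intZ; last first.
    apply: (itg_dom _ itg_tm) => [|t].
      apply: measurable_funM; last exact: measurable_tm.
      exact: (measurable_comp_pair measurable_btw (@measurable_id _ _ setT) (measurable_cst r)).
    by rewrite normrM !ger0_norm ?btw_ge0 ?tm_ge0// ler_piMl ?tm_ge0 ?btw_le1.
  by apply: eq_Rintegral => t _; rewrite mulrC.
rewrite (int_swap iF) -intZ; last exact: itg_tm_prim_sqr.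
apply: eq_Rintegral => t _; rewrite prim_sqr// /F/=.
rewrite (_ : 2^-1 * _ = tm t * prim (fun r => k r * prim k r) t); last by field.
have [tS|tS] := boolP (0 <= (t : R) <= S); last first.
  have -> : tm t = 0 by rewrite /tm /btw (negbTE tS) mul0r.
  rewrite mul0r; under eq_Rintegral do rewrite mulr0 mul0r.
  by rewrite Rintegral_cst// mul0r.
rewrite -intZ.
  by apply: eq_Rintegral => r _; ring.
have /andP[_ tS'] := tS.
rewrite (_ : (fun r => _) = fun r => btw t r * (k r * (btw S r * prim k r))).
  by apply: itg_btwM; apply: bmeasM => //; exact: bmeas_btw_prim.
by apply/funext => r; rewrite -[in LHS](btwSS r tS'); ring.
Qed.

(** Write a al - b be as (a + b) / 2 (al - be) + (a - b) / 2 (al + be). The first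
    part pairs a density with its own primitive and gives a nonnegative square
    by int_th_prim; the second one is controlled by the difference of the two
    coefficients, up to a square of the primitive which the first one absorbs
    since L is large. *)
Lemma pair_energy (al be : R -> R) (a b c : R) :
  bmeas al -> bmeas be -> 0 < a -> 0 < b -> 0 < c -> (2 * c)^-1 <= L ->
  - c * ((a - b) ^+ 2 / (a + b)) * \int[lam]_t (th t * (al t ^+ 2 + be t ^+ 2)) <=
  \int[lam]_t (th t * ((a * al t - b * be t) * (prim al t - prim be t))).
Proof.
move=> bal bbe a0 b0 c0 Lc.
pose k t := al t - be t.
have bk : bmeas k by exact: bmeasB.
have pk t : prim al t - prim be t = prim k t.
  rewrite /prim -intB; [|exact: itg_btwM..].
  by apply: eq_Rintegral => r _; rewrite -mulrBr.
have bs : bmeas (fun t => al t ^+ 2 + be t ^+ 2).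
  by apply: bmeasD; under eq_fun do rewrite expr2; exact: bmeasM.
under [leRHS]eq_Rintegral do rewrite pk.
have ab0 : 0 < a + b by exact: addr_gt0.
set Q := (a - b) ^+ 2 / (a + b).
have Q0 : 0 <= Q by rewrite divr_ge0 ?sqr_ge0// ltW.
have i1 := itg_th_prim bk bk.
have i2 : lam.-itg (fun t => th t * (al t ^+ 2 + be t ^+ 2)).
  by apply: itg_bmeasM => //; exact: itg_th.
have i3' := itg_tm_prim_sqr bk.
have mp := measurable_prim bk.1.
have i3 : lam.-itg (fun t => th t * prim k t ^+ 2).
  apply: (itg_dom _ (itgZ L^-1 i3')) => [|t].
    apply: measurable_funM; [exact: measurable_th|exact: (measurable_funX 2 mp)].
  rewrite normrM !ger0_norm ?th_ge0 ?sqr_ge0// mulrA ler_wpM2r ?sqr_ge0//.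
  exact: th_le.
have i4 : lam.-itg (fun t => th t * ((a * al t - b * be t) * prim k t)).
  apply: itg_th_prim => //; apply: bmeasB; apply: bmeasM => //; exact: bmeas_cst.
(* Young's inequality: the difference of the two sides is a sum of squares *)
have pt t : (a + b) / 2 * (th t * (k t * prim k t)) -
    c * Q * (th t * (al t ^+ 2 + be t ^+ 2)) -
    (a + b) / (8 * c) * (th t * prim k t ^+ 2) <=
    th t * ((a * al t - b * be t) * prim k t).
  rewrite ![_ * (th t * _)]mulrCA -!mulrBr ler_wpM2l ?th_ge0//.
  rewrite -subr_ge0; set x := al t; set y := be t; set D := prim k t.
  have -> : k t = x - y by [].
  have -> : (a * x - b * y) * D - ((a + b) / 2 * ((x - y) * D) -
      c * Q * (x ^+ 2 + y ^+ 2) - (a + b) / (8 * c) * D ^+ 2) =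
    (c / (2 * (a + b))) * ((a - b) * (x + y) + (a + b) / (2 * c) * D) ^+ 2 +
    c / 2 * Q * (x - y) ^+ 2.
    by rewrite /Q; field; rewrite !gt_eqF.
  apply: addr_ge0; apply: mulr_ge0; rewrite ?sqr_ge0//.
    by rewrite divr_ge0 ?(ltW c0)// mulr_ge0 ?(ltW ab0).
  by rewrite mulr_ge0// divr_ge0 ?(ltW c0).
apply: le_trans (le_int _ i4 pt); last first.
  by apply: itgB; [apply: itgB|]; exact: itgZ.
rewrite !intB ?intZ//; try by [exact: itgZ|apply: itgB; exact: itgZ].
rewrite int_th_prim//.
have h : \int[lam]_t (th t * prim k t ^+ 2) <= L^-1 * \int[lam]_t (tm t * prim k t ^+ 2).
  rewrite -intZ//; apply: le_int => //; first exact: itgZ.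
  by move=> t; rewrite mulrA ler_wpM2r ?sqr_ge0// th_le.
set I3 := \int[lam]_t (th t * prim k t ^+ 2) in h *.
set I3' := \int[lam]_t (tm t * prim k t ^+ 2) in h *.
have I30 : 0 <= I3 by apply: int_ge0 => t; rewrite mulr_ge0 ?th_ge0 ?sqr_ge0.
have h' : L * I3 <= I3' by rewrite mulrC -ler_pdivlMr// mulrC.
have h2 : (2 * c)^-1 * I3 <= I3' by apply: le_trans h'; rewrite ler_wpM2r.
have -> : (a + b) / (8 * c) = (a + b) / 4 * (2 * c)^-1 by field; rewrite gt_eqF.
rewrite !mulNr [leRHS]addrAC lerDr.
have -> : (a + b) / 2 * (2^-1 * I3') - (a + b) / 4 / (2 * c) * I3 =
  (a + b) / 4 * (I3' - (2 * c)^-1 * I3) by field; rewrite gt_eqF.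
by rewrite mulr_ge0 ?subr_ge0// divr_ge0// ltW.
Qed.

End exponential_weight.
End time_forms.

(** * The weighted energy inequality *)

Section symmetrization.
Variables (R : realType) (d : nat) (s : R).
Hypothesis d0 : (0 < d)%N.
Hypothesis s01 : 0 < s < 1.
Local Notation mu := (@lebesgue_rV R d).
Local Notation X := ('rV[R]_d).
Local Notation wt := (@wt R d s).
Local Notation kere := (@kere R d s).
Implicit Types (x y z : X) (P : X * X -> R) (C c : R).

Let iw : mu.-itg wt. Proof. exact: itg_wt. Qed.

Let m_xz : measurable_fun setT (fun w : X * X => w.1 - w.2).
Proof. exact: measurable_rV_sub. Qed.

Let m_zx : measurable_fun setT (fun w : X * X => w.1 + w.2).
Proof. exact: measurable_rV_add. Qed.

Variables (e : R) (e0 : 0 < e).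

Let ik : mu.-itg (kere e). Proof. exact: itg_kere. Qed.

Let mk2 : measurable_fun setT (fun w : X * X => kere e w.2).
Proof. exact: (measurableT_comp (measurable_kere s e) measurable_snd). Qed.

Lemma itg_kere_pair P C : measurable_fun setT P ->
  (forall x y, `|P (x, y)| <= C * (wt x + wt y)) ->
  (mu \x mu)%E.-itg (fun w => kere e w.2 * P (w.1, w.1 - w.2)).
Proof.
move=> mP PC.
have mF : measurable_fun setT (fun w : X * X => kere e w.2 * P (w.1, w.1 - w.2)).
  apply: measurable_funM => //.
  exact: (measurable_comp_pair mP measurable_fst m_xz).
have iws z : mu.-itg (fun x => wt (x - z)) by exact: (itg_shift (- z) iw).
apply: (itg_prod (b := fun z => kere e z * (C * (\int[mu]_x wt x + \int[mu]_x wt x)))) => //.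
  by under eq_fun do rewrite mulrC; exact: itgZ.
move=> z /=.
have ib : mu.-itg (fun x => kere e z * (C * (wt x + wt (x - z)))).
  by apply: itgZ; apply: itgZ; exact: itgD.
have -> : kere e z * (C * (\int[mu]_x wt x + \int[mu]_x wt x)) =
    \int[mu]_x (kere e z * (C * (wt x + wt (x - z)))).
  rewrite intZ; last by apply: itgZ; exact: itgD.
  rewrite intZ; last exact: itgD.
  have sh : \int[mu]_x wt (x - z) = \int[mu]_x wt x.
    by apply: (int_shift (f := wt)); exact: measurable_wt.
  by rewrite (intD iw (iws z)) sh.
rewrite EFin_int//; apply: ge0_le_integral => //.
- apply/measurable_EFinP; apply: measurableT_comp => //.
  exact: (measurable_comp_pair mF (@measurable_id _ _ setT) (measurable_cst z)).
- exact: measurable_int ib.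
- move=> x _; rewrite lee_fin normrM ger0_norm ?kere_ge0//.
  by rewrite ler_wpM2l ?kere_ge0.
Qed.

(** The kernel being even, the roles of the two points can be exchanged. *)
Lemma int_kere_pair_swap P C : measurable_fun setT P ->
  (forall x y, `|P (x, y)| <= C * (wt x + wt y)) ->
  \int[(mu \x mu)%E]_w (kere e w.2 * P (w.1, w.1 - w.2)) =
  \int[(mu \x mu)%E]_w (kere e w.2 * P (w.1 - w.2, w.1)).
Proof.
move=> mP PC.
have mPt : measurable_fun setT (fun w : X * X => P (w.2, w.1)).
  exact: (measurable_comp_pair mP measurable_snd measurable_fst).
have PtC x y : `|P (y, x)| <= C * (wt x + wt y) by rewrite addrC.
have i1 := itg_kere_pair mP PC.
have i2 := itg_kere_pair mPt PtC.
rewrite (int_prod2 i1) (int_prod2 i2) /=.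
have mz z : measurable_fun setT (fun x => P (x, x - z)).
  exact: (measurable_comp_pair mP (@measurable_id _ _ setT) (measurable_rV_addr (- z))).
pose g z := \int[mu]_x (kere e z * P (x + z, x)).
have mg : measurable_fun setT g.
  refine (@measurable_int1 _ _ _ _ _ mu (fun w : X * X => kere e w.2 * P (w.1 + w.2, w.1)) _).
  apply: measurable_funM => //.
  exact: (measurable_comp_pair mP m_zx measurable_fst).
transitivity (\int[mu]_z g z).
  apply: eq_Rintegral => z _; rewrite /g.
  have mkz : measurable_fun setT (fun x => kere e z * P (x, x - z)).
    by apply: measurable_funM => //; exact: mz.
  rewrite -(int_shift z mkz).
  by under eq_Rintegral do rewrite addrK.
by rewrite -(int_opp mg); apply: eq_Rintegral => z _; rewrite /g kereN.
Qed.

(** Averaging over the exchange of the two points leaves the symmetric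
    expression P (x, y) + P (y, x), to which the pointwise bound applies;
    wtQ_int then integrates the kernel. *)
Lemma symmetrized_lower_bound P C c (phi : X -> R) : 0 <= c ->
  measurable_fun setT P -> (forall x y, `|P (x, y)| <= C * wt x) ->
  bmeas phi -> (forall x, 0 <= phi x) ->
  (forall x y, - c * wtQ s x y * (phi x + phi y) <= P (x, y) + P (y, x)) ->
  - c * wtC0 d s * \int[mu]_x (wt x * phi x) <=
  \int[mu]_x \int[mu]_z (kere e z * P (x, x - z)).
Proof.
move=> c0 mP PC bphi phi0 Plow; have [mphi [M Mphi]] := bphi.
have C0 : 0 <= C.
  rewrite -(pmulr_lge0 _ (wt_gt0 s (0 : X))); exact: le_trans (PC 0 0).
have M0 : 0 <= M by exact: le_trans (Mphi 0).
have PC' x y : `|P (x, y)| <= C * (wt x + wt y).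
  by rewrite (le_trans (PC x y))// ler_wpM2l// lerDl.
pose A P := \int[(mu \x mu)%E]_w (kere e w.2 * P (w.1, w.1 - w.2)).
have mPt : measurable_fun setT (fun w : X * X => P (w.2, w.1)).
  exact: (measurable_comp_pair mP measurable_snd measurable_fst).
have PtC' x y : `|P (y, x)| <= C * (wt x + wt y) by rewrite addrC.
have iP := itg_kere_pair mP PC'.
have iPt := itg_kere_pair mPt PtC'.
pose Q (w : X * X) := wtQ s w.1 w.2 * phi w.1.
have mQ : measurable_fun setT Q.
  apply: measurable_funM; first exact: measurable_wtQ.
  exact: (measurableT_comp mphi measurable_fst).
have QM x y : `|Q (x, y)| <= M * (wt x + wt y).
  rewrite /Q/= normrM mulrC ler_pM// ger0_norm ?wtQ_ge0// wtQ_le//.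
have mQt : measurable_fun setT (fun w : X * X => Q (w.2, w.1)).
  exact: (measurable_comp_pair mQ measurable_snd measurable_fst).
have QtM x y : `|Q (y, x)| <= M * (wt x + wt y) by rewrite addrC.
have iQ := itg_kere_pair mQ QM.
have iQt := itg_kere_pair mQt QtM.
have sP := int_kere_pair_swap mP PC'.
have sQ := int_kere_pair_swap mQ QM.
have key : - c * (\int[(mu \x mu)%E]_w (kere e w.2 * Q (w.1, w.1 - w.2)) +
      \int[(mu \x mu)%E]_w (kere e w.2 * Q (w.1 - w.2, w.1))) <=
    \int[(mu \x mu)%E]_w (kere e w.2 * P (w.1, w.1 - w.2)) +
    \int[(mu \x mu)%E]_w (kere e w.2 * P (w.1 - w.2, w.1)).
  rewrite -intD// -intD// -intZ; last exact: itgD.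
  apply: le_int; [by apply: itgZ; exact: itgD|exact: itgD|] => -[x z] /=.
  rewrite -!mulrDr mulrCA ler_wpM2l ?kere_ge0//.
  apply: le_trans (Plow x (x - z)); rewrite /Q/= [wtQ _ (x - z) x]wtQC.
  by rewrite -mulrDr mulrA.
have half : - c * \int[(mu \x mu)%E]_w (kere e w.2 * Q (w.1, w.1 - w.2)) <=
    \int[(mu \x mu)%E]_w (kere e w.2 * P (w.1, w.1 - w.2)).
  by move: key; rewrite -sP -sQ; lra.
rewrite -(int_prod1 iP); apply: le_trans half.
rewrite !mulNr lerN2 -mulrA ler_wpM2l// (int_prod1 iQ) /=.
rewrite -intZ; last exact: itg_bmeasM.
apply: le_int => [||x]; first exact: (itg_int2 iQ).
  by apply: itgZ; exact: itg_bmeasM.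
have : \int[mu]_z (kere e z * wtQ s x (x - z)) <= wtC0 d s * wt x.
  exact: wtQ_int.
have mQx : measurable_fun setT (fun z => wtQ s x (x - z)).
  exact: (measurable_comp_pair (@measurable_wtQ R d s) (measurable_cst x) (measurable_rV_subr x)).
have iQx : mu.-itg (fun z => kere e z * wtQ s x (x - z)).
  apply: (itg_dom (g := fun z => (wt x + 1) * kere e z)).
  - by apply: measurable_funM => //; exact: measurable_kere.
  - exact: itgZ.
  - move=> z; rewrite normrM !ger0_norm ?kere_ge0 ?wtQ_ge0// mulrC.
    rewrite ler_wpM2r ?kere_ge0// (le_trans (wtQ_le _ _ _))// lerD2l.
    exact: wt_le1.
move=> h; rewrite /Q/=; under eq_Rintegral do rewrite mulrA mulrC.
by rewrite intZ// mulrC mulrA ler_wpM2r.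
Qed.

End symmetrization.

Section space_time_energy.
Variables (R : realType) (d : nat) (s : R).
Hypothesis d0 : (0 < d)%N.
Hypothesis s01 : 0 < s < 1.
Local Notation mu := (@lebesgue_rV R d).
Local Notation lam := (@lebesgue_measure R).
Local Notation X := ('rV[R]_d).
Local Notation XT := ('rV[R]_d * measurableTypeR R)%type.
Local Notation wt := (@wt R d s).
Local Notation kere := (@kere R d s).
Implicit Types (f : XT -> R) (x y z : X) (t : R).

Let iw : mu.-itg wt. Proof. exact: itg_wt. Qed.

Lemma bmeas_sect1 f x : bmeas f -> bmeas (fun t : measurableTypeR R => f (x, t)).
Proof.
move=> bf; apply: (bmeas_comp (h := fun t : measurableTypeR R => (x, t)) bf).
by apply: measurable_fun_pair.
Qed.

Lemma bmeas_sect2 f t : bmeas f -> bmeas (fun x => f (x, t)).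
Proof.
move=> bf; apply: (bmeas_comp (h := fun x : X => (x, t : measurableTypeR R)) bf).
by apply: measurable_fun_pair.
Qed.

Section truncated_operator.
Variables (e : R) (e0 : 0 < e).

Let ik : mu.-itg (kere e). Proof. exact: itg_kere. Qed.

(** The truncated fractional Laplacian in space, up to its constant. *)
Definition Ltrunc f (w : XT) : R :=
  \int[mu]_z (kere e z * (f w - f (w.1 - z, w.2))).

Lemma measurable_increment f : measurable_fun setT f ->
  measurable_fun setT (fun v : XT * X => f v.1 - f (v.1.1 - v.2, v.1.2)).
Proof.
move=> mf; have m1 : measurable_fun setT (fun v : XT * X => v.1.1 - v.2).
  have m11 : measurable_fun setT (fun v : XT * X => v.1.1).
    exact: (measurableT_comp measurable_fst measurable_fst).
  exact: (measurable_comp_pair (@measurable_rV_sub R d) m11 measurable_snd).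
have m2 : measurable_fun setT (fun v : XT * X => v.1.2).
  exact: (measurableT_comp measurable_snd measurable_fst).
apply: measurable_funB; first exact: (measurableT_comp mf measurable_fst).
exact: (measurable_comp_pair mf m1 m2).
Qed.

Lemma bmeas_Ltrunc f : bmeas f -> bmeas (Ltrunc f).
Proof.
move=> [mf [M Mf]]; have mD := measurable_increment mf; split.
  refine (@measurable_int2 _ _ _ _ _ mu
    (fun v : XT * X => kere e v.2 * (f v.1 - f (v.1.1 - v.2, v.1.2))) _).
  apply: measurable_funM => //.
  exact: (measurableT_comp (@measurable_kere R d s e) measurable_snd).
exists (\int[mu]_z ((M + M) * kere e z)) => w; apply: norm_int_le.
- apply: measurable_funM; first exact: measurable_kere.
  exact: (measurable_comp_pair mD (measurable_cst w) (@measurable_id _ _ setT)).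
- exact: itgZ.
- move=> z; rewrite normrM ger0_norm ?kere_ge0// mulrC ler_wpM2r ?kere_ge0//.
  by rewrite (le_trans (ler_normB _ _))// lerD.
Qed.

End truncated_operator.

Lemma bmeas_int_wt f : bmeas f ->
  bmeas (fun t : measurableTypeR R => \int[mu]_x (wt x * f (x, t))).
Proof.
move=> bf; have [mf [N Nf]] := bf; split.
  refine (@measurable_int1 _ _ _ _ _ mu (fun v : XT => wt v.1 * f v) _).
  by apply: measurable_funM => //; exact: (measurableT_comp (@measurable_wt R d s) measurable_fst).
exists (\int[mu]_x (N * wt x)) => t; apply: norm_int_le => [||x].
- apply: measurable_funM; first exact: measurable_wt.
  exact: (bmeas_sect2 t bf).1.
- exact: itgZ.
- by rewrite (normrM (wt x)) (ger0_norm (wt_ge0 _ _)) mulrC ler_wpM2r.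
Qed.

Section cutoff_primitive.
Variables (S L : R) (S0 : 0 < S) (L0 : 0 < L).
Local Notation th := (@th R S L).

(** The primitive in time, set to 0 outside of [0, S] to make it bounded. *)
Definition primS f (w : XT) : R := btw S w.2 * prim (fun r => f (w.1, r)) w.2.

Lemma bmeas_primS f : bmeas f -> bmeas (primS f).
Proof.
move=> [mf [M Mf]]; have M0 : 0 <= M := le_trans (normr_ge0 _) (Mf (0, 0)).
have m1 : measurable_fun setT (fun w : XT => btw S w.2).
  by apply: measurable_btw_comp => //; exact: measurable_snd.
split.
  apply: measurable_funM => //.
  refine (@measurable_int2 _ _ _ _ _ lam
    (fun w : XT * measurableTypeR R => btw w.1.2 w.2 * f (w.1.1, w.2)) _).
  have m12 : measurable_fun setT (fun w : XT * measurableTypeR R => w.1.2).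
    exact: (measurableT_comp measurable_snd measurable_fst).
  have m11 : measurable_fun setT (fun w : XT * measurableTypeR R => w.1.1).
    exact: (measurableT_comp measurable_fst measurable_fst).
  apply: measurable_funM.
    by apply: measurable_btw_comp => //; exact: measurable_snd.
  exact: (measurable_comp_pair mf m11 measurable_snd).
exists (M * `|S|) => -[x t]; rewrite /primS /= /btw.
case: ifP => [/andP[t0 tS]|_].
  rewrite mul1r; have bfx : bmeas (fun r : measurableTypeR R => f (x, r)).
    by apply: bmeas_sect1; split => //; exists M.
  rewrite (le_trans (norm_prim_le bfx t0 (fun r => Mf (x, r))))// ler_wpM2l//.
  by rewrite (le_trans tS)// ler_norm.
by rewrite mul0r normr0 mulr_ge0.
Qed.

Lemma th_primS f x t : th t * primS f (x, t) = th t * prim (fun r => f (x, r)) t.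
Proof. by rewrite /primS/= mulrA [th t * _]mulrC th_btw. Qed.

Variable f : XT -> R.
Hypothesis bf : bmeas f.
Local Notation B := (primS f).

Let ith : lam.-itg th. Proof. exact: itg_th. Qed.

Let bB : bmeas B. Proof. exact: bmeas_primS. Qed.

Lemma bmeas_int_th (g : XT -> R) : bmeas g ->
  bmeas (fun x : X => \int[lam]_t (th t * g (x, t))).
Proof.
move=> bg; have [mg [M Mg]] := bg; split.
  refine (@measurable_int2 _ _ _ _ _ lam (fun w : XT => th w.2 * g w) _).
  apply: measurable_funM => //.
  exact: (measurableT_comp (measurable_th S L) measurable_snd).
exists (\int[lam]_t (M * th t)) => x; apply: norm_int_le.
- apply: measurable_funM; first exact: measurable_th.
  exact: (bmeas_sect1 x bg).1.
- exact: itgZ.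
- by move=> t; rewrite normrM ger0_norm ?th_ge0// mulrC ler_wpM2r ?th_ge0.
Qed.

Lemma swap_th (g : XT -> R) : bmeas g ->
  \int[mu]_x (wt x * \int[lam]_t (th t * g (x, t))) =
  \int[lam]_t (th t * \int[mu]_x (wt x * g (x, t))).
Proof.
move=> bg; have [mg [M Mg]] := bg.
pose F (w : XT) := wt w.1 * (th w.2 * g w).
have iF : (mu \x lam)%E.-itg F.
  refine (@itg_prodM _ _ _ _ _ mu lam F (fun x => M * wt x) th _ _ _ _) => //.
  - apply: measurable_funM.
      exact: (measurableT_comp (@measurable_wt R d s) measurable_fst).
    apply: measurable_funM => //.
    exact: (measurableT_comp (measurable_th S L) measurable_snd).
  - exact: itgZ.
  - move=> x t; rewrite /F/= !normrM (ger0_norm (th_ge0 _ _ _)) (ger0_norm (wt_ge0 _ _)).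
    rewrite [leRHS](_ : _ = wt x * (th t * M)); last ring.
    by rewrite !ler_wpM2l ?th_ge0.
transitivity (\int[mu]_x \int[lam]_t F (x, t)).
  apply: eq_Rintegral => x _; rewrite -intZ//.
  by apply: itg_bmeasM => //; exact: bmeas_sect1.
rewrite (int_swap iF); apply: eq_Rintegral => t _.
rewrite -intZ; last by apply: itg_bmeasM => //; exact: bmeas_sect2.
by apply: eq_Rintegral => x _; rewrite /F/= mulrCA.
Qed.

Variables (e : R) (e0 : 0 < e).

Let ik : mu.-itg (kere e). Proof. exact: itg_kere. Qed.

(** The bound pair_energy, applied to the two time slices f (x, _) and f (y, _)
    with coefficients wt x and wt y, and symmetrized in space. The constant does
    not depend on the truncation radius e. *)
Lemma energy_inequality c : 0 < c -> (2 * c)^-1 <= L ->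
  - c * wtC0 d s * \int[lam]_t (th t * \int[mu]_x (wt x * f (x, t) ^+ 2)) <=
  \int[lam]_t (th t * \int[mu]_x (wt x * (f (x, t) * Ltrunc e B (x, t)))).
Proof.
move=> c0 Lc; have [mf [M Mf]] := bf; have [mB [N NB]] := bB.
have bff : bmeas (fun w => f w ^+ 2).
  by under eq_fun do rewrite expr2; exact: bmeasM.
have bfL : bmeas (fun w => f w * Ltrunc e B w) by apply: bmeasM => //; exact: bmeas_Ltrunc.
rewrite -(swap_th bff) -(swap_th bfL).
pose g (v : X * XT) := f (v.1, v.2.2) * (B (v.1, v.2.2) - B v.2).
have mg : measurable_fun setT g.
  have m1 : measurable_fun setT (fun v : X * XT => (v.1, v.2.2)).
    apply: measurable_fun_pair => //.
    exact: (measurableT_comp measurable_snd measurable_snd).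
  apply: measurable_funM; first exact: (measurableT_comp mf m1).
  apply: measurable_funB; first exact: (measurableT_comp mB m1).
  exact: (measurableT_comp mB measurable_snd).
have gM v : `|g v| <= M * (N + N).
  by rewrite normrM ler_pM// (le_trans (ler_normB _ _))// lerD.
have igt x y : lam.-itg (fun t => th t * g (x, (y, t))).
  apply: itg_bmeasM => //; split; last by exists (M * (N + N)).
  have myt : measurable_fun setT (fun t : measurableTypeR R => (y, t)).
    by apply: measurable_fun_pair.
  exact: (measurable_comp_pair mg (measurable_cst x) myt).
pose P (w : X * X) := wt w.1 * \int[lam]_t (th t * g (w.1, (w.2, t))).
have mP : measurable_fun setT P.
  apply: measurable_funM.
    exact: (measurableT_comp (@measurable_wt R d s) measurable_fst).
  refine (@measurable_int2 _ _ _ _ _ lam (fun v : (X * X) * measurableTypeR R =>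
    th v.2 * g (v.1.1, (v.1.2, v.2))) _).
  apply: measurable_funM.
    exact: (measurableT_comp (measurable_th S L) measurable_snd).
  have m11 : measurable_fun setT (fun v : (X * X) * measurableTypeR R => v.1.1).
    exact: (measurableT_comp measurable_fst measurable_fst).
  have m12 : measurable_fun setT (fun v : (X * X) * measurableTypeR R => v.1.2).
    exact: (measurableT_comp measurable_snd measurable_fst).
  exact: (measurable_comp_pair mg m11 (measurable_fun_pair m12 measurable_snd)).
have PC x y : `|P (x, y)| <= (M * (N + N) * \int[lam]_t th t) * wt x.
  rewrite /P/= normrM ger0_norm// mulrC ler_wpM2r// -intZ//.
  apply: norm_int_le; first exact: itg_measurable (igt x y).
    exact: itgZ.
  by move=> t; rewrite normrM ger0_norm ?th_ge0// mulrC ler_wpM2r ?th_ge0.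
have bphi := bmeas_int_th bff.
have phi0 x : 0 <= \int[lam]_t (th t * f (x, t) ^+ 2).
  by apply: int_ge0 => t; rewrite mulr_ge0 ?th_ge0 ?sqr_ge0.
have Plow x y : - c * wtQ s x y * (\int[lam]_t (th t * f (x, t) ^+ 2) +
    \int[lam]_t (th t * f (y, t) ^+ 2)) <= P (x, y) + P (y, x).
  have bfx := bmeas_sect1 x bf; have bfy := bmeas_sect1 y bf.
  have ipx := itg_bmeasM (bmeas_sect1 x bff) ith.
  have ipy := itg_bmeasM (bmeas_sect1 y bff) ith.
  rewrite -(intD ipx ipy) /P/=.
  rewrite -(intZ (wt x) (igt x y)) -(intZ (wt y) (igt y x)).
  rewrite -(intD (itgZ (wt x) (igt x y)) (itgZ (wt y) (igt y x))).
  have -> : \int[lam]_t (th t * f (x, t) ^+ 2 + th t * f (y, t) ^+ 2) =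
      \int[lam]_t (th t * (f (x, t) ^+ 2 + f (y, t) ^+ 2)).
    by apply: eq_Rintegral => t _; rewrite mulrDr.
  have pe := pair_energy S L0 bfx bfy (wt_gt0 s x) (wt_gt0 s y) c0 Lc.
  apply: (le_trans pe).
  rewrite le_eqVlt; apply/orP; left; apply/eqP.
  apply: eq_Rintegral => t _; rewrite /g/=.
  rewrite [X in _ = wt x * X + _]mulrCA [X in _ = _ + wt y * X]mulrCA.
  rewrite !mulrBr !th_primS; ring.
have := symmetrized_lower_bound d0 s01 e0 (ltW c0) mP PC bphi phi0 Plow.
move/le_trans; apply; rewrite le_eqVlt; apply/orP; left; apply/eqP.
apply: eq_Rintegral => x _.
pose F (v : X * measurableTypeR R) := kere e v.1 * (wt x * (th v.2 * g (x, (x - v.1, v.2)))).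
have mgx : measurable_fun setT (fun v : X * measurableTypeR R => g (x, (x - v.1, v.2))).
  have m1 : measurable_fun setT (fun v : X * measurableTypeR R => x - v.1).
    exact: (measurableT_comp (measurable_rV_subr x) measurable_fst).
  exact: (measurable_comp_pair mg (measurable_cst x) (measurable_fun_pair m1 measurable_snd)).
have iF : (mu \x lam)%E.-itg F.
  refine (@itg_prodM _ _ _ _ _ mu lam F (fun z => (wt x * (M * (N + N))) * kere e z) th _ _ _ _) => //.
  - apply: measurable_funM.
      exact: (measurableT_comp (measurable_kere s e) measurable_fst).
    apply: measurable_funM => //; apply: measurable_funM => //.
    exact: (measurableT_comp (measurable_th S L) measurable_snd).
  - exact: itgZ.
  - move=> z t; have := gM (x, (x - z, t)); rewrite /F [(z, t).1]/= [(z, t).2]/=.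
    set G := g _ => GM; rewrite 3!normrM (ger0_norm (kere_ge0 _ _ _)) (ger0_norm (th_ge0 _ _ _)) (ger0_norm (wt_ge0 _ _)).
    rewrite [leRHS](_ : _ = kere e z * (wt x * (th t * (M * (N + N))))); last ring.
    by rewrite ler_wpM2l ?kere_ge0// ler_wpM2l// ler_wpM2l ?th_ge0.
transitivity (\int[mu]_z \int[lam]_t F (z, t)).
  apply: eq_Rintegral => z _; rewrite /P/F/=.
  rewrite -(intZ (wt x) (igt x (x - z))) -intZ//.
  exact: itgZ.
have ifL : lam.-itg (fun t => th t * (f (x, t) * Ltrunc e B (x, t))).
  exact: (itg_bmeasM (bmeas_sect1 x bfL) ith).
rewrite (int_swap iF) -(intZ (wt x) ifL).
apply: eq_Rintegral => t _; rewrite /Ltrunc /F /g/=.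
have ikB : mu.-itg (fun z => kere e z * (B (x, t) - B (x - z, t))).
  apply: itg_bmeasM => //; split.
    exact: (measurable_comp_pair (measurable_increment mB) (measurable_cst (x, t)) (@measurable_id _ _ setT)).
  by exists (N + N) => z; rewrite (le_trans (ler_normB _ _))// lerD.
rewrite -(intZ _ ikB) -(intZ _ (itgZ _ ikB)) -(intZ _ (itgZ _ (itgZ _ ikB))).
by apply: eq_Rintegral => z _; ring.
Qed.

End cutoff_primitive.
End space_time_energy.

(** * Smooth compactly supported functions *)

Section flat_functions.
Variable R : realType.
Implicit Types (x : R) (n : nat).

(** The functions out of which the derivatives of the flat function
    exp(-1/x) are built. *)
Definition flat n x : R := if 0 < x then x^-1 ^+ n * expR (- x^-1) else 0.

Lemma flat_ge0 n x : 0 <= flat n x.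
Proof.
rewrite /flat; case: ifPn => // x0.
by rewrite mulr_ge0 ?expR_ge0// exprn_ge0// invr_ge0 ltW.
Qed.

Lemma flat_eq0 n x : x <= 0 -> flat n x = 0.
Proof. by rewrite /flat leNgt => /negbTE ->. Qed.

Lemma flat0_gt0 x : 0 < x -> 0 < flat 0 x.
Proof. by move=> x0; rewrite /flat x0 expr0 mul1r expR_gt0. Qed.

Lemma flat_le n x : flat n x <= n%:R ^+ n.
Proof.
rewrite /flat; case: ifPn => x0; last by rewrite exprn_ge0.
have y0 : 0 < x^-1 by rewrite invr_gt0.
set y := x^-1 in y0 *; case: n => [|n].
  by rewrite !expr0 mul1r -expR0 ler_expR oppr_le0 ltW.
have n0 : 0 < n.+1%:R :> R by [].
rewrite expRN ler_pdivrMr ?expR_gt0//.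
have -> : expR y = expR (y / n.+1%:R) ^+ n.+1.
  by rewrite -expRM_natl mulrCA mulfV ?mulr1// gt_eqF.
rewrite -exprMn lerXn2r ?nnegrE ?(ltW y0) ?mulr_ge0 ?expR_ge0//.
rewrite -ler_pdivrMl// mulrC; apply: le_trans (expR_ge1Dx _).
by rewrite lerDr.
Qed.

Lemma flat_sqr n x : flat n x = x ^+ 2 * flat n.+2 x.
Proof.
rewrite /flat; case: ifPn => x0; last by rewrite mulr0.
by rewrite !exprS; field; rewrite gt_eqF.
Qed.

(** At the origin the difference quotient is of the order of the increment, by
    flat_sqr and flat_le. *)
Lemma is_derive_flat n x :
  is_derive x 1 (flat n) (flat n.+2 x - n%:R * flat n.+1 x).
Proof.
have [x0|x0] := ltP 0 x; last first.
  rewrite !flat_eq0// mulr0 subr0.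
  have C0 : 0 < n.+2%:R ^+ n.+2 :> R by rewrite exprn_gt0.
  have cv : h^-1 *: ((flat n \o shift x) (h *: (1 : R)) - flat n x) @[h --> 0^'] --> (0 : R).
    apply/cvgr0Pnorm_le => eps eps0; near=> h.
    rewrite (flat_eq0 n x0) subr0 /= /GRing.scale/= mulr1.
    have hn0 : h != 0 by near: h; exact: nbhs_dnbhs_neq.
    have [hx|hx] := leP (h + x) 0; first by rewrite flat_eq0// mulr0 normr0 ltW.
    have h0 : 0 < h by lra.
    rewrite flat_sqr ger0_norm; last first.
      by rewrite mulr_ge0 ?invr_ge0 ?(ltW h0)// mulr_ge0 ?sqr_ge0 ?flat_ge0.
    have heps : h <= eps / n.+2%:R ^+ n.+2.
      apply: le_trans (ler_norm _) _; near: h.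
      by apply: dnbhs0_le; rewrite divr_gt0.
    apply: le_trans (_ : h * n.+2%:R ^+ n.+2 <= _); last by rewrite -ler_pdivlMr.
    rewrite mulrA ler_pM ?flat_ge0 ?flat_le ?mulr_ge0 ?invr_ge0 ?(ltW hx) ?(ltW h0)//.
    rewrite ler_pdivrMl// -expr2 lerXn2r ?nnegrE ?(ltW h0) ?(ltW hx)//; lra.
  apply: DeriveDef; first by apply/cvg_ex; exists 0.
  exact: cvg_lim.
have dV : is_derive x 1 (fun y : R => y^-1) (- x ^- 2).
  apply: DeriveDef; first by apply: derivableV; rewrite ?gt_eqF.
  rewrite deriveV ?gt_eqF// derive_id /GRing.scale/= mulr1//.
apply: (@near_eq_is_derive _ _ _ (fun y : R => (y^-1) ^+ n * expR (- y^-1))).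
- near=> y; rewrite /flat ifT//.
  by near: y; exact: lt_nbhsr.
- rewrite /flat x0.
  rewrite (_ : _ - _ = (x^-1 ^+ n.+2 - n%:R * x^-1 ^+ n.+1) * expR (- x^-1)); last ring.
  elim: n => [|n IHn].
    under eq_fun do rewrite expr0 mul1r.
    have dE := is_derive1_comp (f := expR) (g := fun y : R => - y^-1) (x := x)
      (is_derive_expR _) (is_deriveN dV).
    apply: (is_derive_eq dE).
    by rewrite /GRing.scale/= opprK mul0r subr0 exprVn mulrC.
  under eq_fun do rewrite exprS -mulrA.
  have dM := is_deriveM dV IHn.
  apply: (is_derive_eq dM).
  rewrite /GRing.scale/= -exprVn !exprS -[n.+1%:R]natr1; ring.
Unshelve. all: by end_near. Qed.

End flat_functions.

Section smooth_class.
Variables (R : realType) (V : normedModType R).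

(** A class of functions that is syntactically stable under differentiation,
    whence smoothness by induction on the list of directions. *)
Inductive flat_generated : (V -> R) -> Prop :=
| FG_cst c : flat_generated (fun _ => c)
| FG_flat n a (l : {linear V -> R}) : continuous l ->
    flat_generated (fun x => flat n (a + l x))
| FG_add f g : flat_generated f -> flat_generated g ->
    flat_generated (fun x => f x + g x)
| FG_mul f g : flat_generated f -> flat_generated g ->
    flat_generated (fun x => f x * g x)
| FG_inv f : flat_generated f -> (forall x, f x != 0) ->
    flat_generated (fun x => (f x)^-1).

Lemma flat_generated_derive f : flat_generated f ->
  (forall x, differentiable f x) /\ forall v, flat_generated ('D_v f).
Proof.
elim=> {f} [c|n a l cl|f g _ [df Df] _ [dg Dg]|f g ff [df Df] fg [dg Dg]|f ff [df Df] f0].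
- split=> [x|v]; first exact: differentiable_cst.
  rewrite (_ : 'D_v _ = fun _ => 0); first exact: FG_cst.
  by apply/funext => x; exact: derive_cst.
- have da x : differentiable (fun x => a + l x) x.
    by apply: differentiableD; [exact: differentiable_cst|exact: linear_differentiable].
  have dda x v : 'd (fun x => a + l x) x v = l v.
    rewrite diffD; [|exact: differentiable_cst|exact: linear_differentiable].
    by rewrite /= diff_cst add0r diff_lin.
  have dfl (y : R) : differentiable (flat n : R -> R) y.
    by apply/derivable1_diffP; case: (is_derive_flat n y).
  have dd x : differentiable (fun x => flat n (a + l x)) x.
    exact: (@differentiable_comp _ _ _ _ (fun x => a + l x) (flat n)).
  split => // v.
  rewrite (_ : 'D_v _ = fun x => l v * (flat n.+2 (a + l x) + - n%:R * flat n.+1 (a + l x))).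
    by apply: FG_mul; [exact: FG_cst|apply: FG_add; [exact: FG_flat|
      apply: FG_mul; [exact: FG_cst|exact: FG_flat]]].
  apply/funext => x; rewrite deriveE//.
  rewrite (@diff_comp _ _ _ _ (fun x => a + l x) (flat n))//=.
  rewrite dda diff1E// derive1E.
  have [_ ->] := is_derive_flat n (a + l x).
  by rewrite /GRing.scale/= mulNr.
- split=> [x|v]; first exact: differentiableD.
  rewrite (_ : 'D_v _ = fun x => 'D_v f x + 'D_v g x); first exact: FG_add.
  by apply/funext => x; rewrite deriveD//; exact: diff_derivable.
- split=> [x|v]; first exact: differentiableM.
  rewrite (_ : 'D_v _ = fun x => f x * 'D_v g x + g x * 'D_v f x).
    by apply: FG_add; exact: FG_mul.
  by apply/funext => x; rewrite deriveM//; exact: diff_derivable.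
- split=> [x|v]; first exact: differentiableV.
  rewrite (_ : 'D_v _ = fun x => (-1) * ((f x)^-1 * ((f x)^-1 * 'D_v f x))).
    apply: FG_mul; first exact: FG_cst.
    by apply: FG_mul; [exact: FG_inv|apply: FG_mul => //; exact: FG_inv].
  apply/funext => x; rewrite deriveV//; last exact: diff_derivable.
  by rewrite /GRing.scale/= mulN1r -exprVn expr2 mulNr mulrA.
Qed.

Lemma smooth_flat_generated f : flat_generated f -> smooth f.
Proof.
move=> ff vs; suff : flat_generated (iter_derive vs f).
  by move=> /flat_generated_derive[].
by elim: vs => [//|v vs IHvs] /=; have [_] := flat_generated_derive IHvs; exact.
Qed.

Lemma flat_generated_affine n a (l : {linear V -> R}) (u : V -> R) : continuous l ->
  (forall x, u x = a + l x) -> flat_generated (fun x => flat n (u x)).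
Proof. by move=> cl ul; rewrite (funext ul : u = _); exact: FG_flat. Qed.

Lemma flat_generated_prod (I : Type) (r : seq I) (F : I -> V -> R) :
  (forall i, flat_generated (F i)) -> flat_generated (fun x => \prod_(i <- r) F i x).
Proof.
move=> FF; elim: r => [|i r IHr].
  by under eq_fun do rewrite big_nil; exact: FG_cst.
by under eq_fun do rewrite big_cons; exact: FG_mul.
Qed.

End smooth_class.

Section second_differences.
Variable R : realType.

(** Boundedness of a function together with its first and second order
    differences, all that the kernel requires of a test function. *)
Definition C11 (V : normedModType R) (f : V -> R) (M : R) :=
  forall x z, [/\ `|f x| <= M, `|f (x + z) - f x| <= M * `|z| &
    `|f (x + z) + f (x - z) - 2 * f x| <= M * `|z| ^+ 2].

Lemma C11_mul (V : normedModType R) (f g : V -> R) M N :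
  C11 f M -> C11 g N -> C11 (fun x => f x * g x) (4 * (M * N)).
Proof.
move=> Cf Cg x z.
have [f0 f1 f2] := Cf x z; have [g0 g1 g2] := Cg x z.
have [_ f1' _] := Cf x (- z); have [_ g1' _] := Cg x (- z).
have [f3 _ _] := Cf (x + z) 0; have [g3 _ _] := Cg (x + z) 0.
have M0 : 0 <= M := le_trans (normr_ge0 _) f0.
have N0 : 0 <= N := le_trans (normr_ge0 _) g0.
rewrite normrN in f1' g1'.
have MN : 0 <= M * N by exact: mulr_ge0.
have z0 : 0 <= `|z| by [].
split.
- by rewrite normrM (le_trans (ler_pM _ _ f0 g0))// ler_peMl// ler1n.
- rewrite (_ : _ - _ = (f (x + z) - f x) * g (x + z) + f x * (g (x + z) - g x)); last ring.
  rewrite (le_trans (ler_normD _ _))// !normrM.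
  have h1 := ler_pM (normr_ge0 _) (normr_ge0 _) f1 g3.
  have h2 := ler_pM (normr_ge0 _) (normr_ge0 _) f0 g1.
  have : 0 <= M * N * `|z| by exact: mulr_ge0.
  rewrite (_ : M * `|z| * N = M * N * `|z|) in h1; last ring.
  by rewrite mulrA in h2; lra.
- rewrite (_ : _ - _ = (f (x + z) + f (x - z) - 2 * f x) * g x +
    f x * (g (x + z) + g (x - z) - 2 * g x) +
    ((f (x + z) - f x) * (g (x + z) - g x) + (f (x - z) - f x) * (g (x - z) - g x))); last ring.
  rewrite (le_trans (ler_normD _ _))//.
  have h1 := ler_pM (normr_ge0 _) (normr_ge0 _) f2 g0.
  have h2 := ler_pM (normr_ge0 _) (normr_ge0 _) f0 g2.
  have h3 := ler_pM (normr_ge0 _) (normr_ge0 _) f1 g1.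
  have h4 := ler_pM (normr_ge0 _) (normr_ge0 _) f1' g1'.
  rewrite -!normrM in h1 h2 h3 h4.
  have h5 := ler_normD ((f (x + z) + f (x - z) - 2 * f x) * g x)
    (f x * (g (x + z) + g (x - z) - 2 * g x)).
  have h6 := ler_normD ((f (x + z) - f x) * (g (x + z) - g x))
    ((f (x - z) - f x) * (g (x - z) - g x)).
  rewrite (_ : M * `|z| ^+ 2 * N = M * N * `|z| ^+ 2) in h1; last ring.
  rewrite (_ : M * (N * `|z| ^+ 2) = M * N * `|z| ^+ 2) in h2; last ring.
  rewrite (_ : M * `|z| * (N * `|z|) = M * N * `|z| ^+ 2) in h3 h4; last ring.
  lra.
Qed.

Lemma mean_value_dist (f df : R -> R) :
  (forall x : R, is_derive x 1 f (df x)) ->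
  forall x y, exists2 c, `|c - x| <= `|y - x| & f y - f x = df c * (y - x).
Proof.
move=> Df x y.
have cf : continuous f.
  by move=> z; apply/differentiable_continuous/derivable1_diffP; case: (Df z).
have [xy|/ltW yx] := leP x y.
  have [c] := MVT_segment xy (fun z _ => Df z) (continuous_subspaceT cf).
  rewrite in_itv/= => /andP[xc cy] E; exists c => //.
  by rewrite !ger0_norm ?subr_ge0// lerB.
have [c] := MVT_segment yx (fun z _ => Df z) (continuous_subspaceT cf).
rewrite in_itv/= => /andP[yc cx] E; exists c; last first.
  by rewrite -opprB E; ring.
by rewrite !ler0_norm ?subr_le0// !opprB lerB.
Qed.

Lemma C11_flat0 : exists M : R, C11 (flat 0 : R -> R) M.
Proof.
have D0 (x : R) : is_derive x 1 (flat 0) (flat 2 x).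
  by have := is_derive_flat 0 x; rewrite mul0r subr0.
have B (n : nat) (x : R) : `|flat n x| <= n%:R ^+ n by rewrite ger0_norm ?flat_ge0 ?flat_le.
have D2 (x : R) : is_derive x 1 (flat 2) (flat 4 x - 2 * flat 3 x) by exact: is_derive_flat.
have B2 (x : R) : `|flat 4 x - 2 * flat 3 x| <= 310.
  rewrite (le_trans (ler_normB _ _))// normrM.
  by have := B 4%N x; have := B 3%N x; rewrite !exprS !expr0 (ger0_norm (x := 2))//; lra.
(* the two mean values lie at distance at most 2 |z| from each other, so the
   second difference costs twice the bound on the derivative of flat 2 *)
exists 620 => x' z'; move: (x' : R) (z' : R) => {x' z'} x z.
have b0 : `|flat 0 x| <= 1 by have := B 0%N x; rewrite expr0.
have b2 (y : R) : `|flat 2 y| <= 4 by have := B 2%N y; rewrite !exprS expr0; lra.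
have [c1 c1z E1] := mean_value_dist D0 x (x + z).
have [c2 c2z E2] := mean_value_dist D0 x (x - z).
rewrite addrAC subrr add0r in c1z E1; rewrite addrAC subrr add0r normrN in c2z E2.
have [c3 _ E3] := mean_value_dist D2 c2 c1.
have z0 := normr_ge0 z.
split; first lra.
  rewrite E1 normrM ler_wpM2r// (le_trans (b2 _))//; lra.
rewrite (_ : _ - _ = (flat 0 (x + z) - flat 0 x) + (flat 0 (x - z) - flat 0 x)); last ring.
rewrite E1 E2 mulrN -mulrBl E3 !normrM.
have c12 : `|c1 - c2| <= 2 * `|z|.
  by rewrite (_ : c1 - c2 = (c1 - x) - (c2 - x)); [rewrite (le_trans (ler_normB _ _))//; lra|ring].
rewrite expr2 mulrA ler_wpM2r//.
apply: (le_trans (ler_pM _ _ (B2 c3) c12)) => //; lra.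
Qed.

End second_differences.

Section bump.
Variables (R : realType) (d : nat).
Local Notation mu := (@lebesgue_rV R d).
Local Notation X := ('rV[R]_d).
Implicit Types (x y z : X) (r T t : R).

Definition bump_raw r x : R :=
  \prod_(i < d) (flat 0 (r + x ord0 i) * flat 0 (r - x ord0 i)).

Lemma bump_raw_ge0 r x : 0 <= bump_raw r x.
Proof. by apply: prodr_ge0 => i _; rewrite mulr_ge0 ?flat_ge0. Qed.

Lemma bump_raw_eq0 r x : 0 < r -> r <= `|x| -> bump_raw r x = 0.
Proof.
move=> r0 rx.
have [i ri] : exists i, r <= `|x ord0 i|.
  apply: contrapT => /forallNP h; move: rx; rewrite leNgt rV_normE => /negP; apply.
  apply/bigmax_ltP; split => // i _.
  by have /negP := h i; rewrite -ltNge.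
rewrite /bump_raw (bigD1 i)//=.
suff -> : flat 0 (r + x ord0 i) * flat 0 (r - x ord0 i) = 0 by rewrite mul0r.
have [xi|xi] := leP 0 (x ord0 i).
  by rewrite [X in _ * X]flat_eq0 ?mulr0// subr_le0; rewrite ger0_norm in ri.
by rewrite flat_eq0 ?mul0r// -[x ord0 i]opprK subr_le0; rewrite ltr0_norm in ri.
Qed.

Lemma bump_raw_gt0 r x : `|x| < r -> 0 < bump_raw r x.
Proof.
move=> xr; apply: prodr_gt0 => i _.
have : `|x ord0 i| < r.
  apply: le_lt_trans xr; rewrite rV_normE.
  exact: (le_bigmax _ (fun i => `|x ord0 i|)).
by rewrite ltr_norml => /andP[? ?]; rewrite mulr_gt0// flat0_gt0//; lra.
Qed.

Lemma measurable_flat0 : measurable_fun setT (flat 0 : R -> R).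
Proof.
apply: continuous_measurable_fun => x.
apply/differentiable_continuous/derivable1_diffP.
by case: (is_derive_flat 0 x).
Qed.

Lemma measurable_bump_raw r : measurable_fun setT (bump_raw r).
Proof.
rewrite /bump_raw; elim: (index_enum _) => [|i s IHs].
  by under eq_fun do rewrite big_nil; exact: measurable_cst.
under eq_fun do rewrite big_cons; apply: measurable_funM => //.
apply: measurable_funM; apply: (measurableT_comp measurable_flat0).
  by apply: measurable_funD => //; exact: measurable_coord.
by apply: measurable_funB => //; exact: measurable_coord.
Qed.

Lemma C11_bump_raw r : exists M : R, C11 (bump_raw r) M.
Proof.
have [M0 C0] := C11_flat0 R.
have M00 : 0 <= M0 := le_trans (normr_ge0 _) (let: And3 h _ _ := C0 0 0 in h).
have nz (i : 'I_d) z : `|z ord0 i| <= `|z|.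
  by rewrite [leRHS]rV_normE; exact: (le_bigmax _ (fun i => `|z ord0 i|)).
have Cp (i : 'I_d) : C11 (fun x : X => flat 0 (r + x ord0 i)) M0.
  move=> x z; have [h0 h1 h2] := C0 (r + x ord0 i) (z ord0 i).
  rewrite !mxE !addrA; split => //.
    by rewrite (le_trans h1)// ler_wpM2l.
  by rewrite (le_trans h2)// ler_wpM2l// lerXn2r ?nnegrE//; exact: nz.
have Cm (i : 'I_d) : C11 (fun x : X => flat 0 (r - x ord0 i)) M0.
  move=> x z; have [h0 h1 h2] := C0 (r - x ord0 i) (- z ord0 i).
  rewrite !mxE !opprD !addrA; split => //.
    by rewrite (le_trans h1)// normrN ler_wpM2l.
  by rewrite (le_trans h2)// normrN ler_wpM2l// lerXn2r ?nnegrE//; exact: nz.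
rewrite /bump_raw; elim: (index_enum _) => [|i s [M IHs]].
  exists 1 => x z; rewrite !big_nil; split; first by rewrite normr1.
    by rewrite subrr normr0 mulr_ge0.
  by rewrite (_ : 1 + 1 - 2 * 1 = 0) ?normr0 ?mulr_ge0//; ring.
have h := C11_mul (C11_mul (Cp i) (Cm i)) IHs.
by exists (4 * (4 * (M0 * M0) * M)) => x z; rewrite !big_cons; exact: h.
Qed.

Lemma itg_bump_raw r : 0 < r -> mu.-itg (bump_raw r).
Proof.
move=> r0; have [M CM] := C11_bump_raw r.
apply: (itg_dom (measurable_bump_raw r) (itgZ M (itg_indic_ball d r0))) => x.
rewrite indicE; have [xr|xr] := ltP `|x| r.
  by rewrite mem_set//= mulr1; have [] := CM x 0.
by rewrite bump_raw_eq0// normr0 memNset ?mulr0//=; apply/negP; rewrite -leNgt.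
Qed.

Lemma int_bump_raw_gt0 r : 0 < r -> 0 < \int[mu]_x bump_raw r x.
Proof.
move=> r0; rewrite lt_neqAle int_ge0 ?andbT; last by move=> x; exact: bump_raw_ge0.
apply/eqP => /esym I0.
have := int_ge0_eq0 (itg_bump_raw r0) (bump_raw_ge0 r) I0.
move=> [N [mN N0 subN]].
have : (mu [set x | (`|x| < r)%R] <= mu N)%E.
  apply: le_measure; rewrite ?inE//; first exact: measurable_rV_ball.
  by move=> x xr; apply: subN => /= x0; have := bump_raw_gt0 xr; rewrite x0 ltxx.
rewrite [X in (X <= _)%E]measure_rV_ball// [X in (_ <= X)%E]N0 lee_fin leNgt.
by rewrite exprn_gt0// mulr_gt0.
Qed.

(** A mollifier supported in the cube of half side r. *)
Definition moll r x : R := (\int[mu]_x bump_raw r x)^-1 * bump_raw r x.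

Section moll_theory.
Variables (r : R) (r0 : 0 < r).

Lemma moll_ge0 x : 0 <= moll r x.
Proof. by rewrite mulr_ge0 ?bump_raw_ge0// invr_ge0 int_ge0// => y; exact: bump_raw_ge0. Qed.

Lemma moll_eq0 x : r <= `|x| -> moll r x = 0.
Proof. by move=> rx; rewrite /moll bump_raw_eq0// mulr0. Qed.

Lemma measurable_moll : measurable_fun setT (moll r).
Proof. by apply: measurable_funM => //; exact: measurable_bump_raw. Qed.

Lemma itg_moll : mu.-itg (moll r). Proof. exact/itgZ/itg_bump_raw. Qed.

Lemma int_moll : \int[mu]_x moll r x = 1.
Proof.
rewrite intZ; last exact: itg_bump_raw.
by rewrite mulVf// gt_eqF// int_bump_raw_gt0.
Qed.

Lemma C11_moll : exists M : R, C11 (moll r) M.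
Proof.
have [M CM] := C11_bump_raw r; set k := (\int[mu]_x bump_raw r x)^-1.
exists (`|k| * M) => x z; have [h0 h1 h2] := CM x z; rewrite /moll -/k.
rewrite -!mulrA; split.
- by rewrite normrM ler_wpM2l.
- by rewrite -mulrBr normrM ler_wpM2l.
- by rewrite mulrCA -mulrDr -mulrBr normrM ler_wpM2l.
Qed.

Lemma bmeas_moll : bmeas (moll r).
Proof.
split; first exact: measurable_moll.
by have [M CM] := C11_moll; exists M => x; have [] := CM x 0.
Qed.

End moll_theory.

Local Notation V := ('rV[R]_d * R)%type.

(* The linear forms through which the variables enter flat generated functions. *)
Definition space_coord (k : R) (i : 'I_d) (w : V) : R := k * w.1 ord0 i.

Fact space_coord_linear k i : linear (space_coord k i : V -> R^o).
Proof. by move=> a x y; rewrite /space_coord /= !mxE /GRing.scale/=; ring. Qed.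

HB.instance Definition _ k i :=
  GRing.isLinear.Build R V R^o _ (space_coord k i) (space_coord_linear k i).

Definition time_coord (k : R) (w : V) : R := k * w.2.

Fact time_coord_linear k : linear (time_coord k : V -> R^o).
Proof. by move=> a x y; rewrite /time_coord /= /GRing.scale/=; ring. Qed.

HB.instance Definition _ k :=
  GRing.isLinear.Build R V R^o _ (time_coord k) (time_coord_linear k).

Lemma continuous_space_coord k i : continuous (space_coord k i).
Proof.
move=> w; apply: cvgMr.
apply: (@continuous_comp V X R fst (fun x : X => x ord0 i)); first exact: cvg_fst.
exact: coord_continuous.
Qed.

Lemma continuous_time_coord k : continuous (time_coord k).
Proof. by move=> w; apply: cvgMr; exact: cvg_snd. Qed.

(** A smooth transition, as a function of a + b t, from 0 on the left of -1 to 1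
    on the right of 0. *)
Definition step (a b : R) (w : V) : R :=
  flat 0 (1 + (a + b * w.2)) / (flat 0 (1 + (a + b * w.2)) + flat 0 (- (a + b * w.2))).

Lemma step1 a b w : 0 <= a + b * w.2 -> step a b w = 1.
Proof.
move=> h; rewrite /step [flat 0 (- _)]flat_eq0 ?oppr_le0// addr0 mulfV// gt_eqF//.
by rewrite flat0_gt0//; lra.
Qed.

Lemma step0 a b w : a + b * w.2 <= -1 -> step a b w = 0.
Proof. by move=> h; rewrite /step flat_eq0 ?mul0r//; lra. Qed.

Lemma flat_generated_step a b : flat_generated (step a b).
Proof.
have FG1 : flat_generated (fun w : V => flat 0 (1 + (a + b * w.2))).
  apply: (flat_generated_affine 0 (a := 1 + a) (continuous_time_coord (k := b))) => w.
  by rewrite addrA.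
have FG2 : flat_generated (fun w : V => flat 0 (- (a + b * w.2))).
  apply: (flat_generated_affine 0 (a := - a) (continuous_time_coord (k := - b))) => w.
  by rewrite opprD -mulNr.
apply: FG_mul => //; apply: FG_inv; first exact: FG_add.
move=> w; rewrite gt_eqF//; set u := a + b * w.2.
have [u0|u0] := ltP u 0.
  by rewrite ltr_wpDl ?flat_ge0// flat0_gt0// oppr_gt0.
by rewrite ltr_pwDl ?flat_ge0// flat0_gt0//; lra.
Qed.

(** Multiplying by a cutoff in time that equals 1 on [0, T] makes the translated
    and reflected mollifier compactly supported, without creating any
    dependence on time in the slab. *)
Lemma moll_Cc_infty_slab r T (x0 : X) : 0 < r -> 0 < T ->
  Cc_infty_slab T (fun w : V => moll r (x0 - w.1)).
Proof.
move=> r0 T0.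
pose chi (w : V) := step 0 1 w * step T (-1) w.
exists (fun w => moll r (x0 - w.1) * chi w); split.
- apply: smooth_flat_generated; apply: FG_mul; last first.
    by apply: FG_mul; exact: flat_generated_step.
  apply: FG_mul; first exact: FG_cst.
  apply: flat_generated_prod => i; apply: FG_mul.
    apply: (flat_generated_affine 0 (a := r + x0 ord0 i)
      (continuous_space_coord (k := -1) (i := i))) => w.
    by rewrite -[RHS]/(r + x0 ord0 i + (-1) * w.1 ord0 i) !mxE; ring.
  apply: (flat_generated_affine 0 (a := r - x0 ord0 i)
    (continuous_space_coord (k := 1) (i := i))) => w.
  by rewrite -[RHS]/(r - x0 ord0 i + 1 * w.1 ord0 i) !mxE; ring.
- pose K1 : set X := [set x | `|x| <= `|x0| + r].
  pose K2 : set R := `[-1, T + 1]%classic.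
  have cK1 : compact K1.
    apply: bounded_closed_compact.
      by exists (`|x0| + r); split; [exact: num_real|move=> y hy x /le_trans; apply; exact: ltW].
    apply: (@closed_comp _ _ (fun x : X => `|x|) [set t : R | t <= `|x0| + r]).
      by move=> x _; exact: norm_continuous.
    exact: closed_le.
  have cK : compact (K1 `*` K2) by apply: compact_setX => //; exact: segment_compact.
  apply: (subclosed_compact _ cK); first exact: closed_closure.
  have clK : closed (K1 `*` K2).
    by apply: compact_closed => //; exact: norm_hausdorff.
  rewrite [X in _ `<=` X](closure_id _).1//; apply: closureS => -[x t] /= h.
  split => /=.
    rewrite /K1/= leNgt; apply/negP => hx; move/eqP: h; apply.
    rewrite moll_eq0 ?mul0r//.
    by have := ler_dist_dist x0 x; rewrite ler_norml => /andP[]; lra.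
  rewrite /K2/= in_itv/= !leNgt; apply/andP; split; apply/negP => ht; move/eqP: h; apply.
    by rewrite /chi step0 ?mul0r ?mulr0//=; lra.
  by rewrite /chi [step T _ _]step0 ?mulr0//=; lra.
- move=> x t /andP[t0 tT] /=; rewrite /chi !step1 ?mulr1//=; lra.
Qed.

End bump.

(** * The fractional Laplacian of a test function *)

Section fractional_laplacian_C11.
Variables (R : realType) (d : nat) (s : R).
Hypothesis d0 : (0 < d)%N.
Hypothesis s01 : 0 < s < 1.
Local Notation mu := (@lebesgue_rV R d).
Local Notation X := ('rV[R]_d).
Local Notation ker := (@ker R d s).
Local Notation kere := (@kere R d s).
Local Notation kap := (@kap R d s).
Implicit Types (x y z : X) (e : R).

Let ikap : mu.-itg kap. Proof. exact: itg_kap. Qed.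

Variables (J : X -> R) (M : R).
Hypothesis mJ : measurable_fun setT J.
Hypothesis CJ : C11 J M.

Let M0 : 0 <= M.
Proof. by have [h _ _] := CJ 0 0; exact: le_trans h. Qed.

Let bJ : bmeas J.
Proof. by split => //; exists M => x; have [] := CJ x 0. Qed.

(** The truncated fractional Laplacian (up to its constant), and the absolutely
    convergent form of its limit. *)
Definition Lape e x : R := \int[mu]_z (kere e z * (J x - J (x - z))).

Definition diff2 x z : R := J x - 2^-1 * (J (x + z) + J (x - z)).

Definition Lap x : R := \int[mu]_z (ker z * diff2 x z).

Let m_add : measurable_fun setT (fun w : X * X => J (w.1 + w.2)).
Proof. exact: (measurableT_comp mJ (@measurable_rV_add R d)). Qed.

Let m_sub : measurable_fun setT (fun w : X * X => J (w.1 - w.2)).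
Proof. exact: (measurableT_comp mJ (@measurable_rV_sub R d)). Qed.

Lemma measurable_diff2 : measurable_fun setT (fun w : X * X => diff2 w.1 w.2).
Proof.
apply: measurable_funB; first exact: (measurableT_comp mJ measurable_fst).
by apply: measurable_funM => //; exact: measurable_funD.
Qed.

Let m_diff2 x : measurable_fun setT (diff2 x).
Proof.
exact: (measurable_comp_pair measurable_diff2 (measurable_cst x) (@measurable_id _ _ setT)).
Qed.

Let m_shift x : measurable_fun setT (fun z => J (x - z)).
Proof. exact: (measurableT_comp mJ (measurable_rV_subr x)). Qed.

Lemma diff2_le x z : `|diff2 x z| <= 2 * M * Num.min 1 (`|z| ^+ 2).
Proof.
have [h0 _ h2] := CJ x z; have [hp _ _] := CJ (x + z) 0; have [hm _ _] := CJ (x - z) 0.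
rewrite /diff2; have [z1|z1] := leP 1 (`|z| ^+ 2).
  rewrite mulr1 (le_trans (ler_normB _ _))// normrM (ger0_norm (_ : 0 <= 2^-1))//.
  by have := ler_normD (J (x + z)) (J (x - z)); lra.
rewrite (_ : _ - _ = - (2^-1 * (J (x + z) + J (x - z) - 2 * J x))); last by field.
rewrite normrN normrM (ger0_norm (_ : 0 <= 2^-1))//.
have := mulr_ge0 M0 (sqr_ge0 `|z|); lra.
Qed.

Lemma ker_diff2_le x z : `|ker z * diff2 x z| <= 2 * M * kap z.
Proof.
rewrite normrM (ger0_norm (ker_ge0 s z)) mulrC.
apply: (le_trans (ler_wpM2r (ker_ge0 s z) (diff2_le x z))).
rewrite -(mulrA (2 * M)); apply: ler_wpM2l; first by rewrite mulr_ge0.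
exact: ker_min_le_kap.
Qed.

Lemma itg_ker_diff2 x : mu.-itg (fun z => ker z * diff2 x z).
Proof.
apply: (itg_dom (g := fun z => 2 * M * kap z)) => [|| z].
- by apply: measurable_funM => //; exact: measurable_ker.
- exact: itgZ.
- exact: ker_diff2_le.
Qed.

Lemma measurable_Lap : measurable_fun setT Lap.
Proof.
refine (@measurable_int2 _ _ _ _ _ mu (fun w : X * X => ker w.2 * diff2 w.1 w.2) _).
apply: measurable_funM; last exact: measurable_diff2.
exact: (measurableT_comp (@measurable_ker R d s) measurable_snd).
Qed.

Lemma bmeas_Lap : bmeas Lap.
Proof.
split; first exact: measurable_Lap.
exists (\int[mu]_z (2 * M * kap z)) => x; apply: norm_int_le.
- by apply: measurable_funM => //; exact: measurable_ker.
- exact: itgZ.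
- by move=> z; exact: ker_diff2_le.
Qed.

(** The truncated kernel is integrable and even: average over z and - z. *)
Lemma Lape_diff2 e x : 0 < e -> Lape e x = \int[mu]_z (kere e z * diff2 x z).
Proof.
move=> e0; have ik : mu.-itg (kere e) by exact: itg_kere.
have mk : measurable_fun setT (kere e) by exact: measurable_kere.
have bm : bmeas (fun z => J x - J (x - z)).
  by apply: bmeasB; [exact: bmeas_cst|exact: (bmeas_comp bJ (measurable_rV_subr x))].
have m_p : measurable_fun setT (fun z : X => x + z).
  by under eq_fun do rewrite addrC; exact: measurable_rV_addr.
have bp : bmeas (fun z => J x - J (x + z)).
  by apply: bmeasB; [exact: bmeas_cst|exact: (bmeas_comp bJ m_p)].
have im := itg_bmeasM bm ik; have ip := itg_bmeasM bp ik.
have E : Lape e x = \int[mu]_z (kere e z * (J x - J (x + z))).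
  rewrite -(int_opp (itg_measurable ip)).
  by apply: eq_Rintegral => z _; rewrite kereN.
have -> : Lape e x = 2^-1 * (Lape e x + \int[mu]_z (kere e z * (J x - J (x + z)))).
  by rewrite -E; field.
rewrite /Lape -(intD im ip) -intZ; last exact: itgD.
by apply: eq_Rintegral => z _; rewrite /diff2; field.
Qed.

Definition tail e : R := \int[mu]_z (if enorm z <= e then kap z else 0).

Let m_tail e : measurable_fun setT (fun z => if enorm z <= e then kap z else 0).
Proof.
apply: measurable_fun_ifT => //; last exact: measurable_kap.
by apply: measurable_fun_ler => //; exact: measurable_enorm.
Qed.

Let i_tail e : mu.-itg (fun z => if enorm z <= e then kap z else 0).
Proof.
apply: (itg_dom (m_tail e) ikap) => z; case: ifP => _; rewrite ?normr0 ?kap_ge0//.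
by rewrite ger0_norm ?kap_ge0.
Qed.

Lemma tail_ge0 e : 0 <= tail e.
Proof. by apply: int_ge0 => z; case: ifP => // _; exact: kap_ge0. Qed.

Lemma tail_nondecreasing e e' : e <= e' -> tail e <= tail e'.
Proof.
move=> ee'; apply: le_int => // z; case: ifPn => ze.
  by rewrite (le_trans ze ee').
by case: ifP => // _; exact: kap_ge0.
Qed.

Lemma tail_cvg0 (eps : R) : 0 < eps -> exists2 e : R, 0 < e <= 1 & tail e <= eps.
Proof.
move=> eps0.
have : tail n.+1%:R^-1 @[n --> \oo] --> \int[mu]_z (0 : R).
  apply: (dominated_int_cvg (g := kap)) => //.
  - move=> z; apply: cvg_near_cst.
    have [->|z0] := eqVneq z 0.
      apply: nearW => n; case: ifP => // _.
      rewrite /kap normr0 expr0n/= min_r//; first by rewrite mul0r.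
    have ez : 0 < enorm z by apply: lt_le_trans (norm_le_enorm z); rewrite normr_gt0.
    exists (Num.truncn (enorm z)^-1) => // n /= nn; rewrite ifF//.
    apply/negbTE; rewrite -ltNge invf_plt ?posrE//.
    by apply: (lt_le_trans (truncnS_gt _)); rewrite ler_nat ltnS.
  - move=> n z; case: ifP => _; rewrite ?normr0 ?kap_ge0//.
    by rewrite ger0_norm ?kap_ge0.
rewrite Rintegral_cst// mul0r => /cvgrPdist_le/(_ eps eps0)[N _ /(_ N (leqnn _))] /=.
rewrite sub0r normrN => h; exists N.+1%:R^-1.
  by rewrite invr_gt0 ltr0n/= invf_le1// ler1n.
by apply: le_trans h; exact: ler_norm.
Qed.

Lemma Lap_dist e x : 0 < e <= 1 -> `|Lap x - Lape e x| <= 2 * M * tail e.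
Proof.
move=> /andP[e0 e1].
have ik : mu.-itg (fun z => kere e z * diff2 x z).
  apply: (itg_dom _ (itgZ (2 * M) ikap)) => [|z].
    by apply: measurable_funM => //; exact: measurable_kere.
  apply: le_trans (ker_diff2_le x z); rewrite !normrM ler_wpM2r//.
  by rewrite !ger0_norm ?kere_ge0 ?ker_ge0// kere_le_ker.
rewrite Lape_diff2// /Lap -(intB (itg_ker_diff2 x) ik) /tail -intZ//.
apply: norm_int_le => [||z]; last 1 first.
- rewrite /kere; have [ze|ze] := leP (enorm z) e.
    by rewrite mul0r subr0 ker_diff2_le.
  by rewrite subrr normr0 mulr0.
- by apply: itg_measurable; exact: itgB (itg_ker_diff2 x) ik.
- exact: itgZ.
Qed.

(** Far from the support of J both forms only see increments of norm larger
    than 1. *)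
Lemma Lap_eq_Lape e x (r : R) : 0 < e <= 1 -> (forall y, r <= `|y| -> J y = 0) ->
  r + 1 <= `|x| -> Lap x = Lape e x.
Proof.
move=> /andP[e0 e1] Jr rx; rewrite Lape_diff2//; apply: eq_Rintegral => z _.
rewrite /kere; have [ze|//] := leP (enorm z) e.
suff -> : diff2 x z = 0 by rewrite !mulr0.
have z1 : `|z| <= 1 by rewrite (le_trans (norm_le_enorm z))// (le_trans ze).
rewrite /diff2 !Jr; first by ring.
- by have := ler_normB (x - z) (- z); rewrite opprK subrK normrN; lra.
- have := ler_normB (x + z) z; rewrite addrK; lra.
- lra.
Qed.

(** The principal value is Lap because the truncation error is controlled by
    the tail of kap. Reflected translates are the functions that turn
    integrals against the operator into convolutions. *)
Lemma frac_lap_reflect (x0 x : X) :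
  frac_lap s (fun y => J (x0 - y)) x = frac_lap_const d s * Lap (x0 - x).
Proof.
rewrite /frac_lap; congr (_ * _); apply: cvg_lim => //.
have E (e : R) : 0 < e ->
  \int[mu]_(y in [set y | e < enorm (x - y)])
    ((J (x0 - x) - J (x0 - y)) / enorm (x - y) `^ (d%:R + 2 * s)) = Lape e (x0 - x).
  move=> e0; rewrite Rintegral_mkcond.
  pose g z := kere e z * (J (x0 - x) - J (x0 - x + z)).
  have mg : measurable_fun setT g.
    apply: measurable_funM; first exact: measurable_kere.
    have mp : measurable_fun setT (fun z : X => x0 - x + z).
      by under eq_fun do rewrite addrC; exact: measurable_rV_addr.
    by apply: measurable_funB => //; exact: (measurableT_comp mJ mp).
  transitivity (\int[mu]_y g (x - y)).
    apply: eq_Rintegral => y _; rewrite patchE /g /kere.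
    have -> : x0 - x + (x - y) = x0 - y by rewrite addrA subrK.
    have [h|h] := ltP e (enorm (x - y)); first by rewrite mem_set// /ker mulrC.
    by rewrite memNset ?mul0r//=; apply/negP; rewrite -leNgt.
  rewrite (int_reflect x mg) -(int_opp mg); apply: eq_Rintegral => z _.
  by rewrite /g kereN.
apply/cvgrPdist_le => eps eps0.
have M10 : 0 < 2 * M + 1 by rewrite ltr_wpDl// mulr_ge0.
have [e /andP[e0 e1] te] := tail_cvg0 (divr_gt0 eps0 M10).
near=> e'; have e'0 : 0 < e' by near: e'; exact: nbhs_right_gt.
have e'e : e' <= e by near: e'; exact: nbhs_right_le.
rewrite E//; apply: (le_trans (Lap_dist _ _)); first by rewrite e'0 (le_trans e'e).
move: te; rewrite ler_pdivlMr// mulrDr mulr1 => te.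
have := ler_wpM2l (mulr_ge0 (ler0n R 2) M0) (tail_nondecreasing e'e).
have := tail_ge0 e; lra.
Unshelve. all: by end_near. Qed.

End fractional_laplacian_C11.

Lemma frac_lap_const_ge0 (R : realType) (d : nat) (s : R) : 0 <= s ->
  0 <= frac_lap_const d s.
Proof.
have G (x : R) : 0 <= Gamma x.
  by apply: Rintegral_ge0 => t _; rewrite mulr_ge0 ?powR_ge0 ?expR_ge0.
move=> s0; rewrite /frac_lap_const divr_ge0//.
  by rewrite mulr_ge0// mulr_ge0// powR_ge0.
by rewrite mulr_ge0// powR_ge0.
Qed.

(** * Mollification of a weak solution *)

Section mollification.
Variables (R : realType) (d : nat) (s : R).
Hypothesis d0 : (0 < d)%N.
Hypothesis s01 : 0 < s < 1.
Local Notation mu := (@lebesgue_rV R d).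
Local Notation lam := (@lebesgue_measure R).
Local Notation X := ('rV[R]_d).
Local Notation XT := ('rV[R]_d * measurableTypeR R)%type.
Local Notation wt := (@wt R d s).
Local Notation kere := (@kere R d s).
Local Notation wnorm := (@wnorm R d s).
Local Notation wmod := (@wmod R d s).
Implicit Types (f : XT -> R) (h : X -> R) (x y z : X) (t : R).

Let iw : mu.-itg wt. Proof. exact: itg_wt. Qed.

Definition mollf (r : R) h x : R := \int[mu]_y (moll r (x - y) * h y).

(** Mollification in space alone: the equation will be tested with functions
    that do not depend on time. *)
Definition mollst (r : R) f (w : XT) : R := mollf r (fun y => f (y, w.2)) w.1.

Section fixed_radius.
Variables (r : R) (r0 : 0 < r).
Local Notation J := (@moll R d r).

Let iJ : mu.-itg J. Proof. exact: itg_moll. Qed.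
Let mJ : measurable_fun setT J. Proof. exact: measurable_moll. Qed.
Let bJ : bmeas J. Proof. exact: bmeas_moll. Qed.

Let iJs x : mu.-itg (fun y => J (x - y)). Proof. exact: (itg_reflect x iJ). Qed.

Let int_Js x : \int[mu]_y J (x - y) = 1.
Proof. by rewrite (int_reflect x mJ) int_moll. Qed.

Lemma itg_mollf h x : bmeas h -> mu.-itg (fun y => J (x - y) * h y).
Proof. by move=> bh; exact: itg_bmeasM. Qed.

Lemma norm_mollf_le h x (M : R) : bmeas h -> (forall y, `|h y| <= M) ->
  `|mollf r h x| <= M.
Proof.
move=> bh hM; rewrite -[leRHS]mulr1 -(int_Js x) -(intZ M (iJs x)).
apply: norm_int_le; [exact: itg_measurable (itg_mollf x bh)|exact: itgZ|] => y.
by rewrite normrM ger0_norm ?moll_ge0// mulrC ler_wpM2r// moll_ge0.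
Qed.

Lemma bmeas_mollst f : bmeas f -> bmeas (mollst r f).
Proof.
move=> bf; have [mf [M Mf]] := bf; split; last first.
  by exists M => -[x t]; apply: norm_mollf_le => //; exact: bmeas_sect2.
refine (@measurable_int2 _ _ _ _ _ mu
  (fun v : XT * X => J (v.1.1 - v.2) * f (v.2, v.1.2)) _).
have m11 : measurable_fun setT (fun v : XT * X => v.1.1).
  exact: (measurableT_comp measurable_fst measurable_fst).
have m12 : measurable_fun setT (fun v : XT * X => v.1.2).
  exact: (measurableT_comp measurable_snd measurable_fst).
apply: measurable_funM.
  apply: (measurableT_comp mJ).
  exact: (measurable_comp_pair (@measurable_rV_sub R d) m11 measurable_snd).
exact: (measurable_comp_pair mf measurable_snd m12).
Qed.

Lemma bmeas_mollf h : bmeas h -> bmeas (mollf r h).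
Proof.
move=> bh; apply: (bmeas_sect2 0 (f := mollst r (fun w => h w.1))).
apply: bmeas_mollst; exact: (bmeas_comp bh measurable_fst).
Qed.

(** The error is an average, weighted by the mollifier, of translation errors. *)
Lemma wnorm_mollf_le h (e : R) : bmeas h ->
  (forall z, `|z| <= r -> wmod h z <= e) ->
  wnorm (fun x => mollf r h x - h x) <= e.
Proof.
move=> bh he; have [mh [M Mh]] := bh.
have M0 : 0 <= M := le_trans (normr_ge0 _) (Mh 0).
pose F (v : X * X) := J v.2 * (wt v.1 * `|h (v.1 - v.2) - h v.1|).
have mF : measurable_fun setT F.
  apply: measurable_funM; first exact: (measurableT_comp mJ measurable_snd).
  apply: measurable_funM; first exact: (measurableT_comp (@measurable_wt R d s) measurable_fst).
  apply: measurableT_comp => //; apply: measurable_funB.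
    exact: (measurableT_comp mh (@measurable_rV_sub R d)).
  exact: (measurableT_comp mh measurable_fst).
have hM x z : `|h (x - z) - h x| <= M + M by rewrite (le_trans (ler_normB _ _))// lerD.
have iF : (mu \x mu)%E.-itg F.
  refine (@itg_prodM _ _ _ _ _ mu mu F (fun x => (M + M) * wt x) J mF _ iJ _).
    exact: itgZ.
  move=> x z; rewrite /F/= (normrM (J z)) (normrM (wt x)) normr_id.
  rewrite (ger0_norm (moll_ge0 _ _)) (ger0_norm (wt_ge0 _ _)).
  rewrite mulrC ler_wpM2r ?moll_ge0// mulrC ler_wpM2r//.
have bd x : bmeas (fun z => h (x - z) - h x).
  apply: bmeasB; last exact: bmeas_cst.
  exact: (bmeas_comp bh (measurable_rV_subr x)).
have ibd x := itg_bmeasM (bd x) iJ.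
have E x : mollf r h x - h x = \int[mu]_z (J z * (h (x - z) - h x)).
  have mg : measurable_fun setT (fun z => J z * h (x - z)).
    apply: measurable_funM => //.
    exact: (measurableT_comp mh (measurable_rV_subr x)).
  have -> : mollf r h x = \int[mu]_z (J z * h (x - z)).
    rewrite -(int_reflect x mg); apply: eq_Rintegral => y _.
    by rewrite (_ : x - (x - y) = y)// opprB addrC subrK.
  have i1 : mu.-itg (fun z => J z * h (x - z)).
    apply: itg_bmeasM => //; exact: (bmeas_comp bh (measurable_rV_subr x)).
  have -> : h x = \int[mu]_z (h x * J z) by rewrite intZ// int_moll// mulr1.
  rewrite -(intB i1 (itgZ (h x) iJ)); apply: eq_Rintegral => z _.
  by rewrite intZ// int_moll// mulr1; ring.
have bhh := bmeasB (bmeas_mollf bh) bh.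
apply: (@le_trans _ _ (\int[mu]_x \int[mu]_z F (x, z))).
  apply: le_int => [||x]; [exact: itg_wnorm|exact: (itg_int2 iF)|].
  rewrite E /F/=.
  have ia : mu.-itg (fun z => J z * `|h (x - z) - h x|).
    by apply: itg_bmeasM => //; exact: bmeas_norm.
  have -> : \int[mu]_z (J z * (wt x * `|h (x - z) - h x|)) =
      wt x * \int[mu]_z (J z * `|h (x - z) - h x|).
    by rewrite -intZ//; apply: eq_Rintegral => z _; rewrite mulrCA.
  rewrite ler_wpM2l//; apply: norm_int_le => //; first exact: itg_measurable (ibd x).
  by move=> z; rewrite normrM ger0_norm// moll_ge0.
rewrite (int_swap iF) -[leRHS]mulr1 -(int_moll d r0) -(intZ e iJ).
apply: le_int => [||z]; [exact: (itg_int1 iF)|exact: itgZ|].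
have iz : mu.-itg (fun x => wt x * `|h (x - z) - h x|).
  by apply: (@itg_wnorm R d s s01 (fun x => h (x - z) - h x)); apply: bmeasB => //; exact: bmeas_shift.
rewrite /F/= (intZ (J z) iz) mulrC.
have [rz|/ltW zr] := leP r `|z|; first by rewrite moll_eq0// !mulr0.
by rewrite ler_wpM2r ?moll_ge0//; exact: he.
Qed.

Variables (e : R) (e0 : 0 < e).

Let ik : mu.-itg (kere e). Proof. exact: itg_kere. Qed.

(** Fubini, since the truncated kernel is integrable: the truncated operator may
    act on the mollifier or on the mollified function. *)
Lemma mollf_Lape h x : bmeas h ->
  \int[mu]_y (h y * Lape s J e (x - y)) =
  \int[mu]_z (kere e z * (mollf r h x - mollf r h (x - z))).
Proof.
move=> bh; have [mh [M Mh]] := bh.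
have M0 : 0 <= M := le_trans (normr_ge0 _) (Mh 0).
pose F (v : X * X) := h v.1 * (kere e v.2 * (J (x - v.1) - J (x - v.1 - v.2))).
have m1 : measurable_fun setT (fun v : X * X => x - v.1).
  exact: (measurableT_comp (measurable_rV_subr x) measurable_fst).
have mF : measurable_fun setT F.
  apply: measurable_funM; first exact: (measurableT_comp mh measurable_fst).
  apply: measurable_funM; first exact: (measurableT_comp (@measurable_kere R d s e) measurable_snd).
  apply: measurable_funB; first exact: (measurableT_comp mJ m1).
  apply: (measurableT_comp mJ).
  exact: (measurable_comp_pair (@measurable_rV_sub R d) m1 measurable_snd).
have xyz y z : x - y - z = x - z - y by rewrite addrAC.
have iF : (mu \x mu)%E.-itg F.
  apply: (itg_prod (b := fun z => (M * 2) * kere e z)) => //; first exact: itgZ.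
  move=> z.
  have id : mu.-itg (fun y => (M * kere e z) * (J (x - y) + J (x - z - y))).
    by apply: itgZ; exact: itgD.
  have -> : M * 2 * kere e z = \int[mu]_y ((M * kere e z) * (J (x - y) + J (x - z - y))).
    rewrite intZ; last exact: itgD.
    by rewrite (intD (iJs x) (iJs (x - z))) !int_Js; ring.
  rewrite EFin_int//; apply: ge0_le_integral => //.
  - apply/measurable_EFinP; apply: measurableT_comp => //.
    exact: (measurable_comp_pair mF (@measurable_id _ _ setT) (measurable_cst z)).
  - exact: measurable_int id.
  - move=> y _; rewrite lee_fin /F/= (normrM (h y)) (normrM (kere e z)).
    rewrite (ger0_norm (kere_ge0 _ _ _)) mulrA.
    apply: ler_pM => //; first by rewrite mulr_ge0 ?kere_ge0.
      by rewrite ler_wpM2r ?kere_ge0.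
    by rewrite xyz (le_trans (ler_normB _ _))// !ger0_norm ?moll_ge0.
transitivity (\int[mu]_y \int[mu]_z F (y, z)).
  apply: eq_Rintegral => y _; rewrite /Lape -intZ//.
  apply: itg_bmeasM => //; apply: bmeasB; first exact: bmeas_cst.
  exact: (bmeas_comp bJ (measurable_rV_subr (x - y))).
rewrite (int_swap iF); apply: eq_Rintegral => z _; rewrite /F/= /mollf.
have i1 := itg_mollf x bh; have i2 := itg_mollf (x - z) bh.
rewrite -(intB i1 i2) -(intZ _ (itgB i1 i2)); apply: eq_Rintegral => y _.
by rewrite xyz; ring.
Qed.

Variables (S : R) (f : XT -> R).
Hypothesis bf : bmeas f.

Let bfr : bmeas (mollst r f). Proof. exact: bmeas_mollst. Qed.

Lemma Ltrunc_primS_mollst x t : 0 <= t <= S ->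
  \int[lam]_q (btw t q * \int[mu]_y (f (y, q) * Lape s J e (x - y))) =
  Ltrunc s e (primS S (mollst r f)) (x, t).
Proof.
move=> tS; have [mfr [M Mfr]] := bfr.
pose g (v : X * measurableTypeR R) := mollst r f (x, v.2) - mollst r f (x - v.1, v.2).
have mg : measurable_fun setT g.
  apply: measurable_funB.
    exact: (measurable_comp_pair mfr (measurable_cst x) measurable_snd).
  apply: (measurable_comp_pair mfr _ measurable_snd).
  exact: (measurableT_comp (measurable_rV_subr x) measurable_fst).
have gM v : `|g v| <= M + M by rewrite (le_trans (ler_normB _ _))// lerD.
pose F (v : X * measurableTypeR R) := kere e v.1 * (btw t v.2 * g v).
have iF : (mu \x lam)%E.-itg F.
  refine (@itg_prodM _ _ _ _ _ mu lam F (fun z => (M + M) * kere e z) (btw t) _ _ _ _).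
  - apply: measurable_funM; first exact: (measurableT_comp (@measurable_kere R d s e) measurable_fst).
    apply: measurable_funM => //.
    by apply: measurable_btw_comp => //; exact: measurable_snd.
  - exact: itgZ.
  - exact: itg_btw.
  - move=> z q; have := gM (z, q); rewrite /F [(z, q).1]/= [(z, q).2]/=.
    set G := g _ => GM; rewrite 2!normrM (ger0_norm (kere_ge0 _ _ _)) (ger0_norm (btw_ge0 _ _)).
    rewrite [leRHS](_ : _ = kere e z * (btw t q * (M + M))); last ring.
    by rewrite ler_wpM2l ?kere_ge0// ler_wpM2l ?btw_ge0.
transitivity (\int[lam]_q \int[mu]_z F (z, q)).
  apply: eq_Rintegral => q _; rewrite (mollf_Lape x (bmeas_sect2 q bf)).
  have ig : mu.-itg (fun z => kere e z * g (z, q)).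
    apply: itg_bmeasM => //; split; last by exists (M + M).
    exact: (measurable_comp_pair mg (@measurable_id _ _ setT) (measurable_cst (q : measurableTypeR R))).
  by rewrite -(intZ _ ig); apply: eq_Rintegral => z _; rewrite /F /= mulrCA.
rewrite -(int_swap iF); apply: eq_Rintegral => z _.
have bq y : bmeas (fun q : measurableTypeR R => mollst r f (y, q)) by exact: bmeas_sect1.
have i1 := itg_btwM t (bq x); have i2 := itg_btwM t (bq (x - z)).
have E y : primS S (mollst r f) (y, t) = \int[lam]_q (btw t q * mollst r f (y, q)).
  by rewrite /primS [(y, t).2]/= [(y, t).1]/= {1}/btw tS mul1r.
rewrite [(x, t).1]/= [(x, t).2]/= (E x) (E (x - z)) -(intB i1 i2).
rewrite -(intZ _ (itgB i1 i2)); apply: eq_Rintegral => q _.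
by rewrite /F /g [(z, q).2]/= [(z, q).1]/= mulrBr.
Qed.

End fixed_radius.
End mollification.

Section regularized_equation.
Variables (R : realType) (d : nat) (s : R).
Hypothesis d0 : (0 < d)%N.
Hypothesis s01 : 0 < s < 1.
Local Notation mu := (@lebesgue_rV R d).
Local Notation lam := (@lebesgue_measure R).
Local Notation X := ('rV[R]_d).
Local Notation XT := ('rV[R]_d * measurableTypeR R)%type.
Local Notation wt := (@wt R d s).
Local Notation kere := (@kere R d s).
Implicit Types (x y z : X) (t : R) (e : R).

Let iw : mu.-itg wt. Proof. exact: itg_wt. Qed.

Variables (r : R) (r0 : 0 < r).
Local Notation J := (@moll R d r).
Local Notation Lap := (Lap s J).
Local Notation Lape := (Lape s J).

Let iJ : mu.-itg J. Proof. exact: itg_moll. Qed.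
Let mJ : measurable_fun setT J. Proof. exact: measurable_moll. Qed.

Lemma itg_Lape e : 0 < e -> mu.-itg (Lape e).
Proof.
move=> e0; have ik : mu.-itg (kere e) by exact: itg_kere.
pose F (v : X * X) := kere e v.2 * (J v.1 - J (v.1 - v.2)).
have mF : measurable_fun setT F.
  apply: measurable_funM; first exact: (measurableT_comp (@measurable_kere R d s e) measurable_snd).
  apply: measurable_funB; first exact: (measurableT_comp mJ measurable_fst).
  exact: (measurableT_comp mJ (@measurable_rV_sub R d)).
apply: (@itg_int2 _ _ _ _ _ mu mu F).
apply: (itg_prod (b := fun z => 2 * kere e z)) => //; first exact: itgZ.
move=> z; have iJs : mu.-itg (fun x => J (x - z)) by exact: (itg_shift (- z) iJ).
have id : mu.-itg (fun x => kere e z * (J x + J (x - z))).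
  by apply: itgZ; exact: itgD.
have -> : 2 * kere e z = \int[mu]_x (kere e z * (J x + J (x - z))).
  rewrite intZ; last exact: itgD.
  by rewrite (intD iJ iJs) (int_shift (- z) mJ) int_moll//; ring.
rewrite EFin_int//; apply: ge0_le_integral => //.
- apply/measurable_EFinP; apply: measurableT_comp => //.
  exact: (measurable_comp_pair mF (@measurable_id _ _ setT) (measurable_cst z)).
- exact: measurable_int id.
- move=> x _; rewrite lee_fin /F/= (normrM (kere e z)) (ger0_norm (kere_ge0 _ _ _)).
  rewrite ler_wpM2l ?kere_ge0// (le_trans (ler_normB _ _))//.
  by rewrite !ger0_norm ?moll_ge0.
Qed.

(** Lap is the limit of the integrable functions Lape, up to an error supported
    in a fixed ball. *)
Lemma Lap_Lape_ball : exists2 C : R, 0 <= C & forall e x, 0 < e <= 1 ->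
  `|Lap x - Lape e x| <= C * tail d s e * \1_[set x : X | `|x| < r + 1] x.
Proof.
have [M CM] := C11_moll d r.
have M0 : 0 <= M by have [h _ _] := CM 0 0; exact: le_trans h.
exists (2 * M); first exact: mulr_ge0.
move=> e x e01; rewrite indicE; have [xr|rx] := ltP `|x| (r + 1).
  by rewrite mem_set// mulr1; exact: Lap_dist.
rewrite memNset ?mulr0/=; last by apply/negP; rewrite -leNgt.
by rewrite (Lap_eq_Lape d0 s01 mJ CM e01 (moll_eq0 r0) rx) subrr normr0.
Qed.

Lemma itg_Lap : mu.-itg Lap.
Proof.
have [C C0 HC] := Lap_Lape_ball; have [M CM] := C11_moll d r.
have h1 : 0 < (1 : R) <= 1 by rewrite ltr01 lexx.
have r10 : 0 < r + 1 by rewrite addr_gt0.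
have iB := itgZ (C * tail d s 1) (itg_indic_ball d r10).
have iL := itg_Lape ltr01.
apply: (itg_dom _ (itgD (itg_norm iL) iB)) => [|x]; first exact: measurable_Lap.
have := HC 1 x h1; have := ler_normD (Lape 1 x) (Lap x - Lape 1 x).
rewrite addrC subrK; lra.
Qed.

Variables (S : R) (g : XT -> R).
Hypothesis bg : bmeas g.

(** Up to its constant, the fractional Laplacian of the mollification of g: the
    operator acts on the mollifier, as it does in the equation. *)
Definition Lapg (w : XT) : R := \int[mu]_y (g (y, w.2) * Lap (w.1 - y)).

Let iLs x : mu.-itg (fun y => Lap (x - y)). Proof. exact: (itg_reflect x itg_Lap). Qed.

Lemma bmeas_Lapg : bmeas Lapg.
Proof.
have [mg [M Mg]] := bg; have [M' CM'] := C11_moll d r.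
have mL : measurable_fun setT Lap by exact: measurable_Lap.
split.
  have m11 : measurable_fun setT (fun v : XT * X => v.1.1).
    exact: (measurableT_comp measurable_fst measurable_fst).
  have m12 : measurable_fun setT (fun v : XT * X => v.1.2).
    exact: (measurableT_comp measurable_snd measurable_fst).
  refine (@measurable_int2 _ _ _ _ _ mu
    (fun v : XT * X => g (v.2, v.1.2) * Lap (v.1.1 - v.2)) _).
  apply: measurable_funM; first exact: (measurable_comp_pair mg measurable_snd m12).
  apply: (measurableT_comp mL).
  exact: (measurable_comp_pair (@measurable_rV_sub R d) m11 measurable_snd).
exists (M * \int[mu]_y `|Lap y|) => -[x t].
have mn : measurable_fun setT (fun y => `|Lap y|) by exact: measurableT_comp.
rewrite -(int_reflect x mn) -intZ; last exact: itg_norm (iLs x).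
apply: norm_int_le => [||y]; last by rewrite normrM ler_wpM2r.
- apply: measurable_funM; first exact: (bmeas_sect2 t bg).1.
  exact: (measurableT_comp mL (measurable_rV_subr x)).
- by apply: itgZ; exact: itg_norm (iLs x).
Qed.

(** The truncation error is small uniformly in space and time, which allows the
    energy inequality to be applied to the truncated operator first. *)
Lemma primS_Lapg_dist : exists2 C : R, 0 <= C & forall e x t, 0 < e <= 1 ->
  0 <= t <= S ->
  `|primS S Lapg (x, t) - Ltrunc s e (primS S (mollst r g)) (x, t)| <= C * tail d s e.
Proof.
have [C C0 HC] := Lap_Lape_ball; have [mg [M Mg]] := bg.
have M0 : 0 <= M := le_trans (normr_ge0 _) (Mg (0, 0)).
have r10 : 0 < r + 1 by rewrite addr_gt0.
pose K := M * (C * (2 * (r + 1)) ^+ d).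
have K0 : 0 <= K by rewrite !mulr_ge0// exprn_ge0// mulr_ge0// ltW.
exists (K * `|S|); first exact: mulr_ge0.
move=> e x t e01 tS; have /andP[e0 e1] := e01.
have iLe : mu.-itg (fun y => Lape e (x - y)) by exact: (itg_reflect x (itg_Lape e0)).
pose D q : R := \int[mu]_y (g (y, q) * Lap (x - y)) - \int[mu]_y (g (y, q) * Lape e (x - y)).
have DK q : `|D q| <= K * tail d s e.
  have bq := bmeas_sect2 q bg.
  have i1 : mu.-itg (fun y => g (y, q) * Lap (x - y)).
    by under eq_fun do rewrite mulrC; exact: (itg_bmeasM bq (iLs x)).
  have i2 : mu.-itg (fun y => g (y, q) * Lape e (x - y)).
    by under eq_fun do rewrite mulrC; exact: (itg_bmeasM bq iLe).
  rewrite /D -(intB i1 i2).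
  have iB := itg_reflect x (itg_indic_ball d r10).
  apply: (@le_trans _ _ (\int[mu]_y ((M * (C * tail d s e)) * \1_[set x : X | `|x| < r + 1] (x - y)))).
    apply: norm_int_le => [||y]; first exact: itg_measurable (itgB i1 i2).
      exact: itgZ.
    rewrite -mulrBr (normrM (g (y, q))) -(mulrA M); apply: ler_pM => //.
    exact: HC.
  have mB : measurable_fun setT (\1_[set x : X | `|x| < r + 1] : X -> R).
    by apply: measurable_indic; exact: measurable_rV_ball.
  rewrite (intZ _ iB) (int_reflect x mB).
  rewrite int_indic_ball// /K; rewrite le_eqVlt; apply/orP; left; apply/eqP; ring.
have bG := bmeas_sect1 x bmeas_Lapg.
have bE : bmeas (fun q : measurableTypeR R => \int[mu]_y (g (y, q) * Lape e (x - y))).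
  rewrite (_ : (fun q => _) = fun q : measurableTypeR R =>
     \int[mu]_z (kere e z * (mollst r g (x, q) - mollst r g (x - z, q)))); last first.
    by apply/funext => q; rewrite (mollf_Lape d0 s01 r0 e0 x (bmeas_sect2 q bg)).
  exact: (bmeas_sect1 x (bmeas_Ltrunc d0 s01 e0 (bmeas_mollst r0 bg))).
have -> : primS S Lapg (x, t) = \int[lam]_q (btw t q * Lapg (x, q)).
  by rewrite /primS [(x, t).2]/= [(x, t).1]/= {1}/btw tS mul1r.
rewrite -(Ltrunc_primS_mollst d0 s01 r0 e0 bg x tS).
rewrite -(intB (itg_btwM t bG) (itg_btwM t bE)).
apply: (@le_trans _ _ (\int[lam]_q ((K * tail d s e) * btw t q))).
  apply: norm_int_le => [||q].
  - exact: itg_measurable (itgB (itg_btwM t bG) (itg_btwM t bE)).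
  - exact: itgZ (itg_btw t).
  - rewrite -mulrBr (normrM (btw t q)) (ger0_norm (btw_ge0 _ _)) mulrC.
    by rewrite ler_wpM2r ?btw_ge0//; exact: DK.
have /andP[t0 tS'] := tS.
rewrite (intZ _ (itg_btw t)) int_btw// mulrAC; apply: ler_wpM2r; first exact: tail_ge0.
by apply: ler_wpM2l => //; rewrite (le_trans tS')// ler_norm.
Qed.

Variables (c : R) (w : XT -> R).
Hypotheses (c0 : 0 <= c) (bw : bmeas w).
Hypothesis Hw : {ae lam, forall t, 0 < t -> forall x : X,
  mollst r w (x, t) = - c * prim (fun q => Lapg (x, q)) t}.

(** The equation for w replaces the nonlocal operator in the energy inequality
    for mollst r g, which passes to the limit of vanishing truncation. *)
Lemma regularized_energy (eta L : R) : 0 < S -> 0 < L -> 0 < eta ->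
  (2 * eta)^-1 <= L ->
  \int[lam]_t (th S L t * \int[mu]_x (wt x * (mollst r g (x, t) * mollst r w (x, t)))) <=
  c * eta * wtC0 d s *
  \int[lam]_t (th S L t * \int[mu]_x (wt x * mollst r g (x, t) ^+ 2)).
Proof.
move=> S0 L0 eta0 Leta.
have bgr := bmeas_mollst r0 bg; have bwr := bmeas_mollst r0 bw.
have bP := bmeas_primS S bmeas_Lapg.
have ith : lam.-itg (th S L) by exact: itg_th.
have ithf (f : XT -> R) : bmeas f ->
    lam.-itg (fun t => th S L t * \int[mu]_x (wt x * f (x, t))).
  by move=> bf; exact: (itg_bmeasM (bmeas_int_wt s01 bf) ith).
have bgP := bmeasM bgr bP; have bgw := bmeasM bgr bwr.
have -> : \int[lam]_t (th S L t * \int[mu]_x (wt x * (mollst r g (x, t) * mollst r w (x, t)))) =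
    \int[lam]_t ((- c) * (th S L t * \int[mu]_x (wt x * (mollst r g (x, t) * primS S Lapg (x, t))))).
  apply: int_ae_eq.
  - exact: itg_measurable (ithf _ bgw).
  - exact: itg_measurable (itgZ (- c) (ithf _ bgP)).
  refine (ae_mp2 (@ae_neq0 R) Hw _) => t t0 Ht.
  have [/andP[t0' tS]|h] := boolP (0 <= t <= S); last by rewrite (th_out L h) !mul0r mulr0.
  have tgt : 0 < t by rewrite lt_neqAle eq_sym t0.
  rewrite mulrCA; congr (_ * _); rewrite -intZ; last exact: (itg_bmeasM (bmeas_sect2 t bgP) iw).
  apply: eq_Rintegral => x _; rewrite Ht// /primS [(x, t).2]/= [(x, t).1]/=.
  by rewrite {1}/btw t0' tS mul1r; ring.
rewrite (intZ _ (ithf _ bgP)).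
set A := \int[lam]_t (th S L t * \int[mu]_x (wt x * mollst r g (x, t) ^+ 2)).
have [C C0 HC] := primS_Lapg_dist; have [_ [M Mg]] := bgr.
have M0 : 0 <= M := le_trans (normr_ge0 _) (Mg (0, 0)).
pose K := \int[lam]_t th S L t * (M * C * \int[mu]_x wt x).
have K0 : 0 <= K.
  by rewrite !mulr_ge0// ?int_ge0// => t; exact: th_ge0.
apply/ler_addgt0Pr => eps eps0.
have cK0 : 0 < c * K + 1 by rewrite ltr_wpDl// mulr_ge0.
have [e e01 te] := tail_cvg0 d s01 (divr_gt0 eps0 cK0); have /andP[e0 e1] := e01.
have en := energy_inequality d0 s01 S L0 bgr e0 eta0 Leta.
have bPr := bmeas_primS S bgr.
have bL : bmeas (Ltrunc s e (primS S (mollst r g))) by exact: bmeas_Ltrunc.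
have bgL := bmeasM bgr bL.
set E := \int[lam]_t (th S L t * \int[mu]_x (wt x * (mollst r g (x, t) * Ltrunc s e (primS S (mollst r g)) (x, t)))) in en.
set P := \int[lam]_t (th S L t * \int[mu]_x (wt x * (mollst r g (x, t) * primS S Lapg (x, t)))).
have EP : E - P <= K * tail d s e.
  rewrite -(intB (ithf _ bgL) (ithf _ bgP)).
  have ic := itgZ (M * (C * tail d s e) * \int[mu]_x wt x) ith.
  apply: (@le_trans _ _ (\int[lam]_t ((M * (C * tail d s e) * \int[mu]_x wt x) * th S L t))).
    apply: le_int => [|//|t]; first exact: itgB (ithf _ bgL) (ithf _ bgP).
    rewrite -mulrBr mulrC.
    have [tS|h] := boolP (0 <= t <= S); last by rewrite (th_out L h) !mulr0.
    apply: ler_wpM2r; first exact: th_ge0.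
    have i1 := itg_bmeasM (bmeas_sect2 t bgL) iw; have i2 := itg_bmeasM (bmeas_sect2 t bgP) iw.
    rewrite -(intB i1 i2) -(intZ _ iw).
    apply: le_int => [|//|x]; [exact: itgB i1 i2|exact: itgZ|].
    rewrite -mulrBr mulrC ler_wpM2r// -mulrBr.
    apply: (le_trans (ler_norm _)); rewrite (normrM (mollst r g (x, t))).
    by apply: ler_pM => //; rewrite distrC; exact: HC.
  rewrite (intZ _ ith) /K; rewrite le_eqVlt; apply/orP; left; apply/eqP; ring.
move: te; rewrite ler_pdivlMr// mulrDr mulr1 => te.
have := tail_ge0 d s e; have := ler_wpM2l c0 EP; have := ler_wpM2l c0 en.
rewrite -/A; lra.
Qed.

End regularized_equation.

Lemma LapgB (R : realType) (d : nat) (s r : R) (f h : 'rV[R]_d * measurableTypeR R -> R) w :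
  (0 < d)%N -> 0 < s < 1 -> 0 < r -> bmeas f -> bmeas h ->
  Lapg s r (fun z => f z - h z) w = Lapg s r f w - Lapg s r h w.
Proof.
move=> d0 s01 r0 bf bh; have iL := itg_reflect w.1 (itg_Lap d0 s01 r0).
have i1 := itg_bmeasM (bmeas_sect2 w.2 bf) iL.
have i2 := itg_bmeasM (bmeas_sect2 w.2 bh) iL.
transitivity (\int[lebesgue_rV d]_y
    (Lap s (moll r) (w.1 - y) * f (y, w.2) - Lap s (moll r) (w.1 - y) * h (y, w.2))).
  by apply: eq_Rintegral => y _; rewrite -mulrBr mulrC.
by rewrite (intB i1 i2) /Lapg; congr (_ - _); apply: eq_Rintegral => y _; rewrite mulrC.
Qed.

(** * Uniqueness for the regularized formulation *)

Section uniqueness_core.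
Variables (R : realType) (d : nat) (s : R).
Hypothesis d0 : (0 < d)%N.
Hypothesis s01 : 0 < s < 1.
Local Notation mu := (@lebesgue_rV R d).
Local Notation lam := (@lebesgue_measure R).
Local Notation X := ('rV[R]_d).
Local Notation XT := ('rV[R]_d * measurableTypeR R)%type.
Local Notation wt := (@wt R d s).
Local Notation wnorm := (@wnorm R d s).
Implicit Types (f h : XT -> R) (x y z : X) (t : R).

Let iw : mu.-itg wt. Proof. exact: itg_wt. Qed.

Let rad (n : nat) : R := n.+1%:R^-1.

Let rad_gt0 n : 0 < rad n. Proof. by rewrite invr_gt0 ltr0n. Qed.

Let cvg_scale (k l : R) (a : nat -> R) :
  a n @[n --> \oo] --> l -> (k * a n) @[n --> \oo] --> k * l.
Proof. by move=> al; apply: cvgM => //; exact: cvg_cst. Qed.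

Lemma wnorm_mollst_cvg0 f t : bmeas f ->
  wnorm (fun x => mollst (rad n) f (x, t) - f (x, t)) @[n --> \oo] --> 0.
Proof.
move=> bf; have bft := bmeas_sect2 t bf.
apply/cvgrPdist_le => eps eps0.
have [r /andP[r0 r1] rP] := bmeas_tcont s01 bft eps0.
exists (Num.truncn r^-1) => // n /= nn.
rewrite sub0r normrN ger0_norm ?wnorm_ge0//.
apply: (wnorm_mollf_le s01 (rad_gt0 n) bft) => z zr; apply: rP.
apply: (le_trans zr); rewrite /rad invf_ple ?posrE// ltW//.
by apply: (lt_le_trans (truncnS_gt _)); rewrite ler_nat ltnS.
Qed.

Section time_weight.
Variables (S L : R) (S0 : 0 < S) (L0 : 0 < L).
Local Notation th := (@th R S L).

Let ith : lam.-itg th. Proof. exact: itg_th. Qed.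

Definition wpair f h t : R := \int[mu]_x (wt x * (f (x, t) * h (x, t))).

Lemma bmeas_wpair f h : bmeas f -> bmeas h ->
  bmeas (wpair f h : measurableTypeR R -> R).
Proof. by move=> bf bh; exact: (bmeas_int_wt s01 (bmeasM bf bh)). Qed.

Lemma itg_th_wpair f h : bmeas f -> bmeas h -> lam.-itg (fun t => th t * wpair f h t).
Proof. by move=> bf bh; exact: (itg_bmeasM (bmeas_wpair bf bh) ith). Qed.

Lemma wpair_mollst_cvg f h t : bmeas f -> bmeas h ->
  wpair (mollst (rad n) f) (mollst (rad n) h) t @[n --> \oo] --> wpair f h t.
Proof.
move=> bf bh; have [_ [M Mf]] := bf; have [_ [N Nh]] := bh.
have M0 : 0 <= M := le_trans (normr_ge0 _) (Mf (0, 0)).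
have N0 : 0 <= N := le_trans (normr_ge0 _) (Nh (0, 0)).
have fM n x : `|mollst (rad n) f (x, t)| <= M.
  by apply: norm_mollf_le => //; exact: bmeas_sect2.
pose a n := wnorm (fun x => mollst (rad n) f (x, t) - f (x, t)).
pose b n := wnorm (fun x => mollst (rad n) h (x, t) - h (x, t)).
have ab : (N * a n + M * b n) @[n --> \oo] --> 0.
  have ca := wnorm_mollst_cvg0 t bf; have cb := wnorm_mollst_cvg0 t bh.
  have := cvgD (cvg_scale (k := N) ca) (cvg_scale (k := M) cb).
  by rewrite !mulr0 addr0; apply.
apply/cvgrPdist_le => eps eps0.
move/cvgrPdist_le : ab => /(_ eps eps0) [k _ kP]; exists k => // n /kP /=.
rewrite sub0r normrN => /(le_trans (ler_norm _)); apply: le_trans.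
have bfn := bmeas_mollst (rad_gt0 n) bf; have bhn := bmeas_mollst (rad_gt0 n) bh.
have i1 := itg_bmeasM (bmeas_sect2 t (bmeasM bf bh)) iw.
have i2 := itg_bmeasM (bmeas_sect2 t (bmeasM bfn bhn)) iw.
have ja := itg_wnorm s01 (bmeas_sect2 t (bmeasB bfn bf)).
have jb := itg_wnorm s01 (bmeas_sect2 t (bmeasB bhn bh)).
rewrite /wpair -(intB i1 i2) /a /b /wnorm -(intZ N ja) -(intZ M jb).
rewrite -(intD (itgZ N ja) (itgZ M jb)).
apply: norm_int_le => [||x].
- exact: itg_measurable (itgB i1 i2).
- exact: itgD (itgZ N ja) (itgZ M jb).
set fn := mollst (rad n) f (x, t); set hn := mollst (rad n) h (x, t).
rewrite -mulrBr (normrM (wt x)) (ger0_norm (wt_ge0 _ _)).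
rewrite [leRHS](_ : _ = wt x * (`|fn - f (x, t)| * N + M * `|hn - h (x, t)|)); last ring.
rewrite ler_wpM2l// (_ : _ - _ = - ((fn - f (x, t)) * h (x, t) + fn * (hn - h (x, t)))); last ring.
rewrite normrN (le_trans (ler_normD _ _))// !normrM lerD// ler_pM//.
exact: fM.
Qed.

Lemma int_th_wpair_cvg f h : bmeas f -> bmeas h ->
  \int[lam]_t (th t * wpair (mollst (rad n) f) (mollst (rad n) h) t) @[n --> \oo] -->
  \int[lam]_t (th t * wpair f h t).
Proof.
move=> bf bh; have [_ [M Mf]] := bf; have [_ [N Nh]] := bh.
have M0 : 0 <= M := le_trans (normr_ge0 _) (Mf (0, 0)).
have N0 : 0 <= N := le_trans (normr_ge0 _) (Nh (0, 0)).
refine (@dominated_int_cvg _ _ _ lam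
  (fun n t => th t * wpair (mollst (rad n) f) (mollst (rad n) h) t) _
  (fun t => (M * N * \int[mu]_x wt x) * th t) _ _ _ _).
- move=> n; apply: itg_measurable (itg_th_wpair _ _); exact: bmeas_mollst.
- by move=> t; exact: (cvg_scale (k := th t) (wpair_mollst_cvg bf bh)).
- exact: itgZ.
- move=> n t; rewrite (normrM (th t)) (ger0_norm (th_ge0 _ _ _)) mulrC.
  apply: ler_wpM2r; first exact: th_ge0.
  rewrite /wpair -(intZ _ iw).
  have bfn := bmeas_mollst (rad_gt0 n) bf; have bhn := bmeas_mollst (rad_gt0 n) bh.
  apply: norm_int_le => [||x].
  + apply: measurable_funM; first exact: measurable_wt.
    exact: (bmeas_sect2 t (bmeasM bfn bhn)).1.
  + exact: itgZ.
  + rewrite (normrM (wt x)) (ger0_norm (wt_ge0 _ _)) mulrC ler_wpM2r// normrM.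
    by apply: ler_pM => //; apply: norm_mollf_le => //; exact: bmeas_sect2.
Qed.

End time_weight.

(** In the limit of vanishing mollification the energy inequality bounds the
    pairing of g with w by a multiple of that of g with itself, hence by a
    multiple of itself because g ^+ 2 <= K (g w). The multiple can be made
    arbitrarily small at the price of a fast decaying weight in time, so that
    g vanishes; then so do the mollifications of w, by the equation. *)
Lemma uniqueness_core (w g : XT -> R) (c K S : R) :
  bmeas w -> bmeas g -> 0 <= c -> 0 < K -> 0 < S ->
  (forall v, g v ^+ 2 <= K * (g v * w v)) ->
  (forall r, 0 < r -> {ae lam, forall t, 0 < t -> forall x : X,
    mollst r w (x, t) = - c * prim (fun q => Lapg s r g (x, q)) t}) ->
  {ae lam, forall t, 0 < t < S -> wnorm (fun x => w (x, t)) = 0}.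
Proof.
move=> bw bg c0 K0 S0 gw Hw.
have C0 := wtC0_ge0 d s.
(* with this value the multiple is at most one half *)
pose eta : R := (2 * (c * wtC0 d s * K + 1))^-1.
have D0 : 0 < c * wtC0 d s * K + 1 by rewrite ltr_wpDl// !mulr_ge0// ltW.
have eta0 : 0 < eta by rewrite invr_gt0 mulr_gt0.
pose L := (2 * eta)^-1; have L0 : 0 < L by rewrite invr_gt0 mulr_gt0.
have ith : lam.-itg (th S L) by exact: itg_th.
pose I := \int[lam]_t (th S L t * wpair g w t).
pose A := \int[lam]_t (th S L t * wpair g g t).
have IA : I <= c * eta * wtC0 d s * A.
  have cI := int_th_wpair_cvg (S := S) L0 bg bw.
  have cA := cvg_scale (k := c * eta * wtC0 d s) (int_th_wpair_cvg (S := S) L0 bg bg).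
  apply: (ler_cvg_to cI cA); apply: nearW => n.
  have := regularized_energy d0 s01 (rad_gt0 n) bg c0 bw (Hw _ (rad_gt0 n)) S0 L0 eta0 (lexx _).
  rewrite /wpair; under [X in _ <= _ * X -> _]eq_Rintegral do under eq_Rintegral do rewrite expr2.
  exact.
have iI := itg_th_wpair S L0 bg bw.
have iA := itg_th_wpair S L0 bg bg.
have AI : A <= K * I.
  rewrite -(intZ _ iI); apply: le_int => [//||t]; first exact: itgZ.
  rewrite [leRHS]mulrCA; apply: ler_wpM2l; first exact: th_ge0.
  have i1 := itg_bmeasM (bmeas_sect2 t (bmeasM bg bw)) iw.
  have i2 := itg_bmeasM (bmeas_sect2 t (bmeasM bg bg)) iw.
  rewrite /wpair -(intZ _ i1); apply: le_int => [//||x]; first exact: itgZ.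
  by rewrite [leRHS]mulrCA ler_wpM2l// -expr2.
have gg0 t : 0 <= wpair g g t.
  by apply: int_ge0 => x; rewrite mulr_ge0// -expr2 sqr_ge0.
have A0 : A = 0.
  apply/le_anti; rewrite int_ge0 ?andbT; last by move=> t; rewrite mulr_ge0 ?th_ge0.
  have half : c * eta * wtC0 d s * K <= 2^-1.
    rewrite /eta (_ : _ * _ = (c * wtC0 d s * K) / (2 * (c * wtC0 d s * K + 1))); last ring.
    by rewrite ler_pdivrMr ?mulr_gt0//; lra.
  have cc : 0 <= c * eta * wtC0 d s by rewrite !mulr_ge0// ltW.
  have h1 := ler_wpM2l cc AI; rewrite mulrA in h1.
  have [I0|I0] := ltP I 0.
    by apply: (le_trans AI); rewrite pmulr_rle0// ltW.
  have h2 := ler_wpM2r I0 half.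
  have I0' : I = 0 by lra.
  by rewrite I0' mulr0 in AI.
have thg : {ae lam, forall t, th S L t * wpair g g t = 0}.
  by refine (int_ge0_eq0 iA _ A0) => t; rewrite mulr_ge0 ?th_ge0.
have gLap r : 0 < r -> {ae lam, forall t, forall x : X, 0 <= t < S -> Lapg s r g (x, t) = 0}.
  move=> r0; refine (ae_mp2 thg thg _) => t Et _ x tS.
  have /eqP := Et; rewrite mulf_eq0 gt_eqF ?th_gt0//= => /eqP Egg.
  have i2 := itg_bmeasM (bmeas_sect2 t (bmeasM bg bg)) iw.
  have ggx x' : 0 <= wt x' * (g (x', t) * g (x', t)) by rewrite mulr_ge0// -expr2 sqr_ge0.
  have gx0 := int_ge0_eq0 i2 ggx Egg.
  have -> : 0 = \int[mu]_y (0 : R) by rewrite Rintegral_cst// mul0r.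
  rewrite /Lapg; apply: int_ae_eq => //.
    apply: measurable_funM; first exact: (bmeas_sect2 t bg).1.
    have [M CM] := C11_moll d r.
    have [mL _] := bmeas_Lap s01 (measurable_moll r) CM.
    exact: (measurableT_comp mL (measurable_rV_subr x)).
  refine (ae_mp2 gx0 gx0 _) => y /eqP; rewrite mulf_eq0 gt_eqF//= mulf_eq0 orbb => /eqP -> _.
  by rewrite mul0r.
have w0 n : {ae lam, forall t, 0 < t < S -> forall x : X, mollst (rad n) w (x, t) = 0}.
  have h := gLap _ (rad_gt0 n); refine (ae_mp2 (Hw _ (rad_gt0 n)) (Hw _ (rad_gt0 n)) _).
  move=> t Ht _ /andP[t0 tS] x; rewrite Ht//.
  suff -> : prim (fun q => Lapg s (rad n) g (x, q)) t = 0 by rewrite mulr0.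
  rewrite /prim (_ : 0 = \int[lam]_q (0 : R)); last by rewrite Rintegral_cst// mul0r.
  apply: int_ae_eq => //.
    apply: measurable_funM; first exact: measurable_btw1.
    exact: (bmeas_sect1 x (bmeas_Lapg d0 s01 (rad_gt0 n) bg)).1.
  refine (ae_mp2 h h _) => q hq _; rewrite /btw; case: ifP => [/andP[q0 qt]|_].
    by rewrite hq ?mulr0// q0 (le_lt_trans qt).
  by rewrite mul0r.
have w0' : {ae lam, forall t, forall n, 0 < t < S -> forall x : X, mollst (rad n) w (x, t) = 0}.
  by apply: ae_foralln => n; exact: w0.
refine (ae_mp2 w0' w0' _) => t ht _ tS.
have := wnorm_mollst_cvg0 t bw.
rewrite (_ : (fun n => _) = fun _ => wnorm (fun x => w (x, t))).
  by move=> h; apply: (cvg_unique (@Rhausdorff R) _ h); exact: cvg_cst.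
apply/funext => n; apply: eq_Rintegral => x _.
by rewrite ht// sub0r normrN.
Qed.

End uniqueness_core.

(** * Bounded representatives and sections of null sets *)

Section representatives.
Variables (R : realType) (d : nat).
Local Notation mu := (@lebesgue_rV R d).
Local Notation lam := (@lebesgue_measure R).
Local Notation X := ('rV[R]_d).
Local Notation XT := ('rV[R]_d * measurableTypeR R)%type.

Lemma ae_sections (P : XT -> Prop) : {ae lebesgue_st d, forall z, P z} ->
  {ae lam, forall t, {ae mu, forall x, P (x, t)}}.
Proof.
move=> [N [mN N0 PN]].
have iN : (mu \x lam)%E.-itg (\1_N : XT -> R) by apply: itg_indic => //; rewrite N0.
have I0 : \int[(mu \x lam)%E]_z (\1_N z : R) = 0 by rewrite int_indic// N0.
rewrite (int_prod2 iN) in I0.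
have h1 : {ae lam, forall t, \int[mu]_x (\1_N (x, t) : R) = 0}.
  by refine (int_ge0_eq0 (itg_int1 iN) _ I0) => t; apply: int_ge0 => x.
refine (ae_mp2 h1 (ae_integrable2 iN) _) => t ht it.
have h2 := int_ge0_eq0 it (fun x => ler0n R _) ht.
refine (ae_mp2 h2 h2 _) => x; rewrite indicE => /eqP; rewrite pnatr_eq0 eqb0 => hx _.
by apply: contrapT => nP; move/negP: hx; apply; rewrite inE; apply: PN.
Qed.

Lemma Lfun_ae_bounded dT (T : measurableType dT) (m : {measure set T -> \bar R})
    (f : T -> R) : f \in Lfun m +oo%E -> exists M : R, {ae m, forall x, `|f x| <= M}.
Proof.
rewrite inE => /andP[_]; rewrite inE /= /finite_norm unlock.
(* the norm is 0 by convention when the whole space is null *)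
case: ifPn => [_ h|]; first by apply: ess_supr_bounded; exact: h.
rewrite lt0e negb_and negbK measure_ge0 orbF => /eqP m0 _.
by exists 0; exists setT; split.
Qed.

Definition clip (M : R) (a : R) : R := Num.max (- M) (Num.min M a).

Lemma clipE (M a : R) : `|a| <= M -> clip M a = a.
Proof. by rewrite ler_norml => /andP[h1 h2]; rewrite /clip (min_idPr h2) (max_idPr h1). Qed.

Lemma norm_clip_le (M a : R) : 0 <= M -> `|clip M a| <= M.
Proof.
move=> M0; rewrite ler_norml /clip le_max lexx/= ge_max ge_min lexx/= andbT.
by rewrite (le_trans _ M0)// oppr_le0.
Qed.

Lemma bmeas_clip dT (T : measurableType dT) (M : R) (f : T -> R) : 0 <= M ->
  measurable_fun setT f -> bmeas (fun x => clip M (f x)).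
Proof.
move=> M0 mf; split; last by exists M => x; exact: norm_clip_le.
by apply: measurable_maxr => //; exact: measurable_minr.
Qed.

End representatives.

(** Compactness handles the small increments; a large increment of Phi is at
    most its oscillation, by monotonicity. *)
Lemma locally_lipschitz_bounded (R : realType) (Phi : R -> R) (M : R) :
  {homo Phi : a b / a <= b} -> locally_lipschitz Phi ->
  exists2 K, 0 < K & forall a b, `|a| <= M -> `|b| <= M ->
    `|Phi a - Phi b| <= K * `|a - b|.
Proof.
move=> mono lip.
have cI : compact `[- M, M]%classic by exact: segment_compact.
pose P (e x : R) := forall y, `|x - y| < e -> `|Phi x - Phi y| <= e^-1 * `|x - y|.
have loc (x : R) : `[- M, M]%classic x -> \forall x' \near x & e \near (0 : R)^'+, P e x'.
  move=> _; have [A /nbhs_ballP[rho /= rho0 xA] [k [_ kA]]] := lip x.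
  have r20 : 0 < rho / 2 by rewrite divr_gt0.
  pose k1 := `|k| + 1; have k10 : 0 < k1 by rewrite ltr_wpDl.
  exists (ball x (rho / 2), [set e | 0 < e /\ e <= Num.min (rho / 2) k1^-1]) => /=.
    split; first exact: nbhsx_ballx.
    near=> e; split; first by near: e; exact: nbhs_right_gt.
    by near: e; apply: nbhs_right_le; rewrite lt_min r20 invr_gt0.
  move=> [x' e] /= [xx' [e0]]; rewrite le_min => /andP[er ek] y yx.
  have Ax' : A x' by apply: xA; apply: le_ball xx'; lra.
  have Ay : A y.
    apply: xA; rewrite /ball/= in xx' *.
    have -> : x - y = (x - x') + (x' - y) by ring.
    by rewrite (le_lt_trans (ler_normD _ _))//; lra.
  have := kA k1 _ (x', y) (conj Ax' Ay) => /= h; apply: (le_trans (h _)).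
    by rewrite /k1; have := ler_norm k; lra.
  by rewrite ler_wpM2r// -[leLHS]invrK lef_pV2// posrE ?invr_gt0.
have [e [e0 eP]] : exists e, 0 < e /\ `[- M, M]%classic `<=` P e.
  have := (compact_near_coveringP _).1 cI R (0 : R)^'+ P _ loc => h.
  near (0 : R)^'+ => e; exists e; split; last by near: e; exact: h.
  by near: e; exact: nbhs_right_gt.
pose V : R := `|Phi M - Phi (- M)|.
have Ve : 0 <= V / e by rewrite divr_ge0 ?normr_ge0// ltW.
exists (e^-1 + V / e) => [|a b aM bM]; first by rewrite ltr_wpDr// invr_gt0.
rewrite mulrDl; have [ab|ab] := ltP `|a - b| e.
  apply: (@le_trans _ _ (e^-1 * `|a - b|)).
    by refine (eP a _ b ab); rewrite /= in_itv/= -ler_norml.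
  by rewrite lerDl mulr_ge0.
apply: (@le_trans _ _ (V / e * `|a - b|)); last first.
  by rewrite lerDr mulr_ge0// invr_ge0 ltW.
apply: (@le_trans _ _ V).
  move: aM bM; rewrite !ler_norml => /andP[a1 a2] /andP[b1 b2].
  have := mono _ _ a1; have := mono _ _ a2; have := mono _ _ b1; have := mono _ _ b2.
  move=> h1 h2 h3 h4.
  have -> : V = Phi M - Phi (- M) by rewrite /V ger0_norm// subr_ge0 (le_trans h2).
  by apply/andP; split; lra.
by rewrite -mulrA ler_peMr ?normr_ge0// mulrC ler_pdivlMr// mul1r.
Unshelve. all: by end_near. Qed.

Lemma locally_lipschitz_continuous (R : realType) (Phi : R -> R) :
  locally_lipschitz Phi -> continuous Phi.
Proof.
move=> lip x; have [A Ax [k [_ kA]]] := lip x.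
have k10 : 0 < `|k| + 1 by rewrite ltr_wpDl.
apply/cvgrPdist_le => eps eps0; near=> y.
have Ay : A y by near: y.
have := kA (`|k| + 1) _ (x, y) (conj (nbhs_singleton Ax) Ay) => /= h.
apply: (le_trans (h _)); first by have := ler_norm k; lra.
rewrite mulrC -ler_pdivlMr//; near: y; apply: cvgr_dist_le => //.
by rewrite divr_gt0.
Unshelve. all: by end_near. Qed.

(** * Testing the equation with translated mollifiers *)

Section tested_equation.
Variables (R : realType) (d : nat) (s : R).
Hypothesis d0 : (0 < d)%N.
Hypothesis s01 : 0 < s < 1.
Local Notation mu := (@lebesgue_rV R d).
Local Notation lam := (@lebesgue_measure R).
Local Notation X := ('rV[R]_d).
Local Notation XT := ('rV[R]_d * measurableTypeR R)%type.
Variables (Phi : R -> R) (u0 : X -> R).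
Hypothesis Phi_mono : {homo Phi : a b / a <= b}.
Hypothesis Phi_lip : locally_lipschitz Phi.

Let mPhi : measurable_fun setT Phi.
Proof. exact: continuous_measurable_fun (locally_lipschitz_continuous Phi_lip). Qed.

Lemma bmeas_homo_comp dT (T : measurableType dT) (f : T -> R) :
  bmeas f -> bmeas (fun x => Phi (f x)).
Proof.
move=> [mf [M Mf]]; split; first exact: measurableT_comp.
exists (`|Phi M| + `|Phi (- M)|) => x.
have := Mf x; rewrite ler_norml => /andP[/Phi_mono h1 /Phi_mono h2].
have := ler_norm (Phi M); have := ler_norm (- Phi (- M)); rewrite normrN.
have := normr_ge0 (Phi M); have := normr_ge0 (Phi (- M)).
by rewrite ler_norml => *; apply/andP; split; lra.
Qed.

Let measurable_fst_comp (f : X -> R) :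
  measurable_fun setT f -> measurable_fun setT (fun z : XT => f z.1).
Proof. by move=> mf; exact: (measurableT_comp mf measurable_fst). Qed.

Section one_solution.
Variables (u : X * R -> R) (M : R).
Hypothesis M0 : 0 <= M.
Hypothesis weak : very_weak_solution s Phi u0 u.
Local Notation ub := (u \_ (upper_half d)).
Hypothesis uM : {ae lebesgue_st d, forall z, `|ub z| <= M}.

(** A bounded and jointly measurable representative of the solution, which is
    only prescribed almost everywhere and for positive times. *)
Definition urep (z : XT) : R := clip M (ub z).

Let mub : measurable_fun (setT : set XT) ub.
Proof. by case: weak; rewrite inE => /andP[+ _] _; rewrite inE. Qed.

Lemma bmeas_urep : bmeas urep.
Proof. exact: bmeas_clip. Qed.

Let ubE x t : 0 < t -> ub (x, t) = u (x, t).
Proof. by move=> t0; rewrite patchE mem_set. Qed.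

Lemma urepE : {ae lebesgue_st d, forall z, upper_half d z -> urep z = u z}.
Proof.
refine (ae_mp2 uM uM _) => -[x t] h _ /= t0.
by rewrite /urep clipE// ubE.
Qed.

Let urep_sect : {ae lam, forall t, {ae mu, forall x, 0 < t -> urep (x, t) = u (x, t)}}.
Proof. exact: ae_sections urepE. Qed.

Let mu_sect t : 0 < t -> measurable_fun setT (fun x => u (x, t)).
Proof.
move=> t0; under eq_fun do rewrite -(ubE _ t0).
apply: (measurableT_comp mub); exact: (@measurable_fun_pair).
Qed.

(** A test function that does not depend on time annihilates the left-hand side,
    and with the mollifier reflected at x the other terms are the values at x
    of convolutions. *)
Lemma tested_equation (r : R) : 0 < r -> {ae lam, forall t, 0 < t -> forall x : X,
  mollst r urep (x, t) = \int[mu]_y (u0 y * moll r (x - y)) -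
    frac_lap_const d s * prim (fun q => Lapg s r (fun z => Phi (urep z)) (x, q)) t}.
Proof.
move=> r0; have [_ eqn] := weak.
refine (ae_mp2 eqn urep_sect _) => T eqT uT T0 x0.
have [N CN] := C11_moll d r.
have mJ := @measurable_moll R d r.
have [mL _] := bmeas_Lap s01 mJ CN.
have mLx : measurable_fun setT (fun x : X => Lap s (moll r) (x0 - x)).
  exact: (measurableT_comp mL (measurable_rV_subr x0)).
have mJx : measurable_fun setT (fun x : X => moll r (x0 - x)).
  exact: (measurableT_comp mJ (measurable_rV_subr x0)).
have := eqT T0 _ (moll_Cc_infty_slab x0 r0 T0) => /=.
under eq_Rintegral do under eq_Rintegral do rewrite derive1_cst mulr0.
under eq_Rintegral do rewrite Rintegral_cst// mul0r.
rewrite Rintegral_cst// mul0r.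
under [X in _ = X + _ - _ -> _]eq_Rintegral do
  under eq_Rintegral do rewrite (frac_lap_reflect d0 s01 mJ CN).
have -> : \int[mu]_x (u (x, T) * moll r (x0 - x)) = mollst r urep (x0, T).
  apply: int_ae_eq.
  - by apply: measurable_funM => //; exact: mu_sect.
  - apply: measurable_funM => //; exact: (bmeas_sect2 T bmeas_urep).1.
  - by refine (ae_mp2 uT uT _) => x h _; rewrite mulrC h.
have -> : \int[lam]_(t in `[0, T]) \int[mu]_x
    (Phi (u (x, t)) * (frac_lap_const d s * Lap s (moll r) (x0 - x))) =
    frac_lap_const d s * prim (fun q => Lapg s r (fun z => Phi (urep z)) (x0, q)) T.
  set c := frac_lap_const d s.
  have bPu : bmeas (fun z => Phi (urep z)) by exact: bmeas_homo_comp bmeas_urep.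
  have bG := bmeas_sect1 x0 (bmeas_Lapg d0 s01 r0 bPu).
  rewrite /prim -(intZ c (itg_btwM T bG)) Rintegral_mkcond.
  pose h (t : measurableTypeR R) := \int[mu]_x (Phi (ub (x, t)) * (c * Lap s (moll r) (x0 - x))).
  have mh : measurable_fun setT h.
    refine (@measurable_int1 _ _ _ _ _ mu
      (fun z : XT => Phi (ub z) * (c * Lap s (moll r) (x0 - z.1))) _).
    apply: measurable_funM; first exact: measurableT_comp.
    have mcL := measurable_funM (@measurable_cst _ _ X R setT c) mLx.
    exact: (measurable_fst_comp mcL).
  (* the solution is arbitrary at time 0, which contributes a single value b *)
  pose b := \int[mu]_x (Phi (u (x, 0)) * (c * Lap s (moll r) (x0 - x))).
  have E : (fun t => \int[mu]_x (Phi (u (x, t)) * (c * Lap s (moll r) (x0 - x)))) \_ `[0, T] =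
      fun t => if t == 0 then b else btw T t * h t.
    apply/funext => t; rewrite patchE; have [->|t0] := eqVneq t 0.
      by rewrite mem_set//= in_itv/= lexx ltW.
    rewrite /btw; case: ifPn => [|tT].
      rewrite inE /= in_itv/= => tT; rewrite tT mul1r; apply: eq_Rintegral => x _.
      by rewrite ubE// lt_neqAle eq_sym t0; case/andP: tT.
    by rewrite ifF ?mul0r//; apply: contraNF tT => tT; rewrite mem_set//= in_itv.
  rewrite E; apply: int_ae_eq.
  - apply: measurable_fun_ifT => //.
      exact: measurable_fun_eqr.
    by apply: measurable_funM => //; exact: measurable_btw1.
  - by apply: measurable_funM => //; apply: measurable_funM => //; [exact: measurable_btw1|exact: bG.1].
  - refine (ae_mp2 urep_sect (@ae_neq0 R) _) => t ut t0; rewrite (negbTE t0).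
    rewrite mulrCA /btw; case: ifPn => [/andP[t1 _]|_]; last by rewrite !mul0r.
    have tp : 0 < t by rewrite lt_neqAle eq_sym t0.
    rewrite !mul1r /h /Lapg.
    have ig := itg_bmeasM (bmeas_sect2 t bPu) (itg_reflect x0 (itg_Lap d0 s01 r0)).
    under [X in _ = c * X]eq_Rintegral do rewrite mulrC.
    rewrite -(intZ c ig).
    apply: int_ae_eq.
    + apply: measurable_funM; last exact: measurable_funM.
      by apply: measurableT_comp => //; under eq_fun do rewrite ubE//; exact: mu_sect.
    + apply: measurable_funM => //.
      by apply: measurable_funM => //; exact: (bmeas_sect2 t bPu).1.
    + by refine (ae_mp2 ut ut _) => x hx _; rewrite /= ubE// hx// (mulrC (Phi _)) mulrA.
by move=> /eqP; rewrite eq_sym subr_eq0 addrC => /eqP <-; rewrite addrK.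
Qed.

End one_solution.
End tested_equation.

(** * Uniqueness *)

Section vanishing.
Variables (R : realType) (d : nat) (s : R).
Hypothesis s01 : 0 < s < 1.
Local Notation mu := (@lebesgue_rV R d).
Local Notation lam := (@lebesgue_measure R).
Local Notation X := ('rV[R]_d).
Local Notation XT := ('rV[R]_d * measurableTypeR R)%type.
Local Notation wt := (@wt R d s).

(** The weighted norms of the slices up to any time n assemble into the integral
    over space and time of a nonnegative function; the weight is positive. *)
Lemma wnorm_eq0_ae (f : XT -> R) : bmeas f ->
  (forall S, 0 < S -> {ae lam, forall t, 0 < t < S -> wnorm s (fun x => f (x, t)) = 0}) ->
  {ae lebesgue_st d, forall z, upper_half d z -> f z = 0}.
Proof.
move=> bf fS; have [mf [N Nf]] := bf.
have iw : mu.-itg wt by exact: itg_wt.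
pose F (n : nat) (z : XT) := wt z.1 * `|f z| * btw n%:R z.2.
have mF n : measurable_fun setT (F n).
  apply: measurable_funM.
    apply: measurable_funM; first exact: (measurableT_comp (@measurable_wt R d s) measurable_fst).
    exact: (bmeas_norm bf).1.
  exact: (measurable_btw_comp (measurable_cst _) measurable_snd).
have iF n : (mu \x lam)%E.-itg (F n).
  refine (@itg_prodM _ _ _ _ _ mu lam (F n) (fun x => N * wt x) (fun t => btw n%:R t) _ _ _ _).
  - exact: mF.
  - exact: itgZ.
  - exact: itg_btw.
  - move=> x t; rewrite /F ger0_norm; last by rewrite !mulr_ge0 ?wt_ge0 ?btw_ge0.
    by rewrite ler_wpM2r ?btw_ge0// mulrC ler_wpM2r ?wt_ge0.
have F0 n : {ae lebesgue_st d, forall z, F n z = 0}.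
  refine (int_ge0_eq0 (iF n) _ _) => [z|].
    by rewrite /F !mulr_ge0 ?wt_ge0 ?btw_ge0.
  rewrite (int_prod2 (iF n)) (_ : 0 = \int[lam]_q (0 : R)); last by rewrite Rintegral_cst// mul0r.
  apply: int_ae_eq => //.
    exact: itg_measurable (itg_int1 (iF n)).
  refine (ae_mp2 (fS n.+1%:R (ltr0Sn _ _)) (@ae_neq0 R) _) => t ft t0.
  rewrite /F; have [/andP[t1 tn]|tn] := boolP (0 <= t <= n%:R); last first.
    under eq_Rintegral do rewrite /btw /= (negbTE tn) mulr0.
    by rewrite Rintegral_cst// mul0r.
  under eq_Rintegral do rewrite /btw /= t1 tn mulr1.
  apply: ft; rewrite lt_neqAle eq_sym t0 t1/=.
  by apply: (le_lt_trans tn); rewrite ltr_nat.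
have F0' : {ae lebesgue_st d, forall z, forall n, F n z = 0}.
  by apply: ae_foralln => n; exact: F0.
refine (ae_mp2 F0' F0' _) => -[x t] h _ /= t0.
have /eqP := h (Num.truncn t).+1; rewrite /F /btw /= ifT; last first.
  by rewrite ltW//= ltW// truncnS_gt.
by rewrite mulr1 mulf_eq0 gt_eqF ?wt_gt0//= normr_eq0 => /eqP.
Qed.

End vanishing.

Theorem theorem1p3 (R : realType) (d : nat) (s : R) (u0 : 'rV[R]_d -> R)
    (Phi : R -> R) (u v : 'rV[R]_d * R -> R) :
  (0 < d)%N ->
  0 < s < 1 ->
  u0 \in Lfun (lebesgue_rV d) +oo%E ->
  {homo Phi : a b / a <= b} ->
  locally_lipschitz Phi ->
  very_weak_solution s Phi u0 u ->
  very_weak_solution s Phi u0 v ->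
  {ae lebesgue_st d, forall z, upper_half d z -> u z = v z}.
Proof.
move=> d0 s01 _ mono lip Hu Hv.
have [Mu uMu] := Lfun_ae_bounded Hu.1; have [Mv vMv] := Lfun_ae_bounded Hv.1.
pose M := Num.max 0 (Num.max Mu Mv).
have M0 : 0 <= M by rewrite le_max lexx.
have uM : {ae lebesgue_st d, forall z, `|(u \_ (upper_half d)) z| <= M}.
  by refine (ae_mp2 uMu uMu _) => z h _; rewrite !le_max h !orbT.
have vM : {ae lebesgue_st d, forall z, `|(v \_ (upper_half d)) z| <= M}.
  by refine (ae_mp2 vMv vMv _) => z h _; rewrite !le_max h !orbT.
pose U := urep u M; pose V := urep v M.
have bU : bmeas U by exact: bmeas_urep M0 Hu.
have bV : bmeas V by exact: bmeas_urep M0 Hv.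
have [K K0 KP] := locally_lipschitz_bounded M mono lip.
have bPU := bmeas_homo_comp mono lip bU; have bPV := bmeas_homo_comp mono lip bV.
pose w z := U z - V z; pose g z := Phi (U z) - Phi (V z).
have bw : bmeas w := bmeasB bU bV.
have bg : bmeas g := bmeasB bPU bPV.
(* monotonicity gives the sign of g w, the Lipschitz bound the size of g *)
have gw z : g z ^+ 2 <= K * (g z * w z).
  have h : `|g z| <= K * `|w z| by apply: KP; exact: norm_clip_le.
  have gw0 : 0 <= g z * w z.
    have [UV|/ltW UV] := leP (U z) (V z).
      by rewrite mulr_le0// subr_le0// mono.
    by rewrite mulr_ge0// subr_ge0// mono.
  rewrite -(ger0_norm gw0) (normrM (g z)) -(real_normK (num_real (g z))) expr2 mulrCA.
  by rewrite ler_wpM2l.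
have Hw r : 0 < r -> {ae lebesgue_measure, forall t, 0 < t -> forall x,
    mollst r w (x, t) =
    - frac_lap_const d s * prim (fun q => Lapg s r g (x, q)) t}.
  move=> r0.
  refine (ae_mp2 (tested_equation d0 s01 mono lip M0 Hu uM r0)
                 (tested_equation d0 s01 mono lip M0 Hv vM r0) _) => t hu hv t0 x.
  have -> : mollst r w (x, t) = mollst r U (x, t) - mollst r V (x, t).
    rewrite /mollst /mollf.
    rewrite -(intB (itg_mollf r0 x (bmeas_sect2 t bU)) (itg_mollf r0 x (bmeas_sect2 t bV))).
    by apply: eq_Rintegral => y _; rewrite -mulrBr.
  rewrite (hu t0) (hv t0).
  have bGU := bmeas_sect1 x (bmeas_Lapg d0 s01 r0 bPU).
  have bGV := bmeas_sect1 x (bmeas_Lapg d0 s01 r0 bPV).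
  have -> : prim (fun q => Lapg s r g (x, q)) t =
      prim (fun q => Lapg s r (fun z => Phi (U z)) (x, q)) t -
      prim (fun q => Lapg s r (fun z => Phi (V z)) (x, q)) t.
    rewrite /prim -(intB (itg_btwM t bGU) (itg_btwM t bGV)).
    apply: eq_Rintegral => q _; rewrite -mulrBr; congr (_ * _).
    exact: LapgB.
  have E (a c p q : R) : a - c * p - (a - c * q) = - c * (p - q) by ring.
  exact: E.
have c0 : 0 <= frac_lap_const d s.
  by apply: frac_lap_const_ge0; case/andP: s01 => /ltW.
have w0 := wnorm_eq0_ae s01 bw (fun S S0 => uniqueness_core d0 s01 bw bg c0 K0 S0 gw Hw).
have UVuv : {ae lebesgue_st d, forall z, upper_half d z -> U z = u z /\ V z = v z}.
  refine (ae_mp2 (urepE uM) (urepE vM) _) => z h1 h2 hz.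
  by split; [exact: h1|exact: h2].
refine (ae_mp2 w0 UVuv _) => z wz h hz.
have [<- <-] := h hz; apply/eqP; rewrite -subr_eq0; apply/eqP; exact: wz.
Qed.
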